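(* Let $q$ be a radial potential as described in the context, with $1\le r_0<r_1$ or $r_0=r_1=\infty$ (the hard wall at the unit circle is at or inside the inner boundary of the annular droplet). Let $Z_N^{\rm h}[q(r)]$ be the $\beta=2$ partition function with hard wall at the unit circle, and $\eta=1-q'(1)/2$. Then, as $N\to\infty$: (i) If $r_0>1$ (equivalently $\eta>1$), $$\begin{aligned} \log\Big(\frac{Z_N^{\rm h}[q(r)]}{(2\pi)^N}\Big)=&-N^2q(1)-N\log N+N\big(1-\log2+(\eta-1)\log(\eta-1)-\eta\log\eta\big)\\ &+\frac12\log\frac{\eta-1}{\eta}+\frac{\Delta Q(1)}{4\eta(1-\eta)}+o(1). \end{aligned}$$ (ii) If $r_0=1$ (equivalently $\eta=1$), $$\begin{aligned} \log\Big(\frac{Z_N^{\rm h}[q(r)]}{(2\pi)^N}\Big)=&-N^2q(1)-N\log N-N(\log2-1)-\sqrt N\,\gamma^{\rm out}\sqrt{\Delta Q(1)}-\tfrac14\log N\\ &-\alpha^{\rm out}+\beta^{\rm out}\frac{\partial_r\Delta Q(1)}{\Delta Q(1)}+\frac{\Delta Q(1)}{4}+\frac14\log\Big(\frac{\pi\Delta Q(1)}{2}\Big)+o(1). \end{aligned}$$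
   Context: Setting. $Q(z)=q(|z|)$ is a radially symmetric potential, $q$ independent of $N$ and smooth on $(0,\infty)$, strictly subharmonic: $\Delta Q(r):=\frac1r(rq'(r))'=q''(r)+\frac{q'(r)}{r}>0$. We regard $\Delta Q$ as a function of $r=|z|$, and $\partial_r\Delta Q$ is its radial derivative. $r_0$ is the smallest non-negative solution of $q'(r_0)=0$ and $r_1$ is the unique solution of $r_1q'(r_1)=2$; $r_0$ and/or $r_1$ are set equal to $\infty$ if there is no finite solution. $\mathbb D=\{z\in\mathbb{C}:|z|\le1\}$ is the closed unit disk and $d^2z$ is Lebesgue measure on $\mathbb C$. Partition function: $$Z_N^{\rm h}[q(r)]=\frac1{N!}\int_{\mathbb D^N}e^{-N\sum_{j=1}^Nq(|z_j|)}\prod_{1\le j<k\le N}|z_k-z_j|^2\,d^2z_1\cdots d^2z_N .$$ Universal constants: with $\Phi(x)=\log(\frac12\operatorname{erfc}(x))$, so $\Phi'(x)=-\frac{2e^{-x^2}}{\sqrt\pi\operatorname{erfc}(x)}$, $$\alpha^{\rm out}=\int_0^\infty\Big(\frac13\big[x(2x^2-3)+(x^2-2)\Phi'(x)\big]-\frac1{x+1}\Big)dx,\quad\beta^{\rm out}=-\frac16\int_0^\infty\big[x(2x^2+3)+(x^2+1)\Phi'(x)\big]dx,$$ $$\gamma^{\rm out}=-\frac1{\sqrt2}\int_0^\infty\log\big(\sqrt\pi\,x\,e^{x^2}\operatorname{erfc}(x)\big)dx.$$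
   Formalization: In the case r_0 = r_1 = ∞ the condition q'(1) < 0 is added; without it q(r) = log(1+r) has r_0 = r_1 = ∞ but η = 3/4, so the equivalence with η > 1 fails and log(η−1) is undefined. *)

(* Defs.v *)
From HB Require Import structures.
From mathcomp Require Import all_boot all_order all_algebra.
From mathcomp Require Import all_classical all_reals all_analysis.

Set Implicit Arguments.
Unset Strict Implicit.
Unset Printing Implicit Defensive.

Import Order.TTheory GRing.Theory Num.Theory.
Import numFieldNormedType.Exports.

Local Open Scope classical_set_scope.
Local Open Scope ring_scope.

Lemma sigma_finite_prod d1 d2 (T1 : measurableType d1)
    (T2 : measurableType d2) (R : realType)
    (m1 : {sigma_finite_measure set T1 -> \bar R})
    (m2 : {sigma_finite_measure set T2 -> \bar R}) :
  sigma_finite setT (m1 \x m2)%E.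
Proof.
have /sigma_finiteP[F [TF ndF Foo]] := sigma_finiteT m1.
have /sigma_finiteP[G [TG ndG Goo]] := sigma_finiteT m2.
exists (fun n => F n `*` G n).
  rewrite -setXTT TF TG; apply/seteqP; split => [[x y]|[x y]].
    move=> [/= [n _ Fnx] [k _ Gky]]; exists (maxn n k) => //; split.
      by move: x Fnx; exact/subsetPset/ndF/leq_maxl.
    by move: y Gky; exact/subsetPset/ndG/leq_maxr.
  by move=> [n _ []/= ? ?]; split; exists n.
move=> k; have [? ?] := Foo k; have [? ?] := Goo k.
split; first exact: measurableX.
by rewrite product_measure1E// lte_mul_pinfty// ge0_fin_numE.
Qed.

Section tuple_measure.
Context d (T : measurableType d) (R : realType).

Definition tcons n (p : T * n.-tuple T) : n.+1.-tuple T :=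
  [the n.+1.-tuple T of p.1 :: p.2].

(* The n-fold product measure on T^n.  Like the library's [\x], it is defined
   for any set function; it is shown below to be a sigma-finite measure when
   [mu] is, with the expected value on boxes. *)
Fixpoint tuple_measure (mu : set T -> \bar R) n : set (n.-tuple T) -> \bar R :=
  match n with
  | 0 => dirac [tuple]
  | m.+1 => pushforward (mu \x @tuple_measure mu m)%E (@tcons m)
  end.

End tuple_measure.

Arguments tuple_measure {d T R} mu n A.

Section tuple_measure_facts.
Context d (T : measurableType d) (R : realType).
Variable mu : {sigma_finite_measure set T -> \bar R}.

Lemma measurable_tcons n : measurable_fun setT (@tcons d T n).
Proof. by apply: measurable_cons. Qed.

Section step.
Variables (n : nat) (nu : {sigma_finite_measure set (n.-tuple T) -> \bar R}).

Definition tuple_step := pushforward (mu \x nu)%E (@tcons d T n).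

Let mf := @measurable_tcons n.

Let tuple_step0 : tuple_step set0 = 0%E.
Proof. by rewrite /tuple_step /pushforward preimage_set0 measure0. Qed.

Let tuple_step_ge0 A : (0 <= tuple_step A)%E.
Proof. exact: (measure_ge0 (mu \x nu)%E). Qed.

Let tuple_step_sigma_additive : semi_sigma_additive tuple_step.
Proof. exact: measure_semi_sigma_additive. Qed.

HB.instance Definition _ := isMeasure.Build _ _ _ tuple_step
  tuple_step0 tuple_step_ge0 tuple_step_sigma_additive.

Lemma measurable_tail m : measurable_fun setT
  (fun t : m.+1.-tuple T => (thead t, [tuple of behead t])).
Proof.
apply/measurable_fun_pairP; split => /=.
  exact: (measurable_tnth ord0).
exact: measurable_behead.
Qed.

Lemma tuple_step_sigma_finite : sigma_finite setT tuple_step.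
Proof.
have [F F_T mF] := sigma_finite_prod mu nu.
pose g (t : n.+1.-tuple T) := (thead t, [tuple of behead t]).
exists (fun i => g @^-1` F i).
  by rewrite -preimage_bigcup -F_T preimage_setT.
move=> i; have [mFi Fioo] := mF i; split.
  by rewrite -[X in measurable X]setTI; exact: measurable_tail.
rewrite /tuple_step /pushforward.
suff -> : @tcons d T n @^-1` (g @^-1` F i) = F i by [].
apply/seteqP; split => -[x t] /=; rewrite /g /tcons /=;
  have -> : thead [the n.+1.-tuple T of x :: t] = x by rewrite /thead (tnth_nth x).
  by have -> : [tuple of behead [the n.+1.-tuple T of x :: t]] = t by exact: val_inj.
by have -> : [tuple of behead [the n.+1.-tuple T of x :: t]] = t by exact: val_inj.
Qed.

HB.instance Definition _ := @Measure_isSigmaFinite.Build _ _ _ tuple_step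
  tuple_step_sigma_finite.

End step.

Lemma tuple_measureE n :
  {nu : {sigma_finite_measure set (n.-tuple T) -> \bar R} |
    tuple_measure mu n = nu}.
Proof.
elim: n => [|n [nu nuE]].
  by exists (@dirac _ (0.-tuple T) [tuple] R).
by exists (tuple_step nu); rewrite /= nuE.
Qed.

Section instances.
Variable n : nat.

Let tuple_measure0 : tuple_measure mu n set0 = 0%E.
Proof. by have [nu ->] := tuple_measureE n; exact: measure0. Qed.

Let tuple_measure_ge0 A : (0 <= tuple_measure mu n A)%E.
Proof. by have [nu ->] := tuple_measureE n; exact: measure_ge0. Qed.

Let tuple_measure_sigma_additive : semi_sigma_additive (tuple_measure mu n).
Proof.
by have [nu ->] := tuple_measureE n; exact: measure_semi_sigma_additive.
Qed.

HB.instance Definition _ := isMeasure.Build _ _ _ (tuple_measure mu n)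
  tuple_measure0 tuple_measure_ge0 tuple_measure_sigma_additive.

Let tuple_measure_sigma_finite : sigma_finite setT (tuple_measure mu n).
Proof. by have [nu ->] := tuple_measureE n; exact: sigma_finiteT. Qed.

HB.instance Definition _ := @Measure_isSigmaFinite.Build _ _ _
  (tuple_measure mu n) tuple_measure_sigma_finite.

End instances.

Lemma tuple_measure_box n (A : n.-tuple (set T)) :
  (forall i, measurable (tnth A i)) ->
  (tuple_measure mu n [set t : n.-tuple T | forall i, tnth A i (tnth t i)] =
   \prod_(i < n) mu (tnth A i))%E.
Proof.
elim: n A => [|n IH] A mA.
  rewrite big_ord0 /= diracE mem_set// => -[]//.
case/tupleP: A mA => B A mA.
have [nu nuE] := tuple_measureE n.
rewrite big_ord_recl/= /pushforward tnth0.
have -> : @tcons d T n @^-1`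
    [set t | forall i, tnth [tuple of B :: A] i (tnth t i)] =
    B `*` [set t : n.-tuple T | forall i, tnth A i (tnth t i)].
  apply/seteqP; split => -[x t] /=.
    move=> H; split; first by have := H ord0; rewrite !tnth0.
    by move=> i; have := H (lift ord0 i); rewrite !tnthS.
  move=> [Bx At] i; case: (unliftP ord0 i) => [j|] ->.
    by rewrite !tnthS; exact: At.
  by rewrite !tnth0.
have mB : measurable B by have := mA ord0; rewrite tnth0.
have mAi i : measurable (tnth A i) by have := mA (lift ord0 i); rewrite tnthS.
rewrite nuE product_measure1E//; last first.
  rewrite (_ : mkset _ = \bigcap_(i in [set: 'I_n])
      ((fun t : n.-tuple T => tnth t i) @^-1` tnth A i)).
    apply: fin_bigcap_measurable => // i _.
    by rewrite -[X in measurable X]setTI; exact: measurable_tnth.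
  by apply/seteqP; split => [t H i _|t H i]; [exact: H|exact: H i I].
rewrite -nuE (IH A mAi); congr (_ * _)%E.
by apply: eq_bigr => i _; rewrite tnthS.
Qed.

End tuple_measure_facts.

Section potential.
Context {R : realType}.
Implicit Type q : R -> R.

(* [q] is a total function, but only its values on (0, +oo) matter. *)
Definition smooth_pos q := forall n (x : R), 0 < x -> derivable (derive1n n q) x 1.

(* radial Laplacian of Q(z) = q(|z|), as a function of r = |z| *)
Definition laplQ q (r : R) : R := r^-1 * derive1 (fun s => s * derive1 q s) r.

Definition radial_potential q :=
  smooth_pos q /\ forall r : R, 0 < r -> 0 < laplQ q r.

(* q'(r) = 0 for r >= 0; since [q] is only given on (0, +oo), the value q'(0)
   is the limit of q' at 0 from the right. *)
Definition crit q (r : R) :=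
  0 < r /\ derive1 q r = 0 \/ r = 0 /\ derive1 q x @[x --> 0^'+] --> 0.

Definition inner_radius q (r0 : \bar R) :=
  (exists2 r, r0 = r%:E & crit q r /\ forall s, crit q s -> r <= s) \/
  (r0 = +oo%E /\ forall r, ~ crit q r).

Definition outer_radius q (r1 : \bar R) :=
  (exists2 r, r1 = r%:E & [/\ 0 < r, r * derive1 q r = 2 &
     forall s : R, 0 < s -> s * derive1 q s = 2 -> s = r]) \/
  (r1 = +oo%E /\ forall r : R, 0 < r -> r * derive1 q r <> 2).

Definition eta q : R := 1 - derive1 q 1 / 2.

End potential.

Section partition_function.
Context {R : realType}.
Implicit Types (q : R -> R) (z : R * R).

(* C is represented by R * R.  The norm of the product type R * R is the sup
   norm, so the complex modulus is defined here. *)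
Definition cmod z : R := Num.sqrt (z.1 ^+ 2 + z.2 ^+ 2).

(* [measurableTypeR R] is R with its Borel sigma-algebra. *)
Definition area : set (measurableTypeR R * measurableTypeR R) -> \bar R :=
  (@lebesgue_measure R \x @lebesgue_measure R)%E.

HB.instance Definition _ := Measure.copy area
  (@lebesgue_measure R \x @lebesgue_measure R)%E.

HB.instance Definition _ := @Measure_isSigmaFinite.Build _ _ _ area
  (sigma_finite_prod _ _).

Definition unit_disk : set (R * R) := [set z | cmod z <= 1].

Definition boltzmann q N (z : N.-tuple (R * R)) : R :=
  expR (- (N%:R * \sum_(j < N) q (cmod (tnth z j)))) *
  \prod_(j < N) \prod_(k < N | (j < k)%N) cmod (tnth z k - tnth z j) ^+ 2.

Definition Zhard q N : R :=
  (N`!)%:R^-1 *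
  \int[tuple_measure area N]_(z in
      [set z : N.-tuple (R * R) | forall j, unit_disk (tnth z j)])
    boltzmann q z.

End partition_function.

Section constants.
Context {R : realType}.
Implicit Type x : R.

Definition erfc x : R :=
  2 / Num.sqrt pi * \int[lebesgue_measure]_(t in `[x, +oo[) expR (- t ^+ 2).

Definition Phi x : R := ln (erfc x / 2).

Definition alpha_out : R :=
  \int[lebesgue_measure]_(x in `[0, +oo[)
    (3^-1 * (x * (2 * x ^+ 2 - 3) + (x ^+ 2 - 2) * derive1 Phi x) - (x + 1)^-1).

Definition beta_out : R :=
  - 6^-1 * \int[lebesgue_measure]_(x in `[0, +oo[)
    (x * (2 * x ^+ 2 + 3) + (x ^+ 2 + 1) * derive1 Phi x).

(* The integrand has a logarithmic singularity at 0, where the library's [ln]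
   takes the value 0; this does not affect the integral. *)
Definition gamma_out : R :=
  - (Num.sqrt 2)^-1 * \int[lebesgue_measure]_(x in `[0, +oo[)
    ln (Num.sqrt pi * x * expR (x ^+ 2) * erfc x).

End constants.

Section expansions.
Context {R : realType}.
Implicit Type q : R -> R.

Definition expansion_inside q (N : nat) : R :=
  let n : R := N%:R in let h := eta q in
  - n ^+ 2 * q 1 - n * ln n
  + n * (1 - ln 2 + (h - 1) * ln (h - 1) - h * ln h)
  + 2^-1 * ln ((h - 1) / h) + laplQ q 1 / (4 * h * (1 - h)).

Definition expansion_edge q (N : nat) : R :=
  let n : R := N%:R in let D := laplQ q 1 in
  - n ^+ 2 * q 1 - n * ln n - n * (ln 2 - 1)
  - Num.sqrt n * gamma_out * Num.sqrt D - 4^-1 * ln n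
  - alpha_out + beta_out * (derive1 (laplQ q) 1 / D) + D / 4
  + 4^-1 * ln (pi * D / 2).

End expansions.

(* Main.v *)
Require Import Defs.
From mathcomp Require Import all_boot all_order all_algebra perm.
From mathcomp Require Import all_classical all_reals all_analysis.
From mathcomp Require Import measurable_realfun ring lra complex.

Set Implicit Arguments.
Unset Strict Implicit.
Unset Printing Implicit Defensive.

Import Order.TTheory GRing.Theory Num.Theory.
Import numFieldNormedType.Exports.

Local Open Scope classical_set_scope.
Local Open Scope ring_scope.

(* The square of the Vandermonde product is |det|^2 and the area is invariant
   under rotations, so that only the diagonal terms of the double sum over
   permutations survive and [Zhard q N] is the product over [j < N] of the radial
   moments of e^{-N q} on the disk. Substituting |z| = e^{-d s}, such a moment is
     2 pi d e^{-N q(1)} int_0^oo exp(- 2 (j + 1) d s - N g(d s)) ds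
   with g(t) = q(e^{-t}) - q(1), which is convex with g'(0) = - q'(1),
   g''(0) = Delta Q(1) and g'''(0) = - (2 Delta Q(1) + d/dr Delta Q(1)).
   If q'(1) < 0, take d = 1/N: to the needed order the integral is a rational
   function of x = (j + 1) d. If q'(1) = 0, take d = sqrt(2 / (N Delta Q(1))): the
   integral is the Mills ratio e^{x^2} int_x^oo e^{-t^2} dt with a correction of
   order N^{-1/2} in its third moment. In both cases the relative error decays
   like (1 + x)^{-2} and the sum over j of the logarithms is computed with the
   trapezoidal rule. At the edge the antiderivatives involved produce
   gamma^out and beta^out, and integration by parts gives
   alpha^out = log(pi)/2 - 2 beta^out. *)

(** * Calculus on the half line *)

(** All estimates have to be uniform in j. The variable x = (j + 1) d stays in (0, 1] when d = 1/N,
    but reaches order sqrt N at the edge, so errors must be summable in x: a relative error e^2 (1 +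
    x)^{-2} sums to order e^2 / d, which tends to 0. This decay comes from keeping a factor s^2 in
    the pointwise error of the integrand: int s^2 e^{-(2 x + l) s} ds = 2 (2 x + l)^{-3}, whereas
    the integral itself is of order 1 / (1 + x). Convexity of g, which is subharmonicity of Q read
    in t = - log r, takes over where the Taylor expansion of g fails. At the edge d is the scale for
    which the quadratic term of N g(d s) is exactly s^2. The obstacle there is that the logarithm of
    the Mills ratio behaves like - log(2 x) and is not integrable: its antiderivative is
    renormalised by x log(2 x) - x, and the 1 / (2 x) term of the tail must be known exactly,
    because after division by d it contributes Delta Q(1) / 4. *)

Section pointwise_derivatives.
Context {R : realType}.
Implicit Types (f g A l : R -> R) (x a b c d C K : R).

Lemma isd_cst (c x : R) : is_derive x 1 (fun _ : R => c) 0.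
Proof. exact: is_derive_cst. Qed.

Lemma isd_id x : is_derive x 1 (fun y : R => y) 1.
Proof. exact: is_derive_id. Qed.

Lemma isd_add f g x a b : is_derive x 1 f a -> is_derive x 1 g b ->
  is_derive x 1 (fun y => f y + g y) (a + b).
Proof. by move=> fa gb; exact: is_deriveD. Qed.

Lemma isd_opp f x a : is_derive x 1 f a -> is_derive x 1 (fun y => - f y) (- a).
Proof. by move=> fa; exact: is_deriveN. Qed.

Lemma isd_mul f g x a b : is_derive x 1 f a -> is_derive x 1 g b ->
  is_derive x 1 (fun y => f y * g y) (f x * b + g x * a).
Proof. by move=> fa gb; exact: is_deriveM. Qed.

Lemma isd_exp f n x a : is_derive x 1 f a ->
  is_derive x 1 (fun y => f y ^+ n) (n%:R * f x ^+ n.-1 * a).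
Proof.
move=> fa; have -> : (fun y => f y ^+ n) = f ^+ n by apply/funext => y; rewrite exprfctE.
exact: is_deriveX.
Qed.

Lemma isd_comp f g x a b : is_derive (g x) 1 f a -> is_derive x 1 g b ->
  is_derive x 1 (fun y => f (g y)) (a * b).
Proof. by move=> fa gb; exact: is_derive1_comp. Qed.

Lemma isd_expR f x a : is_derive x 1 f a ->
  is_derive x 1 (fun y => expR (f y)) (expR (f x) * a).
Proof. by move=> fa; apply: isd_comp. Qed.

Lemma isd_ln f x a : 0 < f x -> is_derive x 1 f a ->
  is_derive x 1 (fun y => ln (f y)) ((f x)^-1 * a).
Proof. by move=> fx fa; apply: isd_comp; exact: is_derive1_ln. Qed.

Lemma isd_inv f x a : f x != 0 -> is_derive x 1 f a ->
  is_derive x 1 (fun y => (f y)^-1) (- (f x) ^- 2 * a).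
Proof. by move=> fx fa; exact: is_deriveV. Qed.

Lemma isd_near f g x a : (\forall y \near x, f y = g y) ->
  is_derive x 1 f a -> is_derive x 1 g a.
Proof.
by move=> fg fa; apply: (near_eq_is_derive (f := f)) => //; exact: oner_neq0.
Qed.

Lemma is_derive_continuous f x a : is_derive x 1 f a -> {for x, continuous f}.
Proof.
by move=> fa; apply: differentiable_continuous; apply/derivable1_diffP.
Qed.

Lemma is_derive_derive1 f x a : is_derive x 1 f a -> derive1 f x = a.
Proof. by move=> fa; rewrite derive1E; exact: derive_val. Qed.

End pointwise_derivatives.

(** Syntax-directed differentiation. The derivative is left to unification, so [isd] ends with an
    equation between the computed and the announced derivative, closed by [ring] or [field]; side
    conditions of inverses and logarithms come before it. Derivatives of named functions are looked
    up in the context, which is why proofs introduce them with [have] first. *)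
Ltac isd_step :=
  lazymatch goal with
  | |- is_derive _ _ (fun _ => ?c) _ => exact: isd_cst
  | |- is_derive _ _ (fun y => y) _ => exact: isd_id
  | |- is_derive _ _ (fun y => @GRing.add _ (@?f y) (@?g y)) _ =>
      eapply (@isd_add _ f g); isd_step
  | |- is_derive _ _ (fun y => @GRing.opp _ (@?f y)) _ =>
      eapply (@isd_opp _ f); isd_step
  | |- is_derive _ _ (fun y => @GRing.mul _ (@?f y) (@?g y)) _ =>
      eapply (@isd_mul _ f g); isd_step
  | |- is_derive _ _ (fun y => @GRing.exp _ (@?f y) ?n) _ =>
      eapply (@isd_exp _ f n); isd_step
  | |- is_derive _ _ (fun y => @GRing.inv _ (@?f y)) _ =>
      eapply (@isd_inv _ f); [ | isd_step]
  | |- is_derive _ _ (fun y => @expR _ (@?f y)) _ =>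
      eapply (@isd_expR _ f); isd_step
  | |- is_derive _ _ (fun y => @ln _ (@?f y)) _ =>
      eapply (@isd_ln _ f); [ | isd_step]
  | |- is_derive _ _ (fun y => ?f y) _ => eauto
  | |- is_derive _ _ (fun y => ?f (@?g y)) _ =>
      eapply (@isd_comp _ f g); [eauto | isd_step]
  | |- is_derive _ _ ?f _ => eauto
  end.
Ltac isd := eapply is_derive_eq; [isd_step | ].

Section calculus.
Context {R : realType}.
Implicit Types (f g A l : R -> R) (x a b c d C K : R).

Lemma eq_lerW a b : a = b -> a <= b. Proof. by move=> ->. Qed.

Lemma mvt_bound f (f' : R -> R) a b C : a <= b ->
  (forall x, a <= x <= b -> is_derive x 1 f (f' x)) ->
  (forall x, a <= x <= b -> `|f' x| <= C) -> `|f b - f a| <= C * (b - a).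
Proof.
move=> ab df fC.
have [|c|c] := @MVT_segment R f f' a b ab.
- by move=> x; rewrite in_itv/= => /andP[/ltW ? /ltW ?]; apply: df; apply/andP.
- apply: continuous_in_subspaceT => x; rewrite inE/= in_itv/= => xab.
  by apply: is_derive_continuous; exact: df.
rewrite in_itv/= => cab ->; rewrite normrM (ger0_norm (_ : 0 <= b - a)) ?subr_ge0//.
by rewrite ler_wpM2r ?subr_ge0// fC.
Qed.

Lemma derive_ge0_le f (f' : R -> R) a b : a <= b ->
  (forall x, a <= x <= b -> is_derive x 1 f (f' x)) ->
  (forall x, a <= x <= b -> 0 <= f' x) -> f a <= f b.
Proof.
move=> ab df f0.
have [|c|c] := @MVT_segment R f f' a b ab.
- by move=> x; rewrite in_itv/= => /andP[/ltW ? /ltW ?]; apply: df; apply/andP.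
- apply: continuous_in_subspaceT => x; rewrite inE/= in_itv/= => xab.
  by apply: is_derive_continuous; exact: df.
rewrite in_itv/= => cab /eqP; rewrite subr_eq => /eqP ->.
by rewrite lerDr mulr_ge0 ?f0 ?subr_ge0.
Qed.

(** Comparison with the integral of (1 + d y)^{-2}. It turns a relative error of size (1 + x)^{-2}
    into a total of order 1 / d, whatever N is. *)
Lemma sum_inv_sqr_le (d : R) N : 0 < d ->
  \sum_(0 <= k < N) (1 + d * k%:R) ^- 2 <= 1 + d^-1.
Proof.
move=> d0.
have pos k : 0 < 1 + d * k%:R by rewrite ltr_wpDr// mulr_ge0// ltW.
(* The induction carries the exact integral over [0, N]; the leading 1 is the term k = 0. *)
suff H : \sum_(0 <= k < N.+1) (1 + d * k%:R) ^- 2 <= 1 + d^-1 * (1 - (1 + d * N%:R)^-1).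
  rewrite big_nat_recr//= in H; apply: (le_trans _ (le_trans H _)); first by rewrite lerDl invr_ge0 exprn_ge0// ltW.
  rewrite lerD2l ler_piMr ?invr_ge0 ?(ltW d0)// gerBl invr_ge0 ltW//.
elim: N => [|N IH].
  by rewrite big_nat1 mulr0 addr0 invr1 expr1n invr1 subrr mulr0 addr0.
rewrite big_nat_recr//=; apply: (le_trans (lerD IH (lexx _))).
have p1 := pos N; have p2 := pos N.+1.
rewrite -natr1 in p2 *; set n := N%:R in p1 p2 *.
rewrite -addrA lerD2l -subr_ge0.
have -> : d^-1 * (1 - (1 + d * (n + 1))^-1) -
    (d^-1 * (1 - (1 + d * n)^-1) + (1 + d * (n + 1)) ^- 2) = d / ((1 + d * n) * (1 + d * (n + 1)) ^+ 2).
  by field; rewrite !gt_eqF.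
by rewrite divr_ge0 ?ltW// mulr_gt0// exprn_gt0.
Qed.

Lemma trapezoid_step A l (l1 l2 : R -> R) x d C : 0 <= d ->
  (forall y, x <= y <= x + d -> is_derive y 1 A (l y)) ->
  (forall y, x <= y <= x + d -> is_derive y 1 l (l1 y)) ->
  (forall y, x <= y <= x + d -> is_derive y 1 l1 (l2 y)) ->
  (forall y, x <= y <= x + d -> `|l2 y| <= C) ->
  `|A (x + d) - A x - d * (l x + l (x + d)) / 2| <= C * d ^+ 3.
Proof.
move=> d0 dA dl dl1 l2C.
have C0 : 0 <= C by rewrite (le_trans _ (l2C x _))// lexx lerDl.
(* The trapezoidal error as a function of the step h, up to its value at h = 0. Its derivative is
   half a first-order Taylor remainder of [l] about x + h, which two mean value estimates bound by C
   d h. *)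
pose psi h := A (x + h) - h * (l x + l (x + h)) / 2.
have dpsi (h : R) : 0 <= h <= d ->
    is_derive h 1 psi ((l (x + h) - l x - h * l1 (x + h)) / 2).
  move=> /andP[h0 hd].
  have xh : x <= x + h <= x + d by rewrite lerDl h0 lerD2l.
  have A' := dA _ xh; have l' := dl _ xh.
  by rewrite /psi; isd; field.
have := @mvt_bound psi _ 0 d (C * d ^+ 2) d0 dpsi.
rewrite subr0 -mulrA -exprSr /psi addr0 !mul0r subr0 (addrAC (A (x + d))); apply.
move=> h /andP[h0 hd].
have -> : l (x + h) - l x - h * l1 (x + h) =
    (l (x + h) - (x + h) * l1 (x + h)) - (l x - x * l1 (x + h)) by ring.
have H : `|(l (x + h) - (x + h) * l1 (x + h)) - (l x - x * l1 (x + h))| <=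
    C * d * (x + h - x).
  apply: (@mvt_bound (fun y => l y - y * l1 (x + h)) (fun y => l1 y - l1 (x + h))).
  - by rewrite lerDl.
  - move=> y /andP[xy yh].
    have l' : is_derive y 1 l (l1 y).
      by apply: dl; rewrite xy/= (le_trans yh)// lerD2l.
    by isd; ring.
  - move=> y /andP[xy yh]; rewrite distrC.
    apply: le_trans (_ : C * (x + h - y) <= _).
      apply: (mvt_bound (f' := l2)) => // z /andP[yz zh]; [apply: dl1|apply: l2C];
        by rewrite (le_trans xy yz) (le_trans zh)// lerD2l.
    by rewrite ler_wpM2l//; lra.
have -> : C * d ^+ 2 = C * d * d by ring.
rewrite normrM [`|2^-1|]ger0_norm ?invr_ge0//.
apply: le_trans (_ : C * d * (x + h - x) <= _).
  apply: le_trans H; rewrite ler_piMr// invf_le1//; lra.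
rewrite ler_wpM2l ?mulr_ge0//; lra.
Qed.

(** The local errors d^3 K / (1 + d k)^2 sum to a bound independent of N, so the right end d N may
    go to infinity. The sum omits k = 0, hence the end correction (l (d N) - l 0) / 2 with a minus
    sign. *)
Lemma trapezoid_sum A l (l1 l2 : R -> R) K : 0 <= K ->
  (forall x, 0 <= x -> is_derive x 1 A (l x)) ->
  (forall x, 0 <= x -> is_derive x 1 l (l1 x)) ->
  (forall x, 0 <= x -> is_derive x 1 l1 (l2 x)) ->
  (forall x, 0 <= x -> `|l2 x| <= K / (1 + x) ^+ 2) ->
  forall (d : R) N, 0 < d ->
  `|\sum_(1 <= k < N.+1) l (d * k%:R) -
    ((A (d * N%:R) - A 0) / d + (l (d * N%:R) - l 0) / 2)| <= K * d * (1 + d).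
Proof.
move=> K0 dA dl dl1 l2K d N d0.
have nd n : 0 <= d * n%:R by rewrite mulr_ge0// ltW.
pose e k := (A (d * k.+1%:R) - A (d * k%:R) -
  d * (l (d * k%:R) + l (d * k.+1%:R)) / 2) / d.
have -> : \sum_(1 <= k < N.+1) l (d * k%:R) -
    ((A (d * N%:R) - A 0) / d + (l (d * N%:R) - l 0) / 2) =
    - \sum_(0 <= k < N) e k.
  elim: N => [|N IH]; first by rewrite !big_geq// mulr0; field; rewrite gt_eqF.
  rewrite big_nat_recr//= [in RHS]big_nat_recr//= [RHS]opprD -IH /e; field.
  by rewrite gt_eqF.
rewrite normrN; apply: (le_trans (ler_norm_sum _ _ _)).
apply: le_trans (_ : \sum_(0 <= k < N) K * d ^+ 2 * (1 + d * k%:R) ^- 2 <= _).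
  apply: ler_sum => k _; rewrite /e normrM (ger0_norm (_ : 0 <= d^-1)) ?invr_ge0 ?(ltW d0)//.
  rewrite ler_pdivrMr// -natr1 mulrDr mulr1.
  have -> : K * d ^+ 2 / (1 + d * k%:R) ^+ 2 * d = K / (1 + d * k%:R) ^+ 2 * d ^+ 3.
    by field; rewrite gt_eqF// ltr_wpDr.
  have d1 := ltW d0; refine (@trapezoid_step A l l1 l2 _ _ _ d1 _ _ _ _).
  - by move=> y /andP[ky _]; apply: dA; rewrite (le_trans _ ky).
  - by move=> y /andP[ky _]; apply: dl; rewrite (le_trans _ ky).
  - by move=> y /andP[ky _]; apply: dl1; rewrite (le_trans _ ky).
  - move=> y /andP[ky _]; apply: (le_trans (l2K _ (le_trans (nd k) ky))).
    have k0 := nd k; rewrite ler_wpM2l// lef_pV2 ?posrE ?exprn_gt0//; try lra.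
    by rewrite lerXn2r ?nnegrE; lra.
rewrite -mulr_sumr.
apply: (le_trans (ler_wpM2l _ (sum_inv_sqr_le N d0))).
  by rewrite mulr_ge0// exprn_ge0// ltW.
by apply: eq_lerW; field; rewrite gt_eqF.
Qed.

(** Used for the first-order correction [v]: it enters with a small prefactor, so the cruder
    quadrature, which needs only one derivative, is accurate enough. *)
Lemma rectangle_sum A f (f' : R -> R) K : 0 <= K ->
  (forall x, 0 <= x -> is_derive x 1 A (f x)) ->
  (forall x, 0 <= x -> is_derive x 1 f (f' x)) ->
  (forall x, 0 <= x -> `|f' x| <= K / (1 + x) ^+ 2) ->
  forall (d : R) N, 0 < d ->
  `|d * \sum_(1 <= k < N.+1) f (d * k%:R) - (A (d * N%:R) - A 0)|
    <= K * d * (1 + d).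
Proof.
move=> K0 dA df fK d N d0.
have nd n : 0 <= d * n%:R by rewrite mulr_ge0// ltW.
pose e k := (A (d * k.+1%:R) - A (d * k%:R)) - d * f (d * k.+1%:R).
have -> : d * \sum_(1 <= k < N.+1) f (d * k%:R) - (A (d * N%:R) - A 0) =
    - \sum_(0 <= k < N) e k.
  elim: N => [|N IH]; first by rewrite !big_geq// mulr0; ring.
  by rewrite big_nat_recr//= [in RHS]big_nat_recr//= [RHS]opprD -IH /e; ring.
rewrite normrN; apply: (le_trans (ler_norm_sum _ _ _)).
apply: le_trans (_ : \sum_(0 <= k < N) K * d ^+ 2 * (1 + d * k%:R) ^- 2 <= _); last first.
  rewrite -mulr_sumr.
  apply: (le_trans (ler_wpM2l _ (sum_inv_sqr_le N d0))).
    by rewrite mulr_ge0// exprn_ge0// ltW.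
  by apply: eq_lerW; field; rewrite gt_eqF.
apply: ler_sum => k _; have k0 := nd k.
have kS : d * k.+1%:R = d * k%:R + d by rewrite -natr1; ring.
(* With F the value of [f] at the right end, the local error is an increment of y |-> A y - y F,
   whose derivative f y - F is an increment of [f]. *)
have -> : e k = (A (d * k.+1%:R) - d * k.+1%:R * f (d * k.+1%:R)) -
    (A (d * k%:R) - d * k%:R * f (d * k.+1%:R)).
  by rewrite /e kS; ring.
set F := f _.
have -> : K * d ^+ 2 * (1 + d * k%:R) ^- 2 =
    K / (1 + d * k%:R) ^+ 2 * d * (d * k.+1%:R - d * k%:R) by rewrite kS; ring.
have bnd (y : R) : d * k%:R <= y -> `|f' y| <= K / (1 + d * k%:R) ^+ 2.
  move=> ky; apply: (le_trans (fK _ (le_trans (nd k) ky))).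
  rewrite ler_wpM2l// lef_pV2 ?posrE ?exprn_gt0//; try lra.
  by rewrite lerXn2r ?nnegrE; lra.
apply: (@mvt_bound (fun y => A y - y * F) (fun y => f y - F)).
- by rewrite kS lerDl ltW.
- move=> y /andP[ky _]; have A' := dA _ (le_trans k0 ky); isd; ring.
- move=> y /andP[ky yk]; rewrite distrC.
  apply: le_trans (_ : K / (1 + d * k%:R) ^+ 2 * (d * k.+1%:R - y) <= _).
    apply: (mvt_bound (f' := f')) => // z /andP[yz zk]; last by apply: bnd; lra.
    by apply: df; lra.
  apply: ler_wpM2l; last by rewrite kS; lra.
  by apply: (le_trans _ (bnd _ ky)).
Qed.

Lemma ln_1Dx_bound (u : R) : `|u| <= 2^-1 -> `|ln (1 + u) - u| <= 2 * u ^+ 2.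
Proof.
move=> u2; have /andP[u1 u3] : - 2^-1 <= u <= 2^-1 by rewrite -ler_norml.
have p : 0 < 1 + u by lra.
have -> : 2 * u ^+ 2 = (2 * `|u|) * `|u| by rewrite -mulrA -expr2 real_normK// num_real.
have bnd (y : R) : `|y| <= `|u| -> `|(1 + y)^-1 - 1| <= 2 * `|u|.
  move=> yu; have /andP[y1 y2] : - 2^-1 <= y <= 2^-1.
    by rewrite -ler_norml (le_trans yu).
  have -> : (1 + y)^-1 - 1 = - (y / (1 + y)) by field; rewrite gt_eqF//; lra.
  rewrite normrN normrM (ger0_norm (_ : 0 <= (1 + y)^-1)) ?invr_ge0; last lra.
  rewrite ler_pdivrMr; last lra.
  apply: (le_trans yu); rewrite -mulrA mulrCA ler_peMr//; lra.
have dl (y : R) : - 2^-1 <= y -> is_derive y 1 (fun y => ln (1 + y) - y) ((1 + y)^-1 - 1).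
  by move=> y2; isd; [lra|ring].
pose f (y : R) := ln (1 + y) - y.
have f0 : f 0 = 0 by rewrite /f addr0 ln1 subr0.
rewrite -/(f u); case: (leP 0 u) => u0.
  have -> : `|f u| = `|f u - f 0| by rewrite f0 subr0.
  have -> : 2 * `|u| * `|u| = 2 * `|u| * (u - 0) by rewrite subr0 (ger0_norm u0).
  apply: (mvt_bound (f' := fun y => (1 + y)^-1 - 1)) => //.
    by move=> y /andP[y0 _]; apply: dl; lra.
  by move=> y /andP[y0 yu]; apply: bnd; rewrite !ger0_norm.
have -> : `|f u| = `|f 0 - f u| by rewrite f0 sub0r normrN.
have -> : 2 * `|u| * `|u| = 2 * `|u| * (0 - u) by rewrite sub0r (ltr0_norm u0).
apply: (mvt_bound (f' := fun y => (1 + y)^-1 - 1)) => //.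
- exact: ltW.
- by move=> y /andP[y0 _]; apply: dl; lra.
- move=> y /andP[y0 yu]; apply: bnd.
  by rewrite (ler0_norm yu) (ltr0_norm u0); lra.
Qed.

(* If [L k = d * m (d k) * (1 + e v (d k)) + O(d e^2 m (d k) / (1 + d k)^2)],
   then the logarithms of the [L k] sum up to first order in [e]. *)
Lemma sum_ln_perturb (m v : R -> R) (K : R) : 0 <= K ->
  (forall x, 0 <= x -> 0 < m x) ->
  (forall x, 0 <= x -> `|v x| <= K / (1 + x)) ->
  exists2 K' : R, 0 <= K' & forall (L : nat -> R) (d e : R) N,
    0 < d -> 0 < e <= 1 -> e * (4 * K) <= 1 ->
    (forall k, (0 < k <= N)%N -> `|L k - d * m (d * k%:R) * (1 + e * v (d * k%:R))|
       <= K * e ^+ 2 * d * m (d * k%:R) / (1 + d * k%:R) ^+ 2) ->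
    `|\sum_(1 <= k < N.+1) ln (L k) -
      \sum_(1 <= k < N.+1) (ln (d * m (d * k%:R)) + e * v (d * k%:R))|
      <= K' * e ^+ 2 * (1 + d^-1).
Proof.
move=> K0 m0 vK; exists (K + 8 * K ^+ 2).
  by rewrite addr_ge0// mulr_ge0// exprn_ge0.
move=> L d e N d0 /andP[e0 e1] eK HL.
have nd n : 0 <= d * n%:R by rewrite mulr_ge0// ltW.
rewrite -sumrB; apply: (le_trans (ler_norm_sum _ _ _)).
apply: le_trans (_ : \sum_(1 <= k < N.+1)
    (K + 8 * K ^+ 2) * e ^+ 2 * (1 + d * k%:R) ^- 2 <= _); last first.
  rewrite -mulr_sumr ler_wpM2l//.
    by rewrite mulr_ge0 ?exprn_ge0 ?(ltW e0)// addr_ge0// mulr_ge0// exprn_ge0.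
  apply: le_trans (sum_inv_sqr_le N.+1 d0).
  by rewrite [leRHS]big_nat_recl//= big_add1/= lerDr mulr0 addr0 expr1n invr1.
rewrite big_nat [leRHS]big_nat.
apply: ler_sum => k /andP[k1 kN].
have {}HL := HL k; rewrite k1 -ltnS kN in HL; move/(_ isT) : HL.
have := nd k; move: (d * k%:R) => x x0.
have mx := m0 _ x0; have vx := vK _ x0.
have dm : 0 < d * m x by exact: mulr_gt0.
have x1 : 0 < 1 + x by lra.
move=> HL.
pose r := L k / (d * m x) - (1 + e * v x).
have rK : `|r| <= K * e ^+ 2 / (1 + x) ^+ 2.
  have -> : r = (L k - d * m x * (1 + e * v x)) / (d * m x).
    by rewrite /r; field; rewrite !gt_eqF.
  rewrite normrM (gtr0_norm (_ : 0 < (d * m x)^-1)) ?invr_gt0//.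
  rewrite ler_pdivrMr//; apply: (le_trans HL).
  by apply: eq_lerW; field; rewrite gt_eqF.
set X := (1 + x)^-1.
have X0 : 0 < X by rewrite invr_gt0.
have X1 : X <= 1 by rewrite invf_le1; lra.
have {}rK : `|r| <= K * e ^+ 2 * X ^+ 2 by rewrite /X exprVn.
have {}vx : `|v x| <= K * X by [].
have KeX : 0 <= K * e * X by rewrite !mulr_ge0// ltW.
have ev : `|e * v x| <= K * e * X.
  by rewrite normrM gtr0_norm// (mulrC K) -mulrA ler_wpM2l// ltW.
have rK2 : `|r| <= K * e * X.
  apply: (le_trans rK).
  have -> : K * e ^+ 2 * X ^+ 2 = (K * e * X) * (e * X) by ring.
  by rewrite ler_piMr// mulr_ile1// ltW.
(* This is where the hypothesis [e * (4 * K) <= 1] enters: it puts [u] in [-1/2, 1/2], the range of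
   [ln_1Dx_bound]. *)
have KeX4 : K * e * X <= 4^-1.
  apply: le_trans (_ : K * e <= _); first by rewrite ler_piMr// mulr_ge0// ltW.
  lra.
pose u := e * v x + r.
have uK : `|u| <= 2 * (K * e * X).
  by rewrite (le_trans (ler_normD _ _))//; lra.
have LE : L k = d * m x * (1 + u).
  by rewrite /u /r; field; rewrite !gt_eqF.
have u2 : `|u| <= 2^-1 by lra.
have u1 : 0 < 1 + u by move: u2; rewrite ler_norml; lra.
rewrite LE lnM ?posrE//.
have -> : ln (d * m x) + ln (1 + u) - (ln (d * m x) + e * v x) =
    (ln (1 + u) - u) + r by rewrite /u; ring.
apply: (le_trans (ler_normD _ _)).
apply: (le_trans (lerD (ln_1Dx_bound u2) rK)).
rewrite -exprVn -/X.
have : u ^+ 2 <= (2 * (K * e * X)) ^+ 2.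
  by rewrite -[u ^+ 2]real_normK ?num_real// lerXn2r ?nnegrE// mulr_ge0.
have -> : (K + 8 * K ^+ 2) * e ^+ 2 * X ^+ 2 =
  2 * (2 * (K * e * X)) ^+ 2 + K * e ^+ 2 * X ^+ 2 by ring.
lra.
Qed.

End calculus.

(** * Improper integrals and antiderivatives on [0, +oo) *)

Section half_line.
Context {R : realType}.
Notation mu := (@lebesgue_measure R).
Implicit Types (f g A : R -> R) (x K l : R).

Lemma derive1_is_derive f x (a : R) : derivable f x 1 -> derive1 f x = a ->
  is_derive x 1 f a.
Proof. by move=> df <-; rewrite derive1E; exact/derivableP. Qed.

Lemma continuous_half_line_within f :
  (forall x, 0 <= x -> {for x, continuous f}) ->
  {within `[0, +oo[, continuous f}.
Proof.
move=> cf; apply: continuous_in_subspaceT => x; rewrite inE/= in_itv/= andbT.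
exact: cf.
Qed.

Lemma half_line_measurable f :
  (forall x, 0 <= x -> {for x, continuous f}) ->
  measurable_fun (`[0%R, +oo[%classic : set R) f.
Proof.
move=> cf; apply: subspace_continuous_measurable_fun => //.
exact: continuous_half_line_within.
Qed.

Lemma cvg_inv_1Dx : (1 + x)^-1 @[x --> +oo%R] --> (0 : R).
Proof.
apply/gtr0_cvgV0; last by apply: cvg_addrl; exact: cvg_id.
by near=> x; rewrite addr_gt0//; near: x; exact: nbhs_pinfty_gt.
Unshelve. all: by end_near. Qed.

Lemma ge0_half_line_FTC f A l :
  (forall x, 0 <= x -> 0 <= f x) ->
  (forall x, 0 <= x -> is_derive x 1 A (f x)) ->
  (forall x, 0 <= x -> {for x, continuous f}) ->
  A x @[x --> +oo] --> l ->
  mu.-integrable `[0%R, +oo[ (EFin \o f) /\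
  \int[mu]_(x in `[0, +oo[) f x = l - A 0.
Proof.
move=> f0 dA cf Al.
have E : (\int[mu]_(x in `[0%R, +oo[) (f x)%:E = l%:E - (A 0)%:E)%E.
  apply: ge0_continuous_FTC2y => //.
  - exact: continuous_half_line_within.
  - by move=> x /ltW x0; have [] := dA _ x0.
  - apply: cvg_at_right_filter.
    by apply: is_derive_continuous; exact: dA.
  - move=> x; rewrite in_itv/= andbT => /ltW x0.
    by apply: is_derive_derive1; exact: dA.
split; last by rewrite /Rintegral E -EFinB.
apply/integrableP; split; first by apply/measurable_EFinP; exact: half_line_measurable.
rewrite [X in (X < _)%E](_ : _ = (l%:E - (A 0)%:E)%E); first by rewrite -EFinB ltry.
rewrite -E; apply: eq_integral.
by move=> x; rewrite inE/= in_itv/= andbT => x0; rewrite ger0_norm// f0.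
Qed.

Lemma half_line_le_integrable f g :
  (forall x, 0 <= x -> {for x, continuous f}) ->
  (forall x, 0 <= x -> `|f x| <= g x) ->
  mu.-integrable `[0%R, +oo[ (EFin \o g) ->
  mu.-integrable `[0%R, +oo[ (EFin \o f).
Proof.
move=> cf fg; apply: le_integrable => //.
  by apply/measurable_EFinP; exact: half_line_measurable.
move=> x /=; rewrite in_itv/= andbT => x0.
by rewrite lee_fin (le_trans (fg _ x0))// ler_norm.
Qed.

Lemma half_line_FTC f A K l :
  (forall x, 0 <= x -> is_derive x 1 A (f x)) ->
  (forall x, 0 <= x -> {for x, continuous f}) ->
  (forall x, 0 <= x -> `|f x| <= K / (1 + x) ^+ 2) ->
  A x @[x --> +oo] --> l ->
  mu.-integrable `[0%R, +oo[ (EFin \o f) /\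
  \int[mu]_(x in `[0, +oo[) f x = l - A 0.
Proof.
move=> dA cf fK Al.
have K0 : 0 <= K.
  by have := fK 0 (lexx _); rewrite addr0 expr1n divr1; apply: le_trans.
pose h x := K / (1 + x) ^+ 2; pose H x := - K * (1 + x)^-1.
have dH x : 0 <= x -> is_derive x 1 H (h x).
  by move=> x0; rewrite /H /h; isd; [|field]; rewrite gt_eqF//; lra.
have ch x : 0 <= x -> {for x, continuous h}.
  move=> x0; apply: (@is_derive_continuous _ _ _ (- 2 * K / (1 + x) ^+ 3)).
  rewrite /h; isd; first by rewrite expf_neq0// gt_eqF//; lra.
  by field; rewrite gt_eqF//; lra.
have h0 x : 0 <= x -> 0 <= h x by move=> x0; rewrite divr_ge0// exprn_ge0//; lra.
have H0 : H x @[x --> +oo] --> - K * 0 by apply: cvgMr; exact: cvg_inv_1Dx.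
have [ih Ih] := ge0_half_line_FTC h0 dH ch H0.
have if_ : mu.-integrable `[0%R, +oo[ (EFin \o f).
  exact: half_line_le_integrable cf fK ih.
split=> //.
have [] := @ge0_half_line_FTC (fun x => f x + h x) (fun x => A x + H x) (l + - K * 0).
- by move=> x x0; have := fK _ x0; rewrite ler_norml -/(h x) => /andP[]; lra.
- by move=> x x0; apply: isd_add; [exact: dA|exact: dH].
- by move=> x x0; apply: continuousD; [exact: cf|exact: ch].
- exact: cvgD.
move=> _; rewrite RintegralD// Ih; lra.
Qed.

Lemma integrable_inv_sqr K : 
  mu.-integrable `[0%R, +oo[ (EFin \o (fun x => K / (1 + x) ^+ 2)).
Proof.
suff i1 : mu.-integrable `[0%R, +oo[ (EFin \o (fun x : R => 1 / (1 + x) ^+ 2)).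
  apply: eq_integrable (integrableZl _ K i1) => //.
  by move=> x _ /=; rewrite -EFinM mul1r.
have p (x : R) : 0 <= x -> 1 + x != 0 by move=> x0; rewrite gt_eqF//; lra.
have [] // := @ge0_half_line_FTC (fun x => 1 / (1 + x) ^+ 2) (fun x => - (1 + x)^-1) (- 0).
- by move=> x x0; rewrite divr_ge0// exprn_ge0//; lra.
- by move=> x x0; have := p _ x0 => ?; isd; [|field].
- move=> x x0; apply: (@is_derive_continuous _ _ _ (- 2 / (1 + x) ^+ 3)).
  have := p _ x0 => ?; isd; first by rewrite expf_neq0.
  by field.
- by apply: cvgN; exact: cvg_inv_1Dx.
Qed.

Lemma cvg0_le_inv f K : (forall x, 0 <= x -> `|f x| <= K / (1 + x)) ->
  f x @[x --> +oo] --> (0 : R).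
Proof.
move=> fK; apply/norm_cvg0P.
apply: (@squeeze_cvgr _ _ _ _ (cst 0) (fun x => K * (1 + x)^-1)).
- near=> x; rewrite normr_ge0/=; apply: fK.
  by near: x; apply: nbhs_pinfty_ge; rewrite num_real.
- exact: cvg_cst.
- by rewrite -(mulr0 K); apply: cvgMr; exact: cvg_inv_1Dx.
Unshelve. all: by end_near. Qed.

(** A - K / (1 + x) and - A - K / (1 + x) are both nondecreasing; the second provides the upper
    bound that makes the first converge. *)
Lemma half_line_antiderivative_cvg f A K :
  (forall x, 0 <= x -> is_derive x 1 A (f x)) ->
  (forall x, 0 <= x -> `|f x| <= K / (1 + x) ^+ 2) ->
  exists l, A x @[x --> +oo] --> l.
Proof.
move=> dA fK.
have K0 : 0 <= K.
  by have := fK 0 (lexx _); rewrite addr0 expr1n divr1; apply: le_trans.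
pose B x := A x - K * (1 + x)^-1.
have dB x : 0 <= x -> is_derive x 1 B (f x + K / (1 + x) ^+ 2).
  move=> x0; have := dA _ x0 => ?.
  by rewrite /B; isd; [|field]; rewrite gt_eqF//; lra.
pose C x := - A x - K * (1 + x)^-1.
have dC x : 0 <= x -> is_derive x 1 C (- f x + K / (1 + x) ^+ 2).
  move=> x0; have := dA _ x0 => ?.
  by rewrite /C; isd; [|field]; rewrite gt_eqF//; lra.
have iB x y : 0 <= x -> x <= y -> B x <= B y.
  move=> x0 xy; apply: (derive_ge0_le xy) => z /andP[xz _].
    exact: dB (le_trans x0 xz).
  by have := fK _ (le_trans x0 xz); rewrite ler_norml => /andP[]; lra.
have iC x y : 0 <= x -> x <= y -> C x <= C y.
  move=> x0 xy; apply: (derive_ge0_le xy) => z /andP[xz _].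
    exact: dC (le_trans x0 xz).
  by have := fK _ (le_trans x0 xz); rewrite ler_norml => /andP[]; lra.
(* Precomposition with the maximum makes [B] monotone on the whole line without changing it near
   +oo. *)
pose M x := Num.max x 0.
have mB : {homo (fun x => B (M x)) : x y / x <= y}.
  move=> x y xy; apply: iB; first by rewrite le_max lexx orbT.
  by rewrite ge_max !le_max xy lexx !orbT.
have bB : has_ubound (range (fun x => B (M x))).
  exists (- C 0) => _ [x _ <-].
  have Mx : 0 <= M x by rewrite le_max lexx orbT.
  have : 0 <= (1 + M x)^-1 by rewrite invr_ge0; lra.
  by have := iC _ _ (lexx _) Mx; rewrite /B /C => ? /(mulr_ge0 K0); lra.
have cB := nondecreasing_cvgr mB bB.
set b := sup _ in cB.
exists (b + K * 0).
have cH : K * (1 + x)^-1 @[x --> +oo] --> K * (0 : R).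
  by apply: cvgMr; exact: cvg_inv_1Dx.
apply: cvg_trans (cvgD cB cH); apply: near_eq_cvg; near=> x.
have Mx : M x = x by apply/max_idPl; near: x; apply: nbhs_pinfty_ge; rewrite num_real.
by rewrite fctE Mx /B subrK.
Unshelve. all: by end_near. Qed.

(* Unlike [ge0_half_line_FTC], [f] may be singular at [0]. *)
Lemma le0_open_half_line_FTC f A (a l : R) :
  f 0 = 0 ->
  (forall x, 0 < x -> f x <= 0) ->
  (forall x, 0 < x -> is_derive x 1 A (f x)) ->
  (forall x, 0 < x -> {for x, continuous f}) ->
  A x @[x --> +oo] --> l -> A x @[x --> 0^'+] --> a ->
  \int[mu]_(x in `[0, +oo[) f x = l - a.
Proof.
move=> f00 f0 dA cf Al Aa.
(* The open half line is exhausted by the intervals [1/(n+1), +oo), where [f] is continuous up to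
   the end point; the one-sided limit of [A] at 0 then gives the value. *)
pose e n : R := n.+1%:R^-1.
have e0 n : 0 < e n by rewrite invr_gt0.
have E n : (\int[mu]_(x in `[e n, +oo[) (f x)%:E = l%:E - (A (e n))%:E)%E.
  have ep := e0 n.
  apply: le0_continuous_FTC2y => //.
  - by move=> x ex; apply: f0; exact: lt_le_trans ex.
  - apply: continuous_in_subspaceT => x; rewrite inE/= in_itv/= andbT => ex.
    by apply: cf; exact: lt_le_trans ex.
  - by apply: cvg_at_right_filter; apply: is_derive_continuous; exact: dA.
  - by move=> x ex; have [] := dA _ (lt_trans ep ex).
  - move=> x; rewrite in_itv/= andbT => ex.
    by apply: is_derive_derive1; apply: dA; exact: lt_trans ex.
have -> : \int[mu]_(x in `[0, +oo[) f x = \int[mu]_(x in `]0, +oo[) f x.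
  rewrite /Rintegral integral_itv_obnd_cbnd//; apply/measurable_EFinP.
  apply: open_continuous_measurable_fun; first exact: interval_open.
  by move=> x; rewrite inE/= in_itv/= andbT; exact: cf.
have U : `]0, +oo[%classic = \bigcup_n `[e n, +oo[%classic.
  apply/seteqP; split => x /=; rewrite ?in_itv/= ?andbT.
    move=> x0; exists (Num.truncn x^-1) => //=; rewrite in_itv/= andbT.
    by rewrite invf_ple ?posrE// ltW// truncnS_gt.
  by case=> n _ /=; rewrite !in_itv/= !andbT; exact: lt_le_trans.
have c1 : (\int[mu]_(x in `[e n, +oo[) (f x)%:E)%E @[n --> \oo] -->
    (\int[mu]_(x in `]0%R, +oo[) (f x)%:E)%E.
  rewrite U; apply: le0_nondecreasing_set_cvg_integral => //.
  - move=> n m nm; apply/subsetPset; apply: subset_itvr; rewrite bnd_simp.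
    by rewrite lef_pV2 ?posrE// ler_nat.
  - move=> n; apply/measurable_EFinP.
    apply: subspace_continuous_measurable_fun => //.
    apply: continuous_in_subspaceT => x; rewrite inE/= in_itv/= andbT => ex.
    by apply: cf; exact: lt_le_trans ex.
  - move=> n x /=; rewrite in_itv/= andbT lee_fin => ex.
    by apply: f0; exact: lt_le_trans ex.
have c2 : (\int[mu]_(x in `[e n, +oo[) (f x)%:E)%E @[n --> \oo] --> (l - a)%:E.
  under eq_fun do rewrite E -EFinB.
  apply: cvg_EFin; first by near=> n.
  apply: cvgB; first exact: cvg_cst.
  move/cvg_at_rightP : Aa; apply; split=> //; exact: cvg_harmonic.
by rewrite /Rintegral (cvg_unique _ c1 c2).
Unshelve. all: by end_near. Qed.

(** The two-sided derivative is available only strictly to the right of the base point; taking a =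
    -1 in the applications covers x = 0. *)
Lemma antiderivative_exists f (a : R) :
  (forall x, a <= x -> {for x, continuous f}) ->
  exists A, forall x, a < x -> is_derive x 1 A (f x).
Proof.
move=> cf; exists (fun x => \int[mu]_(t in `[a, x]) f t) => x ax.
have [||dA fA] := @continuous_FTC1 R f (BLeft a) x (x + 1) _ _ ax (cf _ (ltW ax)).
- by rewrite ltrDl.
- apply: continuous_compact_integrable; first exact: segment_compact.
  apply: continuous_in_subspaceT => y; rewrite inE/= in_itv/= => /andP[ay _].
  exact: cf.
- exact: derive1_is_derive dA fA.
Qed.

Lemma gauss_antiderivative : exists A (l : R),
  [/\ forall x, is_derive x 1 A (expR (- x ^+ 2)),
      A x @[x --> +oo] --> l & l - A 0 = Num.sqrt pi / 2].
Proof.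
pose A (x : R) := \int[mu]_(t in `]-oo, x]) gauss_fun t.
have dA x : is_derive x 1 A (expR (- x ^+ 2)).
  have cg : {for x, continuous (@gauss_fun R)} by exact: continuous_gauss_fun.
  have [|||dA fA] := @continuous_FTC1 R gauss_fun (BInfty R true) x (x + 1) _ _ _ cg.
  - by rewrite ltrDl.
  - by apply: integrableS integrableT_gauss.
  - by rewrite ltNyr.
  - exact: derive1_is_derive dA fA.
have mA : {homo A : x y / x <= y}.
  by move=> x y xy; apply: (derive_ge0_le (f' := fun x => expR (- x ^+ 2))).
(* For x >= 0 the inequality e^{-y^2} <= 1 / (1 + y^2) bounds A x - A 0 by arctan x, which is below
   pi. *)
have bA : has_ubound (range A).
  exists (A 0 + pi) => _ [x _ <-].
  case: (leP x 0) => x0; first by rewrite (le_trans (mA _ _ x0))// lerDl pi_ge0.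
  suff : atan 0 - A 0 <= atan x - A x.
    have := atan_ltpi2 x; have := @pi_ge0 R; rewrite atan0; lra.
  apply: (@derive_ge0_le _ (fun y => atan y - A y)
    (fun y => (1 + y ^+ 2)^-1 - expR (- y ^+ 2))); first exact: ltW.
  move=> y _; rewrite subr_ge0 expRN lef_pV2 ?posrE ?expR_gt0//.
    exact: expR_ge1Dx.
  by rewrite ltr_pwDl// sqr_ge0.
have cA := nondecreasing_cvgr mA bA.
exists A, (sup (range A)); split => //.
have [||_ <-] := @ge0_half_line_FTC gauss_fun A (sup (range A)) _ _ _ cA.
- by move=> x _; exact: gauss_fun_ge0.
- by move=> x _; exact: continuous_gauss_fun.
- by rewrite /Rintegral integral0y_gauss.
Qed.

Lemma expR_dominates n (c : R) : 0 < c ->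
  exists2 K : R, 0 <= K & forall x : R, 0 <= x -> (1 + x) ^+ n <= K * expR (c * x).
Proof.
move=> c0; exists (n.+1`!%:R / c ^+ n.+1 * expR c).
  by rewrite !mulr_ge0// ?expR_ge0// invr_ge0 exprn_ge0// ltW.
move=> x x0; apply: le_trans (_ : (1 + x) ^+ n.+1 <= _).
  by rewrite ler_weXn2l//; lra.
have cx : 0 <= c * (1 + x) by rewrite mulr_ge0 ?(ltW c0)//; lra.
have := expR_ge1Dxn n cx.
rewrite -(mulrA _ (expR c)) -expRD (_ : c + c * x = c * (1 + x)) => [h|]; last by ring.
have -> : (1 + x) ^+ n.+1 = n.+1`!%:R / c ^+ n.+1 * ((c * (1 + x)) ^+ n.+1 / n.+1`!%:R).
  by rewrite exprMn; field; rewrite expf_neq0 ?gt_eqF// ltr0n fact_gt0.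
by rewrite ler_wpM2l ?divr_ge0 ?exprn_ge0 ?(ltW c0)//; lra.
Qed.

End half_line.

Section real_integrable.
Context d (T : measurableType d) (R : realType).
Variables (mu : {measure set T -> \bar R}) (D : set T).
Hypothesis mD : measurable D.
Implicit Types f g : T -> R.

Lemma integrable_mulrl (k : R) f : mu.-integrable D (EFin \o f) ->
  mu.-integrable D (EFin \o (fun x => k * f x)).
Proof.
by move=> /(integrableZl mD k); apply: eq_integrable => // x _; rewrite /= EFinM.
Qed.

Lemma integrable_addr f g : mu.-integrable D (EFin \o f) ->
  mu.-integrable D (EFin \o g) ->
  mu.-integrable D (EFin \o (fun x => f x + g x)).
Proof.
move=> intf intg; have := integrableD mD intf intg.
by apply: eq_integrable => // x _; rewrite /= EFinD.
Qed.

Lemma integrable_subr f g : mu.-integrable D (EFin \o f) ->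
  mu.-integrable D (EFin \o g) ->
  mu.-integrable D (EFin \o (fun x => f x - g x)).
Proof.
move=> intf intg; have := integrableB mD intf intg.
by apply: eq_integrable => // x _; rewrite /= EFinB.
Qed.

End real_integrable.

(** * Exponential moments and the Mills ratio *)

Section moments.
Context {R : realType}.
Notation mu := (@lebesgue_measure R).
Implicit Types (th l c C s x : R) (n : nat).

(** One family serves both cases: th = 0 gives the exponential weights when q'(1) < 0, th = 1 the
    Gaussian weights of the edge. *)
Definition expquad th l s : R := expR (- (l * s + th * s ^+ 2)).

Definition moment th l n : R :=
  \int[mu]_(s in `[0, +oo[) (s ^+ n * expquad th l s).

Lemma expquad_gt0 th l s : 0 < expquad th l s. Proof. exact: expR_gt0. Qed.

Lemma is_derive_expquad th l s :
  is_derive s 1 (expquad th l) (- (l + 2 * th * s) * expquad th l s).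
Proof. by rewrite /expquad; isd; ring. Qed.

Lemma moment_ge0 th l n : 0 <= moment th l n.
Proof.
apply: Rintegral_ge0 => s /=; rewrite in_itv/= andbT => s0.
by rewrite mulr_ge0 ?exprn_ge0// ltW ?expquad_gt0.
Qed.

Section coercive.
Variables (th l c C : R).
Hypothesis c0 : 0 < c.
Hypothesis lin : forall s, 0 <= s -> c * s - C <= l * s + th * s ^+ 2.

Lemma expquad_le s : 0 <= s -> expquad th l s <= expR C * expR (- (c * s)).
Proof. by move=> s0; rewrite -expRD ler_expR; have := lin s0; lra. Qed.

Lemma moment_integrand_le n : exists K : R,
  forall s, 0 <= s -> `|s ^+ n * expquad th l s| <= K / (1 + s) ^+ 2.
Proof.
have [K K0 KP] := expR_dominates n.+2 c0.
exists (K * expR C) => s s0.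
have s1 : 0 < 1 + s by lra.
rewrite ger0_norm; last by rewrite mulr_ge0 ?exprn_ge0// ltW ?expquad_gt0.
rewrite ler_pdivlMr ?exprn_gt0//.
apply: le_trans (_ : (1 + s) ^+ n * (expR C * expR (- (c * s))) * (1 + s) ^+ 2 <= _).
  rewrite ler_wpM2r ?exprn_ge0 ?(ltW s1)// ler_pM ?exprn_ge0//.
  - by rewrite ltW ?expquad_gt0.
  - by rewrite lerXn2r ?nnegrE//; lra.
  - exact: expquad_le.
have -> : (1 + s) ^+ n * (expR C * expR (- (c * s))) * (1 + s) ^+ 2 =
    expR C * ((1 + s) ^+ n.+2 * expR (- (c * s))).
  by rewrite -[n.+2]addn2 exprD; move: (_ ^+ n) (_ ^+ 2) => a b; ring.
rewrite mulrC ler_wpM2r ?expR_ge0// expRN ler_pdivrMr ?expR_gt0//.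
exact: KP.
Qed.

Lemma continuous_moment_integrand n s : {for s, continuous (fun s => s ^+ n * expquad th l s)}.
Proof.
have := is_derive_expquad th l s => /(isd_mul (isd_exp n (isd_id s))).
exact: is_derive_continuous.
Qed.

Lemma moment_integrable n :
  mu.-integrable `[0%R, +oo[ (EFin \o (fun s => s ^+ n * expquad th l s)).
Proof.
have [K KP] := moment_integrand_le n.
apply: (half_line_le_integrable _ KP).
  by move=> s _; exact: continuous_moment_integrand.
exact: integrable_inv_sqr.
Qed.

(** Integration of the derivative of s^n [expquad]; only n = 0 leaves a boundary term, and the
    predecessor of 0 is multiplied by 0. The bound [lin] replaces a sign condition on [l] so that l
    = 0 is allowed when th = 1, as happens for x = 0. *)
Lemma moment_rec n :
  2 * th * moment th l n.+1 + l * moment th l n =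
  n%:R * moment th l n.-1 + (n == 0%N)%:R.
Proof.
pose W s := s ^+ n * expquad th l s.
pose W' s := n%:R * (s ^+ n.-1 * expquad th l s) -
  l * (s ^+ n * expquad th l s) - 2 * th * (s ^+ n.+1 * expquad th l s).
have dW s : is_derive s 1 W (W' s).
  have d := is_derive_expquad th l s.
  by rewrite /W /W'; isd; rewrite exprS; ring.
have W0 : W 0 = (n == 0%N)%:R.
  rewrite /W expr0n /expquad !mulr0 expr0n/= mulr0 addr0 oppr0 expR0 mulr1.
  by [].
have i0 := moment_integrable n.-1; have i1 := moment_integrable n.
have i2 := moment_integrable n.+1.
have mI : measurable (`[0%R, +oo[%classic : set (measurableTypeR R)) by [].
have j0 := integrable_mulrl mI n%:R i0.
have j1 := integrable_mulrl mI l i1.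
have j2 := integrable_mulrl mI (2 * th) i2.
have [K0 P0] := moment_integrand_le n.-1.
have [K1 P1] := moment_integrand_le n.
have [K2 P2] := moment_integrand_le n.+1.
have b0 : forall s, 0 <= s ->
    `|W' s| <= (n%:R * K0 + `|l| * K1 + `|2 * th| * K2) / (1 + s) ^+ 2.
  move=> s s0; rewrite /W' [leRHS]mulrDl [X in _ <= X + _]mulrDl.
  apply: le_trans (ler_normB _ _) _.
  apply: lerD; [apply: le_trans (ler_normB _ _) _; apply: lerD|];
    by rewrite normrM ?normr_nat -mulrA ler_wpM2l// ?P0 ?P1 ?P2.
have Woo : W s @[s --> +oo] --> (0 : R).
  apply: (@cvg0_le_inv _ _ K1) => s s0; apply: (le_trans (P1 _ s0)).
  have K10 : 0 <= K1.
    have := P1 0 (lexx _); rewrite addr0 expr1n divr1; exact: le_trans.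
  rewrite ler_wpM2l// lef_pV2 ?posrE ?exprn_gt0//; try lra.
  by rewrite expr2 ler_pMl; lra.
have cW' s : 0 <= s -> {for s, continuous W'}.
  move=> s0; apply: continuousB.
    apply: continuousB; apply: continuousM; try exact: cvg_cst;
      exact: continuous_moment_integrand.
  by apply: continuousM; [exact: cvg_cst|exact: continuous_moment_integrand].
have [_] := half_line_FTC (fun s _ => dW s) cW' b0 Woo.
rewrite /W' RintegralB//; last exact: (integrable_subr mI j0 j1).
rewrite RintegralB// !RintegralZl// -!/(moment _ _ _) W0.
move: (n == 0%N)%:R => e; lra.
Qed.

End coercive.

Lemma exp_moments l : 0 < l ->
  [/\ moment 0 l 0 = l^-1, moment 0 l 1 = l^-2 & moment 0 l 2 = 2 * l^-3].
Proof.
move=> l0.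
have lin s : 0 <= s -> l * s - 0 <= l * s + 0 * s ^+ 2 by lra.
have r n := moment_rec l0 lin n.
have := r 0; have := r 1; have := r 2; rewrite /= !mulr0 !mul0r !add0r mul1r.
move=> r2 r1 r0.
have e0 : moment 0 l 0 = l^-1 by apply: (mulfI (lt0r_neq0 l0)); rewrite r0 mulfV ?gt_eqF.
have e1 : moment 0 l 1 = l^-2.
  by apply: (mulfI (lt0r_neq0 l0)); rewrite r1 addr0 e0; field; rewrite gt_eqF.
have e2 : moment 0 l 2 = 2 * l^-3.
  by apply: (mulfI (lt0r_neq0 l0)); rewrite r2 addr0 e1; field; rewrite gt_eqF.
by [].
Qed.

End moments.

(** * The Mills ratio: moments, rational bounds, decay *)

Section mills_ratio.
Context {R : realType}.
Notation mu := (@lebesgue_measure R).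
Implicit Types x : R.

Definition mills x : R := expR (x ^+ 2) * (Num.sqrt pi / 2 * erfc x).

Let sqrtpi_gt0 : 0 < Num.sqrt pi :> R. Proof. by rewrite sqrtr_gt0 pi_gt0. Qed.

Lemma erfc_antiderivative : exists A : R -> R, exists l : R,
  [/\ forall x, is_derive x 1 A (expR (- x ^+ 2)),
      A x @[x --> +oo] --> l, l - A 0 = Num.sqrt pi / 2
    & forall x, Num.sqrt pi / 2 * erfc x = l - A x].
Proof.
have [A [l [dA Al l0]]] := @gauss_antiderivative R.
exists A, l; split => // x.
have cg y : {for y, continuous (fun y : R => expR (- y ^+ 2))}.
  exact: (@continuous_gauss_fun R).
rewrite /erfc (@Rintegral_ge0_continuous_FTC2y R _ A x l) //.
- by field; rewrite gt_eqF.
- by apply: continuous_subspaceT => y; exact: cg.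
- by apply: cvg_at_right_filter; apply: is_derive_continuous (dA x).
- by move=> y _; exact: is_derive_derive1 (dA y).
Qed.

Lemma is_derive_erfc x :
  is_derive x 1 erfc (- (2 / Num.sqrt pi) * expR (- x ^+ 2)).
Proof.
have [A [l [dA _ _ E]]] := erfc_antiderivative.
have -> : @erfc R = (fun y => 2 / Num.sqrt pi * (l - A y)).
  by apply/funext => y; rewrite -E; field; rewrite gt_eqF.
by have := dA x => ?; isd; field; rewrite gt_eqF.
Qed.

Lemma erfc_gt0 x : 0 < erfc x.
Proof.
have [A [l [dA Al _ E]]] := erfc_antiderivative.
have mA : {homo A : x y / x <= y}.
  by move=> u v uv; apply: (derive_ge0_le (f' := fun x => expR (- x ^+ 2))).
have Al' y : A y <= l.
  rewrite -(cvg_lim _ Al)//; apply: limr_ge; first by apply/cvg_ex; exists l.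
  by near=> z; apply: mA; near: z; apply: nbhs_pinfty_ge; rewrite num_real.
suff : A x < A (x + 1).
  move=> /lt_le_trans /(_ (Al' _)); rewrite -subr_gt0 -E pmulr_rgt0//.
  by rewrite divr_gt0.
have [||c _] := @MVT R A (fun x => expR (- x ^+ 2)) x (x + 1).
- by rewrite ltrDl.
- by apply: continuous_subspaceT => y; apply: is_derive_continuous (dA y).
by move=> E'; rewrite -subr_gt0 E' mulr_gt0 ?expR_gt0//; lra.
Unshelve. all: by end_near. Qed.

Lemma erfc0 : erfc 0 = 1 :> R.
Proof.
have [A [l [_ _ l0 E]]] := erfc_antiderivative.
have : Num.sqrt pi / 2 * erfc 0 = Num.sqrt pi / 2 * 1 :> R by rewrite mulr1 E l0.
by apply: mulfI; rewrite gt_eqF// divr_gt0.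
Qed.

Lemma mills_gt0 x : 0 < mills x.
Proof. by apply: mulr_gt0; [exact: expR_gt0|apply: mulr_gt0; [exact: divr_gt0|exact: erfc_gt0]]. Qed.

Lemma mills0 : mills 0 = Num.sqrt pi / 2.
Proof. by rewrite /mills erfc0 expr0n expR0 mul1r mulr1. Qed.

Lemma is_derive_mills x : is_derive x 1 mills (2 * x * mills x - 1).
Proof.
have d := is_derive_erfc x; rewrite /mills; isd.
have := sqrtpi_gt0; rewrite expRN; have := expR_gt0 (x ^+ 2).
by move: (expR _) (Num.sqrt _) (erfc x) => e s r e0 s0; field; rewrite !gt_eqF.
Qed.

(** This rewrites the integrands of [alpha_out] and [beta_out] as rational functions of x and
    [mills x]. *)
Lemma derive_Phi x : derive1 (@Phi R) x = - (mills x)^-1.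
Proof.
apply: is_derive_derive1; rewrite /Phi.
have d := is_derive_erfc x; have e0 := erfc_gt0 x.
isd; first by rewrite divr_gt0.
rewrite /mills expRN; have := sqrtpi_gt0; have := expR_gt0 (x ^+ 2).
move: (expR _) (Num.sqrt _) (erfc x) e0 => e s r r0 e0 s0.
by field; rewrite !gt_eqF.
Qed.

Let lin x (s : R) : 0 <= x -> 0 <= s -> 1 * s - 1 <= 2 * x * s + 1 * s ^+ 2.
Proof. by move=> x0 s0; have := mulr_ge0 x0 s0; have := sqr_ge0 (2 * s - 1); rewrite !expr2; lra. Qed.

(** Completing the square: s^2 + 2 x s = (s + x)^2 - x^2, so the moment is e^{x^2} times a Gaussian
    tail. *)
Lemma mills_moment x : 0 <= x -> mills x = moment 1 (2 * x) 0.
Proof.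
move=> x0; have [A [l [dA Al _ E]]] := erfc_antiderivative.
rewrite /mills E.
have c1 : 0 < 1 :> R by [].
have Bl : expR (x ^+ 2) * A (s + x) @[s --> +oo] --> expR (x ^+ 2) * l.
  by apply: cvgMr; apply: cvg_comp Al; apply: cvg_addrr; exact: cvg_id.
have [|||_] := @ge0_half_line_FTC R (fun s => s ^+ 0 * expquad 1 (2 * x) s)
    (fun s => expR (x ^+ 2) * A (s + x)) _ _ _ _ Bl.
- by move=> s _; rewrite expr0 mul1r ltW ?expquad_gt0.
- move=> s _; have d := dA (s + x); isd.
  have -> : expquad 1 (2 * x) s = expR (x ^+ 2) * expR (- (s + x) ^+ 2).
    by rewrite -expRD /expquad; congr expR; ring.
  by ring.
- by move=> s _; exact: continuous_moment_integrand.
- by rewrite add0r mulrBr => <-.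
Qed.

(* The moments of [s |-> exp (- 2 x s - s^2)], which are affine in [mills x]; their
   positivity gives the rational bounds on the Mills ratio. *)
Definition mills1 x := (1 - 2 * x * mills x) / 2.
Definition mills2 x := ((1 + 2 * x ^+ 2) * mills x - x) / 2.
Definition mills3 x := (1 + x ^+ 2 - (3 * x + 2 * x ^+ 3) * mills x) / 2.
Definition mills4 x := (3 * mills2 x - 2 * x * mills3 x) / 2.

Lemma mills_moments x : 0 <= x ->
  [/\ moment 1 (2 * x) 1 = mills1 x, moment 1 (2 * x) 2 = mills2 x,
      moment 1 (2 * x) 3 = mills3 x, moment 1 (2 * x) 4 = mills4 x
    & moment 1 (2 * x) 5 = (4 * mills3 x - 2 * x * mills4 x) / 2].
Proof.
move=> x0.
have r n := moment_rec ltr01 (fun s => @lin x s x0) n.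
have m0 := mills_moment x0.
have r0 : 2 * 1 * moment 1 (2 * x) 1 + 2 * x * moment 1 (2 * x) 0 = 0%:R * moment 1 (2 * x) 0 + 1%:R := r 0%N.
have r1 : 2 * 1 * moment 1 (2 * x) 2 + 2 * x * moment 1 (2 * x) 1 = 1%:R * moment 1 (2 * x) 0 + 0%:R := r 1%N.
have r2 : 2 * 1 * moment 1 (2 * x) 3 + 2 * x * moment 1 (2 * x) 2 = 2%:R * moment 1 (2 * x) 1 + 0%:R := r 2%N.
have r3 : 2 * 1 * moment 1 (2 * x) 4 + 2 * x * moment 1 (2 * x) 3 = 3%:R * moment 1 (2 * x) 2 + 0%:R := r 3%N.
have r4 : 2 * 1 * moment 1 (2 * x) 5 + 2 * x * moment 1 (2 * x) 4 = 4%:R * moment 1 (2 * x) 3 + 0%:R := r 4%N.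
rewrite -?m0 in r0 r1.
have m1 : moment 1 (2 * x) 1 = mills1 x by rewrite /mills1; move: r0; lra.
have m2 : moment 1 (2 * x) 2 = mills2 x.
  by rewrite m1 in r1; rewrite /mills2; move: r1; rewrite /mills1; lra.
have m3 : moment 1 (2 * x) 3 = mills3 x.
  by rewrite m1 m2 in r2; rewrite /mills3; move: r2; rewrite /mills1 /mills2; lra.
have m4 : moment 1 (2 * x) 4 = mills4 x.
  by rewrite m2 m3 in r3; rewrite /mills4; lra.
by split => //; rewrite m3 m4 in r4; lra.
Qed.

Lemma mills_ge0 x : 0 <= x ->
  [/\ 0 <= mills1 x, 0 <= mills2 x, 0 <= mills3 x, 0 <= mills4 x
    & 2 * x * mills4 x <= 4 * mills3 x].
Proof.
move=> x0; have [m1 m2 m3 m4 m5] := mills_moments x0.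
rewrite -m1 -m2 -m3 -m4; split; rewrite ?moment_ge0//.
by have := @moment_ge0 R 1 (2 * x) 5; rewrite m5 -m3 -m4; lra.
Qed.

Lemma mills_nincr x y : 0 <= x -> x <= y -> mills y <= mills x.
Proof.
move=> x0 xy; rewrite -lerN2.
apply: (@derive_ge0_le _ (fun y => - mills y) (fun y => - (2 * y * mills y - 1)) _ _ xy).
- by move=> z _; apply: isd_opp; exact: is_derive_mills.
- move=> z /andP[xz _]; have [+ _ _ _ _] := mills_ge0 (le_trans x0 xz).
  by rewrite /mills1; lra.
Qed.

(** For x >= 1, positivity of [mills2] gives (1 + 2 x^2) mills x >= x, and 1 + 2 x^2 <= 3 x^2. For x
    < 1, monotonicity reduces to the value at 1. The bound converts absolute errors into errors
    relative to [mills x]. *)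
Lemma mills_ge_inv x : 0 <= x -> (3 * (1 + x))^-1 <= mills x.
Proof.
move=> x0.
have big y : 1 <= y -> 1 <= 3 * y * mills y.
  move=> y1; have y0 : 0 <= y by lra.
  have [_ + _ _ _] := mills_ge0 y0.
  rewrite /mills2; move: (mills y) => F h.
  have y2 : 1 <= y ^+ 2 by rewrite expr_ge1.
  rewrite -(ler_pM2l (_ : 0 < 1 + 2 * y ^+ 2)); last lra.
  have -> : (1 + 2 * y ^+ 2) * (3 * y * F) = 3 * y * ((1 + 2 * y ^+ 2) * F) by ring.
  apply: le_trans (_ : 3 * y * y <= _); first by rewrite -mulrA -expr2; lra.
  by rewrite ler_wpM2l//; lra.
rewrite -[_^-1]div1r ler_pdivrMr; last lra.
case: (leP 1 x) => x1.
  by have := big _ x1; have := mills_gt0 x; lra.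
have := mills_nincr x0 (ltW x1).
have := big 1 (lexx _); rewrite mulr1 => h1 h2.
have : 0 <= x * mills x by rewrite mulr_ge0// ltW// mills_gt0.
lra.
Qed.

(** In the recursion 2 m_{n+1} + 2 x m_n = n m_{n-1}, positivity of m_{n+1} gives 2 x m_n <= n
    m_{n-1}. When x >= 1 one has 1 + x <= 2 x and each step gains a factor 1 / (1 + x), whence the
    constants 36 = 3 * 12 and 144 = 4 * 36; when x < 1 crude bounds with 1 + x <= 2 suffice. *)
Lemma mills_decay x : 0 <= x ->
  [/\ (1 + x) * mills1 x <= 6 * mills x, (1 + x) ^+ 2 * mills2 x <= 12 * mills x,
      (1 + x) ^+ 3 * mills3 x <= 36 * mills x
    & (1 + x) ^+ 4 * mills4 x <= 144 * mills x].
Proof.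
move=> x0; have [a1 a2 a3 a4 a5] := mills_ge0 x0.
have F0 := mills_ge_inv x0.
have p := mills_gt0 x.
have b1 : 2 * x * mills1 x <= mills x.
  by move: a2; rewrite /mills2 /mills1; lra.
have b2 : 2 * x * mills2 x <= 2 * mills1 x.
  by move: a3; rewrite /mills3 /mills2 /mills1; lra.
have b3 : 2 * x * mills3 x <= 3 * mills2 x by move: a4; rewrite /mills4; lra.
have c1 : 2 * mills1 x <= 1.
  by rewrite /mills1; have := mulr_ge0 x0 (ltW p); lra.
have c2 : 2 * mills2 x <= mills x.
  have := mulr_ge0 x0 a1; rewrite /mills2 /mills1; lra.
have c3 : mills3 x <= mills1 x.
  have := mulr_ge0 x0 a2; rewrite /mills3 /mills2 /mills1; lra.
have c4 : 2 * mills4 x <= 3 * mills2 x.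
  by rewrite /mills4; have := mulr_ge0 x0 a3; lra.
move: (mills1 x) (mills2 x) (mills3 x) (mills4 x) (mills x) a1 a2 a3 a4 a5 F0 p b1 b2 b3 c1 c2 c3 c4.
move=> m1 m2 m3 m4 F a1 a2 a3 a4 a5 F0 p b1 b2 b3 c1 c2 c3 c4.
have x1 : 0 <= 1 + x by lra.
case: (leP 1 x) => x2.
  have step (a : R) : 0 <= a -> (1 + x) * a <= 2 * x * a.
    by move=> a0; rewrite ler_wpM2r//; lra.
  have d1 : (1 + x) * m1 <= F by apply: le_trans b1; exact: step.
  have d2 : (1 + x) * m2 <= 2 * m1 by apply: le_trans b2; exact: step.
  have d3 : (1 + x) * m3 <= 3 * m2 by apply: le_trans b3; exact: step.
  have d4 : (1 + x) * m4 <= 4 * m3 by apply: le_trans a5; exact: step.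
  have e2 : (1 + x) ^+ 2 * m2 <= 12 * F.
    by rewrite expr2 -mulrA; have := ler_wpM2l x1 d2; lra.
  have e3 : (1 + x) ^+ 3 * m3 <= 36 * F.
    by rewrite exprSr -mulrA; have := ler_wpM2l (exprn_ge0 2 x1) d3; lra.
  split => //; first lra.
  by rewrite exprSr -mulrA; have := ler_wpM2l (exprn_ge0 3 x1) d4; lra.
have f1 : m1 <= 3 * F.
  have : 1 <= F * (3 * (1 + x)) by rewrite -ler_pdivrMr ?div1r//; lra.
  have : 0 <= (1 - x) * F by rewrite mulr_ge0//; lra.
  lra.
have y1 : 1 + x <= 2 by lra.
have pw n (a b : R) : 0 <= a -> a <= b -> (1 + x) ^+ n * a <= 2 ^+ n * b.
  move=> a0 ab; apply: ler_pM => //; first exact: exprn_ge0.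
  by rewrite lerXn2r ?nnegrE.
have := pw 1%N _ _ a1 f1; have := pw 2%N _ _ a2 (lexx _).
have := pw 3%N _ _ a3 (lexx _); have := pw 4%N _ _ a4 (lexx _).
by rewrite !expr1 -!natrX /= => h4 h3 h2 h1; split; lra.
Qed.

(* From the positivity of [mills2] and [mills3]. *)
Lemma mills_upper_lower x : 0 < x ->
  1 - (1 + 2 * x ^+ 2)^-1 <= 2 * x * mills x <= 1 - (3 + 2 * x ^+ 2)^-1.
Proof.
move=> x0; have [_ a2 a3 _ _] := mills_ge0 (ltW x0).
have x2 : 0 < x ^+ 2 by rewrite exprn_gt0.
apply/andP; split.
  have -> : 1 - (1 + 2 * x ^+ 2)^-1 = 2 * x ^+ 2 / (1 + 2 * x ^+ 2) by field; rewrite gt_eqF//; lra.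
  rewrite ler_pdivrMr; last lra.
  by have := mulr_ge0 (ltW x0) a2; rewrite /mills2; lra.
have -> : 1 - (3 + 2 * x ^+ 2)^-1 = 2 * (1 + x ^+ 2) / (3 + 2 * x ^+ 2) by field; rewrite gt_eqF//; lra.
rewrite ler_pdivlMr; last lra.
by move: a3; rewrite /mills3; lra.
Qed.

End mills_ratio.

(** * Sums of logarithms *)

Section sum_expansion.
Context {R : realType}.
Implicit Types (m l v : R -> R) (K d e x : R).

(** [m] is the leading profile of the moments, [v] the relative correction at first order in [e].
    The constant is chosen before L, d, e and N. The error is O(1/N) for d = e = 1/N, and
    O(N^{-1/2}) when e = N^{-1/2} and d is a fixed multiple of e. *)
Lemma sum_ln_expansion m (l1 l2 : R -> R) v (v' Al Av : R -> R) K : 0 <= K ->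
  (forall x, 0 <= x -> 0 < m x) ->
  (forall x, 0 <= x -> is_derive x 1 Al (ln (m x))) ->
  (forall x, 0 <= x -> is_derive x 1 (fun y => ln (m y)) (l1 x)) ->
  (forall x, 0 <= x -> is_derive x 1 l1 (l2 x)) ->
  (forall x, 0 <= x -> `|l2 x| <= K / (1 + x) ^+ 2) ->
  (forall x, 0 <= x -> is_derive x 1 Av (v x)) ->
  (forall x, 0 <= x -> is_derive x 1 v (v' x)) ->
  (forall x, 0 <= x -> `|v' x| <= K / (1 + x) ^+ 2) ->
  (forall x, 0 <= x -> `|v x| <= K / (1 + x)) ->
  exists2 K' : R, 0 <= K' & forall (L : nat -> R) d e N,
    0 < d -> 0 < e <= 1 -> e * (4 * K) <= 1 ->
    (forall k, (0 < k <= N)%N -> `|L k - d * m (d * k%:R) * (1 + e * v (d * k%:R))|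
       <= K * e ^+ 2 * d * m (d * k%:R) / (1 + d * k%:R) ^+ 2) ->
    `|\sum_(1 <= k < N.+1) ln (L k) -
      (N%:R * ln d + (Al (d * N%:R) - Al 0) / d +
       (ln (m (d * N%:R)) - ln (m 0)) / 2 + e / d * (Av (d * N%:R) - Av 0))|
      <= K' * (e ^+ 2 * (1 + d^-1) + (d + e) * (1 + d)).
Proof.
move=> K0 m0 dAl dl dl1 l2K dAv dv v'K vK.
have [K' K'0 HK] := sum_ln_perturb K0 m0 vK.
exists (K + K'); first exact: addr_ge0.
move=> L d e N d0 /andP[e0 e1] eK HL.
have e01 : 0 < e <= 1 by rewrite e0.
have H := HK L d e N d0 e01 eK HL.
have T := trapezoid_sum K0 dAl dl dl1 l2K N d0.
have Q := rectangle_sum K0 dAv dv v'K N d0.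
set S := \sum_(1 <= k < N.+1) ln (L k) in H *.
have E : \sum_(1 <= k < N.+1) (ln (d * m (d * k%:R)) + e * v (d * k%:R)) =
    N%:R * ln d + \sum_(1 <= k < N.+1) ln (m (d * k%:R)) +
    e / d * (d * \sum_(1 <= k < N.+1) v (d * k%:R)).
  rewrite mulrA divfK ?gt_eqF// big_split/= -mulr_sumr; congr (_ + _).
  transitivity (\sum_(1 <= k < N.+1) (ln d + ln (m (d * k%:R)))).
    apply: eq_bigr => k _; rewrite lnM ?posrE// m0// mulr_ge0// ltW//.
  by rewrite big_split/= sumr_const_nat subn1/= mulr_natl.
rewrite E in H.
set S1 := \sum_(1 <= k < N.+1) ln (m _) in H T.
set S2 := d * _ in H Q.
set a := (Al _ - _) / d in T *; set b := (_ - _) / 2 in T *; set c := Av _ - _ in Q *.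
have -> : S - (N%:R * ln d + a + b + e / d * c) =
   (S - (N%:R * ln d + S1 + e / d * S2)) + (S1 - (a + b)) + e / d * (S2 - c) by ring.
apply: (le_trans (ler_normD _ _)); apply: le_trans (lerD (ler_normD _ _) (lexx _)) _.
have Q' : `|e / d * (S2 - c)| <= K * e * (1 + d).
  rewrite normrM gtr0_norm ?divr_gt0//; apply: le_trans (ler_wpM2l _ Q) _.
    by rewrite divr_ge0// ltW.
  by apply: eq_lerW; field; rewrite gt_eqF.
have d1 : 0 <= d^-1 by rewrite invr_ge0 ltW.
have h1 : 0 <= K * (e ^+ 2 * (1 + d^-1)).
  by rewrite !mulr_ge0// ?exprn_ge0 ?(ltW e0)//; lra.
have h2 : 0 <= K' * ((d + e) * (1 + d)) by rewrite !mulr_ge0//; lra.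
lra.
Qed.

End sum_expansion.

(** * Antiderivatives behind the universal constants *)

Section edge_constants.
Context {R : realType}.
Notation mu := (@lebesgue_measure R).
Implicit Types x : R.

(** The relative first-order correction at the edge, produced by the cubic term of g; its integral
    over the half line is 3 [beta_out]. *)
Definition mills31 x : R := mills3 x / mills x.

Lemma mills31E x : mills31 x = ((1 + x ^+ 2) / mills x - x * (2 * x ^+ 2 + 3)) / 2.
Proof. by rewrite /mills31 /mills3; field; rewrite gt_eqF// mills_gt0. Qed.

(** The quotient rule together with mills_k' = - 2 mills_{k+1}, obtained by differentiating e^{-2 x
    s} in x. *)
Definition mills31' x : R := 2 * (mills3 x * mills1 x / mills x ^+ 2 - mills4 x / mills x).

Lemma is_derive_mills31 x : is_derive x 1 mills31 (mills31' x).
Proof.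
have d := is_derive_mills x; have p := mills_gt0 x.
rewrite /mills31 /mills3; isd; first by rewrite gt_eqF.
rewrite /mills31' /mills4 /mills2 /mills3 /mills1.
by move: (mills x) p => F p; field; rewrite gt_eqF.
Qed.

Lemma mills31_decay x : 0 <= x ->
  [/\ 0 <= mills31 x, mills31 x <= 36 / (1 + x) ^+ 3
    & `|mills31' x| <= 720 / (1 + x) ^+ 2].
Proof.
move=> x0; have [a1 a2 a3 a4 a5] := mills_ge0 x0.
have [d1 d2 d3 d4] := mills_decay x0.
have p := mills_gt0 x; have x1 : 0 < 1 + x by lra.
have b1 : mills1 x / mills x <= 6 / (1 + x).
  by rewrite ler_pdivrMr// mulrAC ler_pdivlMr// mulrC.
have b3 : mills3 x / mills x <= 36 / (1 + x) ^+ 3.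
  by rewrite ler_pdivrMr// mulrAC ler_pdivlMr ?exprn_gt0// mulrC.
have b4 : mills4 x / mills x <= 144 / (1 + x) ^+ 4.
  by rewrite ler_pdivrMr// mulrAC ler_pdivlMr ?exprn_gt0// mulrC.
have c1 : 0 <= mills1 x / mills x by rewrite divr_ge0// ltW.
have c3 : 0 <= mills3 x / mills x by rewrite divr_ge0// ltW.
have c4 : 0 <= mills4 x / mills x by rewrite divr_ge0// ltW.
split => //.
have -> : mills31' x = 2 * (mills3 x / mills x * (mills1 x / mills x)) - 2 * (mills4 x / mills x).
  by rewrite /mills31'; field; rewrite gt_eqF.
have e13 : mills3 x / mills x * (mills1 x / mills x) <= 216 / (1 + x) ^+ 4.
  apply: le_trans (ler_pM _ _ b3 b1) _ => //.
  by apply: eq_lerW; field; rewrite gt_eqF.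
have e4 : (1 + x) ^- 4 <= (1 + x) ^- 2.
  by rewrite lef_pV2 ?posrE ?exprn_gt0// ler_weXn2l//; lra.
have := mulr_ge0 c3 c1; have : 0 <= (1 + x) ^- 4 by rewrite invr_ge0 exprn_ge0 ?ltW.
rewrite ler_norml; lra.
Qed.

Lemma mills31_antiderivative : exists (A : R -> R) (l : R),
  [/\ forall x, 0 <= x -> is_derive x 1 A (mills31 x), A x @[x --> +oo] --> l
    & l - A 0 = 3 * beta_out].
Proof.
have cm x : {for x, continuous mills31} by apply: is_derive_continuous (is_derive_mills31 x).
have [A dA'] := antiderivative_exists (fun x (_ : -1 <= x) => cm x).
have dA x : 0 <= x -> is_derive x 1 A (mills31 x) by move=> x0; apply: dA'; lra.
have bd x : 0 <= x -> `|mills31 x| <= 36 / (1 + x) ^+ 2.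
  move=> x0; have [p q _] := mills31_decay x0; rewrite ger0_norm//.
  apply: le_trans q _; rewrite ler_wpM2l// lef_pV2 ?posrE ?exprn_gt0//; try lra.
  by rewrite ler_weXn2l//; lra.
have [l Al] := half_line_antiderivative_cvg dA bd.
have [I E] := half_line_FTC dA (fun x _ => cm x) bd Al.
exists A, l; split => //; rewrite -E /beta_out.
have -> : \int[mu]_(x in `[0, +oo[) (x * (2 * x ^+ 2 + 3) + (x ^+ 2 + 1) * derive1 Phi x)
    = \int[mu]_(x in `[0, +oo[) (- 2 * mills31 x); last by rewrite RintegralZl//; lra.
apply: eq_Rintegral => x _; rewrite derive_Phi mills31E.
by move: (mills x) (mills_gt0 x) => F p; field; rewrite gt_eqF.
Qed.

Lemma mills_le1 x : 0 <= x -> mills x <= 1.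
Proof.
move=> x0; have := mills_nincr (lexx _) x0.
have : Num.sqrt pi <= 2 :> R.
  rewrite -[leRHS]ger0_norm// -sqrtr_sqr ler_sqrt//.
  by rewrite expr2; have := pihalf_lt2 R; lra.
by rewrite mills0; lra.
Qed.

Lemma is_derive_ln_mills x : is_derive x 1 (fun y => ln (mills y)) (2 * x - (mills x)^-1).
Proof.
have d := is_derive_mills x; have p := mills_gt0 x; isd => //.
by field; rewrite gt_eqF.
Qed.

(** [mills] is the Laplace transform of e^{-s^2} at 2 x, so the second derivative of its logarithm
    is 4 times the variance of s under the normalised weight. In this form its decay follows from
    [mills_decay]. *)
Lemma is_derive_ln_mills' x :
  is_derive x 1 (fun y => 2 * y - (mills y)^-1)
    (4 * (mills2 x / mills x - (mills1 x / mills x) ^+ 2)).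
Proof.
have d := is_derive_mills x; have p := mills_gt0 x; isd; first by rewrite gt_eqF.
rewrite /mills1 /mills2; move: (mills x) p => F p.
by field; rewrite gt_eqF.
Qed.

Lemma ln_mills_decay x : 0 <= x ->
  `|4 * (mills2 x / mills x - (mills1 x / mills x) ^+ 2)| <= 144 / (1 + x) ^+ 2.
Proof.
move=> x0; have [a1 a2 a3 a4 a5] := mills_ge0 x0.
have [d1 d2 _ _] := mills_decay x0.
have p := mills_gt0 x; have x1 : 0 < 1 + x by lra.
have b1 : mills1 x / mills x <= 6 / (1 + x).
  by rewrite ler_pdivrMr// mulrAC ler_pdivlMr// mulrC.
have b2 : mills2 x / mills x <= 12 / (1 + x) ^+ 2.
  by rewrite ler_pdivrMr// mulrAC ler_pdivlMr ?exprn_gt0// mulrC.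
have c1 : 0 <= mills1 x / mills x by rewrite divr_ge0// ltW.
have c2 : 0 <= mills2 x / mills x by rewrite divr_ge0// ltW.
have e1 : (mills1 x / mills x) ^+ 2 <= 36 / (1 + x) ^+ 2.
  apply: le_trans (_ : (6 / (1 + x)) ^+ 2 <= _).
    by rewrite lerXn2r ?nnegrE// divr_ge0// ltW.
  by apply: eq_lerW; field; rewrite gt_eqF.
have := sqr_ge0 (mills1 x / mills x).
by rewrite ler_norml; lra.
Qed.

Lemma mills_le x : 0 <= x -> (1 + x) * mills x <= 2.
Proof.
move=> x0; have [a1 _ _ _ _] := mills_ge0 x0.
have p := mills_gt0 x; have q := mills_le1 x0.
case: (leP 1 x) => x2.
  have : 0 <= (x - 1) * mills x by rewrite mulr_ge0 ?(ltW p)//; lra.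
  by move: a1; rewrite /mills1; lra.
have : (1 + x) * mills x <= 2 * 1 by apply: ler_pM => //; lra.
by rewrite mulr1.
Qed.

Lemma mills_asymptotic x : 0 <= x -> `|(1 + x) * mills x - 2^-1| <= 6 / (1 + x).
Proof.
move=> x0; have [a1 _ _ _ _] := mills_ge0 x0; have [d1 _ _ _] := mills_decay x0.
have p := mills_gt0 x; have q := mills_le1 x0; have x1 : 0 < 1 + x by lra.
have k := mills_le x0.
have -> : (1 + x) * mills x - 2^-1 = mills x - mills1 x by rewrite /mills1; field.
have h1 : mills x <= 6 / (1 + x) by rewrite ler_pdivlMr// mulrC; lra.
have h2 : mills1 x <= 6 / (1 + x) by rewrite ler_pdivlMr// mulrC; lra.
by rewrite ler_norml; lra.
Qed.

Lemma cvg_mills : (1 + x) * mills x @[x --> +oo] --> (2^-1 : R).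
Proof.
apply/subr_cvg0; apply: (@cvg0_le_inv _ _ 6) => x x0.
exact: mills_asymptotic.
Qed.

(** Since Phi' = - 1 / mills, the integrand of [alpha_out] is - (2/3) [mills31] plus the exact
    derivative h of - ln ((1 + x) mills x). The latter integrates to ln 2 + ln (sqrt pi / 2). The
    identity is needed because the sum over j produces [beta_out] only. *)
Lemma alpha_outE : alpha_out = ln pi / 2 - 2 * beta_out :> R.
Proof.
have [A [l [dA Al E]]] := mills31_antiderivative.
pose h x := (mills x)^-1 - 2 * x - (1 + x)^-1.
pose B x := - ln ((1 + x) * mills x).
have dB x : 0 <= x -> is_derive x 1 B (h x).
  move=> x0; have d := is_derive_mills x; have p := mills_gt0 x.
  rewrite /B; isd; first by rewrite mulr_gt0//; lra.
  by rewrite /h; field; rewrite !gt_eqF//; lra.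
have bh x : 0 <= x -> `|h x| <= 36 / (1 + x) ^+ 2.
  move=> x0; have [a1 a2 _ _ _] := mills_ge0 x0; have [d1 d2 _ _] := mills_decay x0.
  have p := mills_gt0 x; have x1 : 0 < 1 + x by lra.
  have q : 0 < (1 + x) * mills x := mulr_gt0 x1 p.
  (* The three terms of h are not small separately; the moment identities exhibit their
     cancellation, and the decay (1 + x)^{-2} becomes visible. *)
  have -> : h x = 2 * (mills1 x - mills2 x) / ((1 + x) * mills x).
    rewrite /h /mills1 /mills2; move: (mills x) p => F p.
    by field; rewrite !gt_eqF.
  have u1 : mills1 x / ((1 + x) * mills x) <= 6 / (1 + x) ^+ 2.
    rewrite ler_pdivrMr//.
    have -> : 6 / (1 + x) ^+ 2 * ((1 + x) * mills x) = 6 * mills x / (1 + x).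
      by field; rewrite gt_eqF.
    by rewrite ler_pdivlMr// mulrC.
  have u2 : mills2 x / ((1 + x) * mills x) <= 12 / (1 + x) ^+ 2.
    rewrite ler_pdivrMr//.
    have -> : 12 / (1 + x) ^+ 2 * ((1 + x) * mills x) = 12 * mills x / (1 + x).
      by field; rewrite gt_eqF.
    rewrite ler_pdivlMr// mulrC; apply: le_trans d2.
    by rewrite ler_wpM2r// ler_eXnr//; lra.
  have v1 : 0 <= mills1 x / ((1 + x) * mills x) by rewrite divr_ge0// ltW.
  have v2 : 0 <= mills2 x / ((1 + x) * mills x) by rewrite divr_ge0// ltW.
  have w : 0 <= (1 + x) ^- 2 by rewrite invr_ge0 exprn_ge0// ltW.
  by rewrite -mulrA mulrBl ler_norml; lra.
have ch x : 0 <= x -> {for x, continuous h}.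
  move=> x0; have d := is_derive_mills x; have p := mills_gt0 x.
  apply: is_derive_continuous; rewrite /h; isd_step; rewrite gt_eqF//; lra.
have Boo : B x @[x --> +oo] --> (- ln 2^-1 : R).
  by apply: cvgN; apply: continuous_cvg; [exact: continuous_ln|exact: cvg_mills].
have [Ih Eh] := half_line_FTC dB ch bh Boo.
have cm x : 0 <= x -> {for x, continuous mills31}.
  by move=> _; apply: is_derive_continuous (is_derive_mills31 x).
have bd x : 0 <= x -> `|mills31 x| <= 36 / (1 + x) ^+ 2.
  move=> x0; have [p q _] := mills31_decay x0; rewrite ger0_norm//.
  apply: le_trans q _; rewrite ler_wpM2l// lef_pV2 ?posrE ?exprn_gt0//; try lra.
  by rewrite ler_weXn2l//; lra.
have [I31 E31] := half_line_FTC dA cm bd Al.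
rewrite /alpha_out.
transitivity (\int[mu]_(x in `[0, +oo[) (- (2 / 3) * mills31 x + h x)).
  apply: eq_Rintegral => x _; rewrite derive_Phi mills31E /h (addrC x 1).
  by move: (mills x) (mills_gt0 x) (1 + x)^-1 => F p r; field; rewrite gt_eqF.
rewrite RintegralD//; last exact: integrable_mulrl.
rewrite RintegralZl// Eh E31 E /B addr0 mul1r mills0 lnV ?posrE//.
have sp : 0 < Num.sqrt pi :> R by rewrite sqrtr_gt0 pi_gt0.
have lp : ln pi = 2 * ln (Num.sqrt pi) :> R.
  by rewrite -[in LHS](sqr_sqrtr (pi_ge0 R)) expr2 lnM ?posrE//; ring.
by rewrite lnM ?posrE// lnV ?posrE// lp; lra.
Qed.

Lemma pinfty_limit_le (f : R -> R) (a c l : R) : (forall y, a <= y -> c <= f y) ->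
  f x @[x --> +oo] --> l -> c <= l.
Proof.
move=> cf fl; rewrite -(cvg_lim _ fl)//; apply: limr_ge; first by apply/cvg_ex; exists l.
by near=> y; apply: cf; near: y; apply: nbhs_pinfty_ge; rewrite num_real.
Unshelve. all: by end_near. Qed.

Lemma ln_le_subr1 (y : R) : 0 < y -> ln y <= y - 1.
Proof. by move=> y0; rewrite -ler_expR lnK ?posrE//; have := expR_ge1Dx (y - 1); lra. Qed.

Lemma cvg_xlnx : x * ln x @[x --> 0^'+] --> (0 : R).
Proof.
apply/norm_cvg0P.
apply: (@squeeze_cvgr _ _ _ _ (cst 0) (fun x => 2 * Num.sqrt x)).
- near=> x; rewrite normr_ge0/=.
  have x0 : 0 < x by near: x; exact: nbhs_right_gt.
  have x1 : x <= 1 by near: x; exact: nbhs_right_le.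
  have s0 : 0 < Num.sqrt x by rewrite sqrtr_gt0.
  rewrite normrM gtr0_norm// ler0_norm ?ln_le0//.
  have {1 2}-> : x = Num.sqrt x * Num.sqrt x by rewrite -expr2 sqr_sqrtr// ltW.
  move: (Num.sqrt x) s0 => s s0; rewrite lnM ?posrE//.
  have si : 0 < s^-1 by rewrite invr_gt0.
  have := ln_le_subr1 si; rewrite lnV ?posrE// => h.
  have : s * s * (- ln s) <= s * s * s^-1 by rewrite ler_wpM2l ?mulr_ge0 ?(ltW s0)//; lra.
  have -> : s * s * s^-1 = s by field; rewrite gt_eqF.
  lra.
- exact: cvg_cst.
- have c0 : Num.sqrt x @[x --> 0^'+] --> (0 : R).
    by apply: cvg_at_right_filter; rewrite -[X in _ --> X](sqrtr0 R); exact: sqrt_continuous.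
  by rewrite -[X in _ --> X](mulr0 2); exact: cvgMr.
Unshelve. all: by end_near. Qed.

(** Both bounds come from ln y <= y - 1, applied to y itself and to the reciprocal of its lower
    bound. They agree to leading order, - 1 / (2 x^2), which is what fixes the 1 / (2 x) tail of the
    antiderivative. *)
Lemma ln_2x_mills_bounds x : 0 < x ->
  - (2 * x ^+ 2)^-1 <= ln (2 * x * mills x) <= - (3 + 2 * x ^+ 2)^-1.
Proof.
move=> x0; have /andP[h1 h2] := mills_upper_lower x0.
have p : 0 < 2 * x * mills x by apply: mulr_gt0; [lra|exact: mills_gt0].
have x2 : 0 < x ^+ 2 by rewrite exprn_gt0.
apply/andP; split; last by apply: le_trans (ln_le_subr1 p) _; lra.
have q : 0 < 1 + (2 * x ^+ 2)^-1 by rewrite addr_gt0// invr_gt0; lra.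
have := ln_le_subr1 q.
have -> : 1 + (2 * x ^+ 2)^-1 = (1 - (1 + 2 * x ^+ 2)^-1)^-1.
  by field; rewrite !gt_eqF//; lra.
have r : 0 < 1 - (1 + 2 * x ^+ 2)^-1.
  rewrite subr_gt0 invf_lt1; lra.
rewrite lnV ?posrE// => h.
have : ln (1 - (1 + 2 * x ^+ 2)^-1) <= ln (2 * x * mills x) by rewrite ler_ln ?posrE.
have -> : (2 * x ^+ 2)^-1 = (1 - (1 + 2 * x ^+ 2)^-1)^-1 - 1.
  by field; rewrite !gt_eqF//; lra.
lra.
Qed.

(** As ln (mills x) is close to - ln (2 x) at infinity, [A] diverges; B x = A x + x ln (2 x) - x has
    the integrable derivative ln (2 x mills x), which is the integrand of [gamma_out], and tends to
    A 0 at 0 because x ln x vanishes there. The two-sided tail bound is exact to order 1 / x. *)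
Lemma ln_mills_antiderivative : exists (A : R -> R) (l : R),
  [/\ forall x, 0 <= x -> is_derive x 1 A (ln (mills x)),
      l - A 0 = - Num.sqrt 2 * gamma_out
    & forall x, 1 <= x ->
        - (2 * x)^-1 <= l - (A x + x * ln (2 * x) - x) <= - (2 * (x + 1))^-1].
Proof.
have cm x : {for x, continuous (fun y => ln (mills y))}.
  exact: is_derive_continuous (is_derive_ln_mills x).
have [A dA'] := antiderivative_exists (fun x (_ : -1 <= x) => cm x).
have dA x : 0 <= x -> is_derive x 1 A (ln (mills x)) by move=> x0; apply: dA'; lra.
pose B x := A x + x * ln (2 * x) - x.
have dB x : 0 < x -> is_derive x 1 B (ln (2 * x * mills x)).
  move=> x0; have d := dA _ (ltW x0); rewrite /B; isd; first by rewrite mulr_gt0.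
  rewrite [in RHS]lnM ?posrE; [|lra|exact: mills_gt0].
  by field; rewrite gt_eqF.
have [l Bl] : exists l : R, B x @[x --> +oo] --> l.
  (* The derivative of [B] is singular at 0, so convergence is proved for the translate by 1, where
     a bound by 1 / (1 + x)^2 holds on the whole half line. *)
  have [||l Bl] := @half_line_antiderivative_cvg R
      (fun x => ln (2 * (x + 1) * mills (x + 1))) (fun x => B (x + 1)) 1.
  - move=> x x0; have d := dB (x + 1) (ltr_wpDl x0 ltr01).
    by isd; ring.
  - move=> x x0; have x1 : 0 < x + 1 by lra.
    have /andP[h1 h2] := ln_2x_mills_bounds x1.
    have h3 : 0 <= (3 + 2 * (x + 1) ^+ 2)^-1.
      by rewrite invr_ge0 addr_ge0// mulr_ge0// exprn_ge0// ltW.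
    have h4 : (2 * (x + 1) ^+ 2)^-1 <= 1 / (1 + x) ^+ 2.
      rewrite div1r (addrC 1) lef_pV2 ?posrE ?mulr_gt0 ?exprn_gt0//.
      by rewrite ler_peMl ?exprn_ge0 ?ltW//; lra.
    by rewrite ler_norml; lra.
  exists l.
  have : B (x - 1 + 1) @[x --> +oo] --> l.
    apply: (cvg_comp (fun x => x - 1) (fun x => B (x + 1))); last exact: Bl.
    by apply: cvg_addrr; exact: cvg_id.
  by under eq_fun do rewrite subrK.
have B0 : B x @[x --> 0^'+] --> A 0.
  have c0 : (A x + (x * ln x + x * ln 2) - x) @[x --> 0^'+] --> A 0 + (0 + 0 * ln 2) - 0.
    apply: cvgB; last by apply: cvg_at_right_filter; exact: cvg_id.
    apply: cvgD.
      by apply: cvg_at_right_filter; apply: is_derive_continuous (dA 0 (lexx _)).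
    apply: cvgD; first exact: cvg_xlnx.
    by apply: cvgMl; apply: cvg_at_right_filter; exact: cvg_id.
  rewrite mul0r !addr0 subr0 in c0; apply: cvg_trans c0; apply: near_eq_cvg.
  near=> x; have x0 : 0 < x by near: x; exact: nbhs_right_gt.
  by rewrite /B lnM ?posrE//; ring.
exists A, l; split => //.
- rewrite /gamma_out.
  have -> : \int[mu]_(x in `[0, +oo[) ln (Num.sqrt pi * x * expR (x ^+ 2) * erfc x) =
      \int[mu]_(x in `[0, +oo[) ln (2 * x * mills x).
    apply: eq_Rintegral => x _; congr ln; rewrite /mills.
    by move: (expR _) (erfc x) (Num.sqrt pi) => a b c; field.
  rewrite (@le0_open_half_line_FTC _ _ B (A 0) l) //.
  + have : Num.sqrt 2 != 0 :> R by rewrite gt_eqF// sqrtr_gt0.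
    by move: (Num.sqrt 2) => w w0; field.
  + by rewrite mulr0 mul0r ln0.
  + move=> x x0; have /andP[_ h] := ln_2x_mills_bounds x0.
    have h3 : 0 <= (3 + 2 * x ^+ 2)^-1.
      by rewrite invr_ge0 addr_ge0// mulr_ge0// exprn_ge0// ltW.
    lra.
  + move=> x x0; have d := is_derive_mills x; have p := mills_gt0 x.
    have q : 0 < 2 * x * mills x by apply: mulr_gt0 => //; lra.
    by apply: is_derive_continuous; isd_step.
(* By the logarithmic bounds, B z - 1 / (2 z) and - B z + 1 / (2 (z + 1)) are nondecreasing for z >=
   1, hence at most their limits l and - l. *)
- move=> x x1; rewrite -/(B x); apply/andP; split.
    suff : B x - (2 * x)^-1 <= l by lra.
    apply: (pinfty_limit_le (a := x)) Bl => y xy.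
    have y0 : 0 <= (2 * y)^-1 by rewrite invr_ge0; lra.
    suff : B x - (2 * x)^-1 <= B y - (2 * y)^-1 by lra.
    apply: (@derive_ge0_le _ (fun z => B z - (2 * z)^-1)
      (fun z => ln (2 * z * mills z) + (2 * z ^+ 2)^-1) _ _ xy).
      move=> z /andP[xz _]; have z0 : 0 < z by lra.
      have d := dB z z0; isd; first by rewrite gt_eqF//; lra.
      by field; rewrite gt_eqF.
    move=> z /andP[xz _]; have z0 : 0 < z by lra.
    by have /andP[h _] := ln_2x_mills_bounds z0; lra.
  suff : - B x + (2 * (x + 1))^-1 <= - l + 2^-1 * 0 by lra.
  have Cl : - B y + 2^-1 * (1 + y)^-1 @[y --> +oo] --> - l + 2^-1 * 0.
    by apply: cvgD; [exact: cvgN|apply: cvgMr; exact: cvg_inv_1Dx].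
  apply: (pinfty_limit_le (a := x)) Cl => y xy.
  have -> : 2^-1 * (1 + y)^-1 = (2 * (y + 1))^-1 by field; rewrite gt_eqF//; lra.
  apply: (@derive_ge0_le _ (fun z => - B z + (2 * (z + 1))^-1)
    (fun z => - ln (2 * z * mills z) - (2 * (z + 1) ^+ 2)^-1) _ _ xy).
    move=> z /andP[xz _]; have z0 : 0 < z by lra.
    have d := dB z z0; isd; first by rewrite gt_eqF//; lra.
    by field; rewrite gt_eqF//; lra.
  move=> z /andP[xz _]; have z0 : 0 < z by lra.
  have /andP[_ h] := ln_2x_mills_bounds z0.
  (* 2 (z + 1)^2 >= 3 + 2 z^2 fails for small z; here z >= x >= 1. *)
  have : (2 * (z + 1) ^+ 2)^-1 <= (3 + 2 * z ^+ 2)^-1.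
    have z2 : 0 < z ^+ 2 by rewrite exprn_gt0.
    by rewrite lef_pV2 ?posrE; rewrite ?sqrrD ?mulr1 ?expr1n; lra.
  lra.
Unshelve. all: by end_near. Qed.

End edge_constants.

(** * Sums of logarithms for the two profiles *)

Section asymptotic_sums.
Context {R : realType}.
Implicit Types (a b c K x : R) (L : nat -> nat -> R).

Lemma cvg_sqrt_natr_inv : (Num.sqrt N%:R)^-1 @[N --> \oo] --> (0 : R).
Proof.
apply/cvgrPdist_le => e e0; near=> N.
rewrite sub0r normrN ger0_norm ?invr_ge0 ?sqrtr_ge0//.
have N0 : e ^- 2 <= N%:R by near: N; exact: nbhs_infty_ger.
have Np : 0 < N%:R :> R by apply: lt_le_trans N0; rewrite invr_gt0 exprn_gt0.
rewrite -[leRHS]invrK lef_pV2 ?posrE ?invr_gt0 ?sqrtr_gt0//.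
rewrite -[leLHS]ger0_norm ?invr_ge0 ?(ltW e0)// -sqrtr_sqr ler_sqrt// exprVn//.
Unshelve. all: by end_near. Qed.

Lemma natr_inv_cvg0 : N%:R^-1 @[N --> \oo] --> (0 : R).
Proof.
rewrite -(mulr0 0); apply: cvg_trans (cvgM cvg_sqrt_natr_inv cvg_sqrt_natr_inv).
apply: near_eq_cvg; near=> N.
by rewrite /= -invfM -expr2 sqr_sqrtr.
Unshelve. all: by end_near. Qed.

(** Applied with a = - q'(1) and b = Delta Q(1). Here d = e = 1/N, the sum runs over [0, 1], and all
    antiderivatives are elementary; - N log N is N ln d. The absolute error e^3 (1 + x)^{-3} is the
    required relative one, because the profile is comparable to 1 / (1 + x). *)
Lemma inside_asymptotics a b K L : 0 < a -> 0 <= K ->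
  (forall N k, (0 < k <= N)%N -> let e : R := N%:R^-1 in let x := e * k%:R in
     `|L N k - e * (a + 2 * x)^-1 * (1 - e * b * (a + 2 * x) ^- 2)|
       <= K * e ^+ 3 / (1 + x) ^+ 3) ->
  (fun N => \sum_(1 <= k < N.+1) ln (L N k) -
    (- (N%:R * ln N%:R) + N%:R * (1 + a / 2 * ln a - (a + 2) / 2 * ln (a + 2)) +
     (ln a - ln (a + 2)) / 2 + b / 2 * ((a + 2)^-1 - a^-1))) @ \oo --> (0 : R).
Proof.
move=> a0 K0 HL.
pose m x := (a + 2 * x)^-1; pose v x := - b * (a + 2 * x) ^- 2.
have ax x : 0 <= x -> 0 < a + 2 * x by lra.
have axn x : 0 <= x -> a + 2 * x != 0 by move=> x0; rewrite gt_eqF// ax.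
(* c = min (a, 1) gives c (1 + x) <= a + 2 x, so powers of the profile are bounded by powers of 1 /
   (1 + x). *)
have [c [c0 ca c1]] : exists c, [/\ 0 < c, c <= a & c <= 1].
  by exists (Num.min a 1); rewrite lt_min a0 ltr01 !ge_min !lexx orbT.
have ci : 1 <= c^-1 by rewrite invf_ge1.
have ac x : 0 <= x -> c * (1 + x) <= a + 2 * x.
  move=> x0; have : c * x <= 1 * x by rewrite ler_wpM2r//; lra.
  lra.
have m0 x : 0 <= x -> 0 < m x by move=> x0; rewrite invr_gt0 ax.
have mc x : 0 <= x -> m x <= c^-1 / (1 + x).
  move=> x0; rewrite -invfM lef_pV2 ?posrE ?ax ?mulr_gt0//; [exact: ac|lra].
have mc2 n x : 0 <= x -> m x ^+ n <= c^-1 ^+ n / (1 + x) ^+ n.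
  move=> x0; rewrite -exprVn -exprMn lerXn2r ?nnegrE ?mc//; first exact/ltW/m0.
  by rewrite divr_ge0 ?invr_ge0 ?(ltW c0)//; lra.
have mlow x : 0 <= x -> (a + 2)^-1 / (1 + x) <= m x.
  move=> x0; rewrite -invfM lef_pV2 ?posrE ?ax ?mulr_gt0//; try lra.
  by have := mulr_ge0 (ltW a0) x0; lra.
have inv_le (n p : nat) x : 0 <= x -> (n <= p)%N -> (1 + x) ^- p <= (1 + x) ^- n.
  move=> x0 np; rewrite lef_pV2 ?posrE ?exprn_gt0//; try lra.
  by rewrite ler_weXn2l//; lra.
(* One constant for all hypotheses: the second derivative of ln m, then v and its derivative, then
   the error K divided by the lower bound m >= 1 / ((a + 2) (1 + x)). *)
pose K1 := 4 * c^-1 ^+ 2 + 4 * `|b| * c^-1 ^+ 3 + K * (a + 2).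
have Kb1 : 0 <= 4 * c^-1 ^+ 2 by rewrite mulr_ge0// exprn_ge0; lra.
have Kb2 : 0 <= 4 * `|b| * c^-1 ^+ 3.
  by apply: mulr_ge0; [exact: mulr_ge0|apply: exprn_ge0; lra].
have Kb3 : 0 <= K * (a + 2) by rewrite mulr_ge0//; lra.
have K10 : 0 <= K1 by rewrite /K1; lra.
have le_div (A B : R) n x : 0 <= x -> A <= B -> A / (1 + x) ^+ n <= B / (1 + x) ^+ n.
  by move=> x0 AB; rewrite ler_wpM2r// invr_ge0 exprn_ge0//; lra.
pose l2 x := 4 * m x ^+ 2.
pose v' x := 4 * b * m x ^+ 3.
pose Al x := x - (a + 2 * x) / 2 * ln (a + 2 * x).
pose Av x := b / 2 * (a + 2 * x)^-1.
have [K' K'0 H] : exists2 K' : R, 0 <= K' & forall (L : nat -> R) d e N,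
    0 < d -> 0 < e <= 1 -> e * (4 * K1) <= 1 ->
    (forall k, (0 < k <= N)%N -> `|L k - d * m (d * k%:R) * (1 + e * v (d * k%:R))|
       <= K1 * e ^+ 2 * d * m (d * k%:R) / (1 + d * k%:R) ^+ 2) ->
    `|\sum_(1 <= k < N.+1) ln (L k) -
      (N%:R * ln d + (Al (d * N%:R) - Al 0) / d +
       (ln (m (d * N%:R)) - ln (m 0)) / 2 + e / d * (Av (d * N%:R) - Av 0))|
      <= K' * (e ^+ 2 * (1 + d^-1) + (d + e) * (1 + d)).
  refine (@sum_ln_expansion R m (fun x => - 2 * (a + 2 * x)^-1) l2 v v' Al Av K1
    K10 m0 _ _ _ _ _ _ _ _).
  - move=> x x0; have p := ax x x0; rewrite /Al /m; isd => //.
    by rewrite lnV ?posrE//; field; rewrite gt_eqF.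
  - move=> x x0; have p := ax x x0; rewrite /m; isd; rewrite ?invr_gt0 ?gt_eqF//.
    by field; rewrite gt_eqF.
  - move=> x x0; have p := ax x x0; rewrite /l2 /m; isd; rewrite ?invr_gt0 ?gt_eqF//.
    by field; rewrite gt_eqF.
  - move=> x x0; rewrite /l2 ger0_norm; last by rewrite mulr_ge0// exprn_ge0// ltW// m0.
    apply: le_trans (_ : (4 * c^-1 ^+ 2) / (1 + x) ^+ 2 <= _).
      by rewrite -mulrA ler_wpM2l// mc2.
    by apply: le_div => //; rewrite /K1; lra.
  - move=> x x0; have p := ax x x0; rewrite /Av /v; isd; rewrite ?gt_eqF//.
    by field; rewrite gt_eqF.
  - move=> x x0; have p := ax x x0; rewrite /v /v' /m; isd.
      by rewrite expf_neq0// gt_eqF.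
    by field; rewrite gt_eqF.
  - move=> x x0; rewrite /v' [`|_ * m x ^+ 3|]normrM [`|4 * b|]normrM normr_nat (ger0_norm (exprn_ge0 3 (ltW (m0 _ x0)))).
    apply: le_trans (_ : (4 * `|b| * c^-1 ^+ 3) / (1 + x) ^+ 3 <= _).
      by rewrite -[leRHS]mulrA ler_wpM2l ?mulr_ge0// mc2.
    apply: le_trans (_ : K1 / (1 + x) ^+ 3 <= _).
      by apply: le_div => //; rewrite /K1; lra.
    by rewrite ler_wpM2l// inv_le.
  - move=> x x0; rewrite /v normrM normrN ger0_norm; last first.
      by rewrite invr_ge0 exprn_ge0// ltW// ax.
    apply: le_trans (_ : (4 * `|b| * c^-1 ^+ 3) / (1 + x) ^+ 2 <= _).
      have -> : 4 * `|b| * c^-1 ^+ 3 / (1 + x) ^+ 2 = `|b| * (4 * c^-1 ^+ 3 / (1 + x) ^+ 2) by ring.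
      rewrite -exprVn ler_wpM2l//; apply: le_trans (mc2 2%N _ x0) _; apply: le_div => //.
      have c2 : 0 <= c^-1 ^+ 2 by apply: exprn_ge0; lra.
      by have := ler_wpM2l c2 ci; rewrite mulr1 -exprSr; lra.
    apply: le_trans (_ : K1 / (1 + x) ^+ 2 <= _).
      by apply: le_div => //; rewrite /K1; lra.
    by rewrite ler_wpM2l// -[X in _ <= X^-1]expr1 inv_le.
apply/norm_cvg0P.
pose P (e : R) := K' * (e ^+ 2 + e + 2 * e * (1 + e)).
have P0 : P N%:R^-1 @[N --> \oo] --> (0 : R).
  have c1' := natr_inv_cvg0.
  have -> : (0 : R) = K' * (0 * 0 + 0 + 2 * 0 * (1 + 0)) by ring.
  apply: cvgMr; apply: cvgD; first by apply: cvgD => //; exact: cvgM.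
  by apply: cvgM; [exact: cvgMr|apply: cvgD => //; exact: cvg_cst].
apply: (@squeeze_cvgr _ _ _ _ (cst 0) (fun N => P N%:R^-1)) => //; last exact: cvg_cst.
near=> N; rewrite normr_ge0/=.
have N0 : (0 < N)%N by near: N; exact: nbhs_infty_gt.
have Np : 0 < N%:R :> R by rewrite ltr0n.
have e0 : 0 < N%:R^-1 :> R by rewrite invr_gt0.
have e1 : N%:R^-1 <= 1 :> R by rewrite invf_le1// ler1n.
have eK : N%:R^-1 * (4 * K1) <= 1.
  rewrite mulrC ler_pdivrMr// mul1r.
  by near: N; exact: nbhs_infty_ger.
have e01 : 0 < (N%:R^-1 : R) <= 1 by rewrite e0.
have Hk k : (0 < k <= N)%N ->
    `|L N k - N%:R^-1 * m (N%:R^-1 * k%:R) * (1 + N%:R^-1 * v (N%:R^-1 * k%:R))|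
    <= K1 * N%:R^-1 ^+ 2 * N%:R^-1 * m (N%:R^-1 * k%:R) / (1 + N%:R^-1 * k%:R) ^+ 2.
  move=> kN; have /= := HL N k kN.
  have x0 : 0 <= (N%:R^-1 * k%:R : R) by rewrite mulr_ge0// ltW.
  move: (N%:R^-1 * k%:R) x0 => x x0.
  have -> : N%:R^-1 * (a + 2 * x)^-1 * (1 - N%:R^-1 * b * (a + 2 * x) ^- 2) =
      N%:R^-1 * m x * (1 + N%:R^-1 * v x) by rewrite /m /v; ring.
  move=> h; apply: le_trans h _.
  have mx := mlow _ x0; have x1 : 0 < 1 + x := ltr_pwDl ltr01 x0.
  move: (N%:R^-1) e0 => e e0.
  have e3 : 0 <= e ^+ 3 by rewrite exprn_ge0// ltW.
  apply: le_trans (_ : K * (a + 2) * e ^+ 3 * m x / (1 + x) ^+ 2 <= _).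
    have -> : K * e ^+ 3 / (1 + x) ^+ 3 =
        K * (a + 2) * e ^+ 3 * ((a + 2)^-1 / (1 + x)) / (1 + x) ^+ 2.
      by field; rewrite !gt_eqF// addr_gt0.
    rewrite ler_wpM2r ?invr_ge0 ?exprn_ge0 ?(ltW x1)// ler_wpM2l//.
    exact: mulr_ge0.
  apply: le_div => //.
  have -> : K1 * e ^+ 2 * e * m x = K1 * (e ^+ 3 * m x) by ring.
  rewrite -mulrA ler_wpM2r ?(mulr_ge0 e3 (ltW (m0 _ x0)))//.
  by rewrite /K1; lra.
have := H (L N) N%:R^-1 N%:R^-1 N e0 e01 eK Hk.
have -> : K' * (N%:R^-1 ^+ 2 * (1 + N%:R^-1^-1) + (N%:R^-1 + N%:R^-1) * (1 + N%:R^-1)) = P N%:R^-1.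
  by rewrite /P; field; rewrite gt_eqF.
have -> : N%:R^-1 * N%:R = 1 :> R by rewrite mulVf// gt_eqF.
congr (`|_| <= _); congr (_ - _).
rewrite /Al /Av /m mulr0 addr0 mulr1 !lnV ?posrE//; last lra.
by field; rewrite !gt_eqF//; lra.
Unshelve. all: by end_near. Qed.

(** Applied with b = Delta Q(1) and c = g'''(0). The end point x = d N = d0 sqrt N goes to infinity,
    and 1 / d = x b / 2. The constant of the renormalised antiderivative gives the sqrt N term; its
    tail, multiplied by x b / 2, gives b / 4; the end correction ln (mills x) / 2, close to - ln (2
    x) / 2, gives - (1/4) log N. *)
Lemma edge_asymptotics b c K L : 0 < b -> 0 <= K ->
  let d0 := Num.sqrt (2 / b) in
  (forall N k, (0 < k <= N)%N -> let e : R := (Num.sqrt N%:R)^-1 in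
     let d := d0 * e in let x := d * k%:R in
     `|L N k - d * (mills x - e * (c / 6 * d0 ^+ 3) * mills3 x)|
       <= K * e ^+ 2 * d / (1 + x) ^+ 3) ->
  (fun N => \sum_(1 <= k < N.+1) ln (L N k) -
    (- (N%:R * ln N%:R) - N%:R * (ln 2 - 1) -
     Num.sqrt N%:R * gamma_out * Num.sqrt b - 4^-1 * ln N%:R +
     b / 4 + 4^-1 * ln (b / 2) - 4^-1 * ln pi - c / b * beta_out)) @ \oo --> (0 : R).
Proof.
move=> b0 K0 d0 HL.
have d00 : 0 < d0 by rewrite sqrtr_gt0 divr_gt0.
have d02 : d0 ^+ 2 = 2 / b by rewrite sqr_sqrtr// divr_ge0// ltW.
pose kap := c / 6 * d0 ^+ 3; pose v x := - kap * mills31 x.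
have [Al [l [dAl lE Altail]]] := @ln_mills_antiderivative R.
have [A3 [l3 [dA3 A3l l3E]]] := @mills31_antiderivative R.
(* 144 and 720 come from [ln_mills_decay] and [mills31_decay]; 3 K is the error divided by the lower
   bound mills x >= 1 / (3 (1 + x)). *)
pose K1 := 144 + 720 * `|kap| + 3 * K.
have kap0 := normr_ge0 kap.
have K10 : 0 <= K1 by rewrite /K1; lra.
have le_div (A B : R) n x : 0 <= x -> A <= B -> A / (1 + x) ^+ n <= B / (1 + x) ^+ n.
  by move=> x0 AB; rewrite ler_wpM2r// invr_ge0 exprn_ge0//; lra.
have inv_le (n p : nat) x : 0 <= x -> (n <= p)%N -> (1 + x) ^- p <= (1 + x) ^- n.
  move=> x0 np; rewrite lef_pV2 ?posrE ?exprn_gt0//; try lra.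
  by rewrite ler_weXn2l//; lra.
have [K' K'0 H] : exists2 K' : R, 0 <= K' & forall (L : nat -> R) (d e : R) N,
    0 < d -> 0 < e <= 1 -> e * (4 * K1) <= 1 ->
    (forall k, (0 < k <= N)%N -> `|L k - d * mills (d * k%:R) * (1 + e * v (d * k%:R))|
       <= K1 * e ^+ 2 * d * mills (d * k%:R) / (1 + d * k%:R) ^+ 2) ->
    `|\sum_(1 <= k < N.+1) ln (L k) -
      (N%:R * ln d + (Al (d * N%:R) - Al 0) / d +
       (ln (mills (d * N%:R)) - ln (mills 0)) / 2 +
       e / d * (- kap * A3 (d * N%:R) - - kap * A3 0))|
      <= K' * (e ^+ 2 * (1 + d^-1) + (d + e) * (1 + d)).
  refine (@sum_ln_expansion R (@mills R) (fun x => 2 * x - (mills x)^-1)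
    (fun x => 4 * (mills2 x / mills x - (mills1 x / mills x) ^+ 2)) v
    (fun x => - kap * mills31' x) Al (fun x => - kap * A3 x) K1 K10 _ dAl _ _ _ _ _ _ _).
  - by move=> x _; exact: mills_gt0.
  - by move=> x _; exact: is_derive_ln_mills.
  - by move=> x _; exact: is_derive_ln_mills'.
  - move=> x x0; apply: le_trans (ln_mills_decay x0) _; apply: le_div => //.
    by rewrite /K1; lra.
  - by move=> x x0; have d := dA3 _ x0; rewrite /v; isd; ring.
  - by move=> x x0; have d := is_derive_mills31 x; rewrite /v; isd; ring.
  - move=> x x0; have [_ _ h] := mills31_decay x0.
    rewrite normrM normrN; apply: le_trans (ler_wpM2l kap0 h) _.
    by rewrite mulrA; apply: le_div => //; rewrite /K1; lra.
  - move=> x x0; have [h1 h2 _] := mills31_decay x0.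
    rewrite /v normrM normrN (ger0_norm h1); apply: le_trans (ler_wpM2l kap0 h2) _.
    apply: le_trans (_ : K1 / (1 + x) ^+ 3 <= _).
      by rewrite mulrA; apply: le_div => //; rewrite /K1; lra.
    by rewrite ler_wpM2l// -[X in _ <= X^-1]expr1 inv_le.
pose T N (e : R) := N%:R * ln (d0 * e) + (Al (d0 * e * N%:R) - Al 0) / (d0 * e) +
       (ln (mills (d0 * e * N%:R)) - ln (mills 0)) / 2 +
       e / (d0 * e) * (- kap * A3 (d0 * e * N%:R) - - kap * A3 0).
have S_T : (fun N => \sum_(1 <= k < N.+1) ln (L N k) - T N (Num.sqrt N%:R)^-1) @ \oo --> (0 : R).
  apply/norm_cvg0P.
  pose P (e : R) := K' * (e * e + e / d0 + (d0 + 1) * e * (1 + d0 * e)).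
  have P0 : P (Num.sqrt N%:R)^-1 @[N --> \oo] --> (0 : R).
    have ce := cvg_sqrt_natr_inv.
    have -> : (0 : R) = K' * (0 * 0 + 0 / d0 + (d0 + 1) * 0 * (1 + d0 * 0)) by ring.
    apply: cvgMr; apply: cvgD; first by apply: cvgD; [exact: cvgM|exact: cvgMl].
    by apply: cvgM; [exact: cvgMr|apply: cvgD; [exact: cvg_cst|exact: cvgMr]].
  apply: (@squeeze_cvgr _ _ _ _ (cst 0) (fun N => P (Num.sqrt N%:R)^-1)) => //; last exact: cvg_cst.
  near=> N; rewrite normr_ge0/=.
  have N0 : (0 < N)%N by near: N; exact: nbhs_infty_gt.
  have Np : 0 < N%:R :> R by rewrite ltr0n.
  have s1 : 1 <= (Num.sqrt N%:R : R) by rewrite -[leLHS]sqrtr1 ler_sqrt// ler1n.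
  have e0 : 0 < (Num.sqrt N%:R : R)^-1 by rewrite invr_gt0 (lt_le_trans ltr01).
  have e1 : (Num.sqrt N%:R : R)^-1 <= 1 by rewrite invf_le1// (lt_le_trans ltr01).
  have eK : (Num.sqrt N%:R)^-1 * (4 * K1) <= 1.
    have K4 : 0 <= 4 * K1 by rewrite mulr_ge0.
    rewrite mulrC ler_pdivrMr ?mul1r; last by rewrite (lt_le_trans ltr01).
    rewrite -[leLHS]ger0_norm// -sqrtr_sqr ler_sqrt//.
    by near: N; exact: nbhs_infty_ger.
  have e01 : 0 < ((Num.sqrt N%:R)^-1 : R) <= 1 by rewrite e0.
  have HLN k (kN : (0 < k <= N)%N) := HL N k kN.
  move: ((Num.sqrt N%:R)^-1) e0 e1 eK e01 HLN => e e0 e1 eK e01 HLN.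
  have d1 : 0 < d0 * e by exact: mulr_gt0.
  have Hk k : (0 < k <= N)%N ->
    `|L N k - d0 * e * mills (d0 * e * k%:R) * (1 + e * v (d0 * e * k%:R))|
    <= K1 * e ^+ 2 * (d0 * e) * mills (d0 * e * k%:R) / (1 + d0 * e * k%:R) ^+ 2.
    move=> kN; have /= := HLN k kN.
    have x0 : 0 <= d0 * e * k%:R by rewrite mulr_ge0// ltW.
    move: (d0 * e * k%:R) x0 => x x0; rewrite -/kap.
    have mx := mills_ge_inv x0; have mp := mills_gt0 x; have x1 : 0 < 1 + x := ltr_pwDl ltr01 x0.
    have -> : d0 * e * (mills x - e * kap * mills3 x) =
        d0 * e * mills x * (1 + e * v x).
      by rewrite /v /mills31; field; rewrite gt_eqF.
    move=> h; apply: le_trans h _.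
    have ed : 0 <= e ^+ 2 * (d0 * e) by rewrite mulr_ge0 ?exprn_ge0// ltW.
    apply: le_trans (_ : 3 * K * (e ^+ 2 * (d0 * e)) * mills x / (1 + x) ^+ 2 <= _).
      have -> : K * e ^+ 2 * (d0 * e) / (1 + x) ^+ 3 =
          3 * K * (e ^+ 2 * (d0 * e)) * (3 * (1 + x))^-1 / (1 + x) ^+ 2.
        by field; rewrite !gt_eqF//; lra.
      apply: le_div => //; rewrite ler_wpM2l//.
      by apply: mulr_ge0 => //; exact: mulr_ge0.
    apply: le_div => //.
    have -> : K1 * e ^+ 2 * (d0 * e) = K1 * (e ^+ 2 * (d0 * e)) by ring.
    by rewrite ler_wpM2r ?(ltW mp)// ler_wpM2r// /K1; lra.
  have := H (L N) (d0 * e) e N d1 e01 eK Hk.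
  have -> : K' * (e ^+ 2 * (1 + (d0 * e)^-1) + (d0 * e + e) * (1 + d0 * e)) = P e.
    by rewrite /P; field; rewrite !gt_eqF.
  by [].
pose r x := l - (Al x + x * ln (2 * x) - x).
(* What separates the prediction [T] from the announced expansion, written at x = d0 sqrt N: the
   tail of [Al], the error in mills x = 1 / (2 (1 + x)), the passage from 1 + x to x inside the
   logarithm, and the tail of [A3]. Each tends to 0. *)
pose E x := - (b / 2) * (x * r x + 2^-1) +
  2^-1 * (ln ((1 + x) * mills x) - ln 2^-1) + 2^-1 * ln (1 - (1 + x)^-1) -
  kap / d0 * (A3 x - l3).
have E0 : E x @[x --> +oo] --> (0 : R).
  have r0 : x * r x + 2^-1 @[x --> +oo] --> (0 : R).
    apply/norm_cvg0P.
    apply: (@squeeze_cvgr _ _ _ _ (cst 0) (fun x => (1 + x)^-1)) => //; last 2 first.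
    - exact: cvg_cst.
    - exact: cvg_inv_1Dx.
    near=> x; rewrite normr_ge0/=.
    have x1 : 1 <= x by near: x; apply: nbhs_pinfty_ge; rewrite num_real.
    have /andP[h1 h2] := Altail x x1.
    have xp : 0 < x by exact: lt_le_trans ltr01 x1.
    have := ler_wpM2l (ltW xp) h1; have := ler_wpM2l (ltW xp) h2.
    have -> : x * - (2 * (x + 1))^-1 = - 2^-1 + 2^-1 * (1 + x)^-1.
      by field; rewrite !gt_eqF// addr_gt0.
    have -> : x * - (2 * x)^-1 = - 2^-1 by field; rewrite gt_eqF.
    rewrite -/(r x); have : 0 < (1 + x)^-1 by rewrite invr_gt0 addr_gt0.
    by move=> ? ? ?; rewrite ler_norml; lra.
  have -> : (0 : R) = - (b / 2) * 0 + 2^-1 * (ln 2^-1 - ln 2^-1) + 2^-1 * ln (1 - 0) -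
      kap / d0 * (l3 - l3) by rewrite subr0 ln1; ring.
  apply: cvgB; last by apply: cvgMr; apply: cvgB => //; exact: cvg_cst.
  apply: cvgD; last first.
    apply: cvgMr; apply: continuous_cvg; first by apply: continuous_ln; rewrite subr0.
    by apply: cvgB; [exact: cvg_cst|exact: cvg_inv_1Dx].
  apply: cvgD; first exact: cvgMr.
  apply: cvgMr; apply: cvgB; last exact: cvg_cst.
  by apply: continuous_cvg; [exact: continuous_ln|exact: cvg_mills].
have Xoo : d0 * Num.sqrt N%:R @[N --> \oo] --> +oo.
  apply/cvgryPge => A; near=> N.
  rewrite -ler_pdivrMl//; apply: le_trans (ler_norm _) _.
  rewrite -sqrtr_sqr ler_sqrt//.
  by near: N; exact: nbhs_infty_ger.
have EN : E (d0 * Num.sqrt N%:R) @[N --> \oo] --> (0 : R) by apply: cvg_comp E0.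
rewrite -[X in _ --> X](addr0 0); apply: cvg_trans (cvgD S_T EN).
apply: near_eq_cvg; near=> N; rewrite fctE.
have N0 : (0 < N)%N by near: N; exact: nbhs_infty_gt.
have Np : 0 < N%:R :> R by rewrite ltr0n.
have s0 : 0 < (Num.sqrt N%:R : R) by rewrite sqrtr_gt0.
have NE : N%:R = Num.sqrt N%:R * Num.sqrt N%:R :> R by rewrite -expr2 sqr_sqrtr// ltW.
apply/eqP; rewrite -subr_eq0; apply/eqP.
set S := \sum_(_ <= _ < _) _; rewrite /T /E /r.
have d0N : d0 != 0 by rewrite gt_eqF.
have -> : d0 * (Num.sqrt N%:R)^-1 * N%:R = d0 * Num.sqrt N%:R.
  by rewrite {2}NE; field; rewrite gt_eqF.
have lnN : ln N%:R = 2 * ln (Num.sqrt N%:R) :> R by rewrite {1}NE lnM ?posrE//; ring.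
have sbE : Num.sqrt b = Num.sqrt 2 / d0.
  rewrite /d0 sqrtrM// sqrtrV ?(ltW b0)//; field.
  by rewrite !gt_eqF ?sqrtr_gt0.
have bE : b = 2 / d0 ^+ 2 by rewrite d02; field; rewrite gt_eqF.
have lnb : ln (b / 2) = - 2 * ln d0.
  have -> : b / 2 = (d0 * d0)^-1 by rewrite bE expr2; field.
  by rewrite lnV ?posrE ?mulr_gt0// lnM ?posrE//; ring.
have x0 : 0 < d0 * Num.sqrt N%:R by exact: mulr_gt0.
have x1 : 0 < 1 + d0 * Num.sqrt N%:R by rewrite addr_gt0.
have h1 : ln (d0 * (Num.sqrt N%:R)^-1) = ln d0 - ln (Num.sqrt N%:R).
  by rewrite lnM ?posrE ?invr_gt0// lnV ?posrE.
have h2 : ln (2 * (d0 * Num.sqrt N%:R)) = ln 2 + ln d0 + ln (Num.sqrt N%:R).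
  by rewrite lnM ?posrE// lnM ?posrE// addrA.
have h3 : ln (1 - (1 + d0 * Num.sqrt N%:R)^-1) =
    ln d0 + ln (Num.sqrt N%:R) - ln (1 + d0 * Num.sqrt N%:R).
  have -> : 1 - (1 + d0 * Num.sqrt N%:R)^-1 = d0 * Num.sqrt N%:R * (1 + d0 * Num.sqrt N%:R)^-1.
    by field; rewrite gt_eqF.
  by rewrite lnM ?posrE ?invr_gt0// lnM ?posrE// lnV ?posrE//; ring.
have h4 : ln ((1 + d0 * Num.sqrt N%:R) * mills (d0 * Num.sqrt N%:R)) =
    ln (1 + d0 * Num.sqrt N%:R) + ln (mills (d0 * Num.sqrt N%:R)).
  by rewrite lnM ?posrE//; exact: mills_gt0.
have h5 : ln (mills 0) = ln pi / 2 - ln 2 :> R.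
  rewrite mills0.
  have sp : 0 < Num.sqrt pi :> R by rewrite sqrtr_gt0 pi_gt0.
  have lp : ln pi = 2 * ln (Num.sqrt pi) :> R.
    by rewrite -[in LHS](sqr_sqrtr (pi_ge0 R)) expr2 lnM ?posrE//; ring.
  by rewrite lnM ?posrE// lnV ?posrE// lp; field.
have h6 : ln 2^-1 = - ln 2 :> R by rewrite lnV ?posrE.
have h7 : l3 = A3 0 + 3 * beta_out by lra.
have h8 : l = Al 0 - Num.sqrt 2 * gamma_out by lra.
rewrite h1 h2 h3 h4 h5 h6 h7 h8 lnN lnb sbE.
move: (ln (mills (d0 * Num.sqrt N%:R))) (Al (d0 * Num.sqrt N%:R)) (A3 (d0 * Num.sqrt N%:R))
  (ln (1 + d0 * Num.sqrt N%:R)) => w1 w2 w3 w4.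
clear h1 h2 h3 h4 lnN x0; move: (Num.sqrt N%:R) s0 NE => s s0 NE.
by rewrite NE /kap bE; clearbody d0; field; rewrite !gt_eqF.
Unshelve. all: by end_near. Qed.

End asymptotic_sums.

Ltac nneg := repeat first [ assumption | done | apply: ltW; assumption |
  apply: expR_ge0 | apply: sqr_ge0 | apply: exprn_ge0 | apply: divr_ge0 |
  apply: mulr_ge0 | apply: addr_ge0 ].

(** * Laplace integrals near the wall *)

Section laplace.
Context {R : realType}.
Notation mu := (@lebesgue_measure R).
Implicit Types (a b c e s t u x C K l : R).

(** At the edge the deviation from the Gaussian exponent has no sign, hence the factor exp |u|; it
    is later absorbed by half of the Gaussian weight. *)
Lemma expRN_taylor u : `|expR (- u) - (1 - u)| <= u ^+ 2 * expR `|u|.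
Proof.
have h0 := expR_ge1Dx (- u).
rewrite ger0_norm; last lra.
case: (leP 0 u) => u0.
  rewrite (ger0_norm u0); apply: le_trans (_ : u ^+ 2 * 1 <= _); last first.
    by rewrite ler_wpM2l ?sqr_ge0// -[leLHS]expR0 ler_expR.
  have u1 : 0 < 1 + u by lra.
  have : expR (- u) <= (1 + u)^-1.
    by rewrite expRN lef_pV2 ?posrE ?expR_gt0// expR_ge1Dx.
  have -> : (1 + u)^-1 = 1 - u + u ^+ 2 / (1 + u) by field; rewrite gt_eqF.
  have : u ^+ 2 / (1 + u) <= u ^+ 2 by rewrite ler_pdivrMr// ler_peMr ?sqr_ge0//; lra.
  lra.
rewrite (ltr0_norm u0); set v := - u in h0 *; have v0 : 0 <= v by rewrite /v; lra.
have -> : u = - v by rewrite opprK.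
have e0 := expR_gt0 v.
have h1 : expR v * (1 - v) <= 1.
  have := expR_ge1Dx (- v); rewrite expRN => h; rewrite mulrC -ler_pdivlMr//.
  by rewrite mul1r.
have h2 : v * (expR v * (1 - v)) <= v * 1 by rewrite ler_wpM2l.
by rewrite sqrrN expr2; lra.
Qed.

(** The reason for keeping s^2 in every pointwise error: the second moment contributes l^{-3}, and
    with l of the form 2 x + l0 this is the decay (1 + x)^{-3} used in the sums. *)
Lemma Rintegral_dist (P p : R -> R) C l : 0 < l ->
  (forall s, 0 <= s -> {for s, continuous P}) ->
  (forall s, 0 <= s -> {for s, continuous p}) ->
  mu.-integrable `[0%R, +oo[ (EFin \o p) ->
  (forall s, 0 <= s -> `|P s - p s| <= C * (s ^+ 2 * expquad 0 l s)) ->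
  `|\int[mu]_(s in `[0, +oo[) P s - \int[mu]_(s in `[0, +oo[) p s|
    <= C * (2 * l^-3).
Proof.
move=> l0 cP cp ip Pp.
have lin s : 0 <= s -> l * s - 0 <= l * s + 0 * s ^+ 2 by lra.
have [_ _ <-] := exp_moments l0.
have i2 := integrable_mulrl _ C (moment_integrable l0 lin 2).
have {}i2 := i2 (measurable_itv _).
have cD s : 0 <= s -> {for s, continuous (fun s => P s - p s)}.
  by move=> s0; apply: continuousB; [exact: cP|exact: cp].
have iD := half_line_le_integrable cD Pp i2.
have mI : measurable (`[0%R, +oo[%classic : set (measurableTypeR R)) by [].
have -> : \int[mu]_(s in `[0, +oo[) P s =
    \int[mu]_(s in `[0, +oo[) p s + \int[mu]_(s in `[0, +oo[) (P s - p s).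
  by rewrite -RintegralD//; apply: eq_Rintegral => s _; rewrite addrC subrK.
rewrite addrAC subrr add0r; apply: le_trans (le_normr_Rintegral mI iD) _.
rewrite -RintegralZl//; last exact: (moment_integrable l0 lin 2).
apply: le_Rintegral => //.
  exact: (integrable_norm iD).
by move=> s /=; rewrite in_itv/= andbT => s0; exact: Pp.
Qed.

Section convex_exponent.
Variables (g g1 g2 g3 : R -> R) (a b c : R).
Hypothesis dg : forall t, 0 <= t -> is_derive t 1 g (g1 t).
Hypothesis dg1 : forall t, 0 <= t -> is_derive t 1 g1 (g2 t).
Hypothesis dg2 : forall t, 0 <= t -> is_derive t 1 g2 (g3 t).
Hypothesis g00 : g 0 = 0.
Hypotheses (g1a : g1 0 = a) (g2b : g2 0 = b) (g3c : g3 0 = c).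
Hypothesis a0 : 0 <= a.
Hypothesis g2_gt0 : forall t, 0 <= t -> 0 < g2 t.
Variables (t0 C : R).
Hypothesis t0_gt0 : 0 < t0.
Hypothesis g3_lip : forall t, 0 <= t <= t0 -> `|g3 t - c| <= C * t.

Let C_ge0 : 0 <= C.
Proof.
have := @g3_lip t0; rewrite lexx ltW// => /(_ isT) h.
by rewrite -(pmulr_lge0 _ t0_gt0) (le_trans _ h).
Qed.

Lemma taylor_step (f f' : R -> R) n :
  (forall t, 0 <= t -> is_derive t 1 f (f' t)) -> f 0 = 0 ->
  (forall t, 0 <= t <= t0 -> `|f' t| <= C * t ^+ n) ->
  forall t, 0 <= t <= t0 -> `|f t| <= C * t ^+ n.+1.
Proof.
move=> df f0 f'C t /andP[tp tt0].
have := @mvt_bound R f f' 0 t (C * t ^+ n) tp.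
rewrite f0 !subr0 exprSr mulrA; apply.
  by move=> x /andP[x0 _]; exact: df.
move=> x /andP[x0 xt]; apply: le_trans (f'C _ _) _.
  by rewrite x0 (le_trans xt).
by rewrite ler_wpM2l// lerXn2r ?nnegrE.
Qed.

Lemma taylor3 t : 0 <= t <= t0 ->
  `|g t - a * t - b * t ^+ 2 / 2 - c * t ^+ 3 / 6| <= C * t ^+ 4.
Proof.
have T2 : forall t, 0 <= t <= t0 -> `|g2 t - b - c * t| <= C * t ^+ 2.
  apply: (@taylor_step _ (fun t => g3 t - c)).
  - by move=> s s0; have d := dg2 s0; isd; ring.
  - by rewrite g2b; ring.
  - by move=> s s0; rewrite expr1; exact: g3_lip.
have T1 : forall t, 0 <= t <= t0 -> `|g1 t - a - b * t - c * t ^+ 2 / 2| <= C * t ^+ 3.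
  apply: (taylor_step _ _ T2).
  - by move=> s s0; have d := dg1 s0; isd; field.
  - by rewrite g1a; ring.
apply: (@taylor_step (fun t => g t - a * t - b * t ^+ 2 / 2 - c * t ^+ 3 / 6) _ 3 _ _ T1).
- by move=> s s0; have d := dg s0; isd; field.
- by rewrite g00; ring.
Qed.

Lemma taylor2 t : 0 <= t <= t0 ->
  `|g t - a * t - b * t ^+ 2 / 2| <= (`|c| / 6 + C * t0) * t ^+ 3.
Proof.
move=> tt; have T3 := taylor3 tt; have /andP[tp tt0] := tt.
have -> : g t - a * t - b * t ^+ 2 / 2 =
  (g t - a * t - b * t ^+ 2 / 2 - c * t ^+ 3 / 6) + c / 6 * t ^+ 3 by ring.
apply: le_trans (ler_normD _ _) _; rewrite mulrDl addrC lerD//.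
  by rewrite [`|_ * t ^+ 3|]normrM [`|c / 6|]normrM (ger0_norm (exprn_ge0 3 tp)) (ger0_norm (_ : 0 <= 6^-1)).
apply: le_trans T3 _; rewrite -mulrA ler_wpM2l//.
by rewrite exprS ler_wpM2r ?exprn_ge0.
Qed.

Lemma g1_ge t s : 0 <= t -> t <= s -> g1 t <= g1 s.
Proof.
move=> tp ts; apply: (derive_ge0_le ts) => x /andP[tx _].
  exact: dg1 (le_trans tp tx).
exact/ltW/g2_gt0/(le_trans tp tx).
Qed.

Lemma g_ge_linear t : 0 <= t -> a * t <= g t.
Proof.
move=> tp; rewrite -subr_ge0.
have <- : g 0 - a * 0 = 0 by rewrite g00; ring.
apply: (@derive_ge0_le _ (fun t => g t - a * t) (fun t => g1 t - a) _ _ tp).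
  by move=> s /andP[s0 _]; have d := dg s0; isd; ring.
by move=> s /andP[s0 _]; rewrite subr_ge0 -g1a g1_ge.
Qed.

(** When a = 0 the tangent at 0 gives nothing; the tangent at h = t1 / 2 has positive slope by
    strict convexity, and t - h >= t / 2 beyond t1. *)
Lemma g_ge_far t1 : 0 < t1 ->
  exists2 m : R, 0 < m & forall t, t1 <= t -> m * t <= g t.
Proof.
move=> t1p; set h := t1 / 2; have hp : 0 < h by rewrite divr_gt0.
have g1h : 0 < g1 h.
  have [x xi||x + E] := @MVT_segment R g1 g2 0 h (ltW hp).
  - by move: xi; rewrite in_itv/= => /andP[/ltW x0 _]; exact: dg1.
  - apply: continuous_in_subspaceT => x; rewrite inE/= in_itv/= => /andP[x0 _].
    exact: is_derive_continuous (dg1 x0).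
  rewrite in_itv/= => /andP[x0 _].
  have : 0 < g2 x * (h - 0) by rewrite mulr_gt0 ?g2_gt0 ?subr0.
  by rewrite -E g1a => hh; apply: le_lt_trans a0 _; rewrite -subr_gt0.
exists (g1 h / 2); first by rewrite divr_gt0.
move=> t tt; have tp : 0 <= t by lra.
have ht : h <= t by rewrite /h; lra.
have gh : 0 <= g h.
  apply: le_trans (g_ge_linear (ltW hp)); apply: mulr_ge0 => //; exact: ltW.
have : g h - g1 h * h <= g t - g1 h * t.
  apply: (@derive_ge0_le _ (fun t => g t - g1 h * t) (fun t => g1 t - g1 h) _ _ ht).
    by move=> s /andP[s0 _]; have d := dg (le_trans (ltW hp) s0); isd; ring.
  by move=> s /andP[s0 _]; rewrite subr_ge0 g1_ge// ltW.
have : g1 h * (2 * h) <= g1 h * t by rewrite ler_wpM2l ?(ltW g1h)// /h; lra.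
lra.
Qed.

(** Half of the exponential rate pays for the polynomial factor, while s^2 is left untouched for
    [Rintegral_dist]. *)
Lemma absorb_poly (l : R) n : 0 < l -> exists2 K : R, 0 <= K &
  forall s, 0 <= s -> s ^+ 2 * (1 + s) ^+ n * expR (- (l * s)) <=
    K * (s ^+ 2 * expquad 0 (l / 2) s).
Proof.
move=> l0; have l2 : 0 < l / 2 by rewrite divr_gt0.
have [K K0 KP] := expR_dominates n l2.
exists K => // s s0.
have -> : expR (- (l * s)) = expR (- (l / 2 * s)) * expR (- (l / 2 * s)).
  by rewrite -expRD; congr expR; field.
rewrite /expquad mul0r addr0.
have -> : s ^+ 2 * (1 + s) ^+ n * (expR (- (l / 2 * s)) * expR (- (l / 2 * s))) =
  (1 + s) ^+ n * expR (- (l / 2 * s)) * (s ^+ 2 * expR (- (l / 2 * s))) by ring.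
rewrite ler_wpM2r ?mulr_ge0 ?sqr_ge0 ?expR_ge0//.
by rewrite expRN ler_pdivrMr ?expR_gt0// KP.
Qed.

(** After the linear term is factored out, convexity makes h = n (g t - a t) nonnegative, so e^{-h}
    is at most 1 everywhere. Up to t0 it is compared with 1 - h and then with the Taylor polynomial;
    beyond t0 crude bounds are enough. *)
Lemma laplace_inside_pointwise : 0 < a -> exists K l,
  [/\ 0 <= K, 0 < l & forall n e s, 0 < e -> 1 <= n -> n * e = 1 -> 0 <= s ->
    `|expR (- (n * g (e * s))) - expR (- (a * s)) * (1 - e * b / 2 * s ^+ 2)|
     <= K * e ^+ 2 * (s ^+ 2 * expquad 0 l s)].
Proof.
move=> a_gt0.
pose C1 := `|c| / 6 + C * t0.
pose C2 := b / 2 + C1 * t0.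
have bp : 0 < b by rewrite -g2b g2_gt0.
have C10 : 0 <= C1 by rewrite /C1 addr_ge0 ?mulr_ge0 ?(ltW t0_gt0).
have C20 : 0 <= C2 by rewrite /C2 addr_ge0 ?mulr_ge0 ?(ltW t0_gt0) ?(ltW bp).
pose K0 := C2 ^+ 2 + C1 + 2 / t0 ^+ 4 + b / 2 / t0 ^+ 2.
have K00 : 0 <= K0.
  by rewrite /K0 !addr_ge0 ?sqr_ge0 ?mulr_ge0 ?invr_ge0 ?exprn_ge0 ?(ltW t0_gt0) ?(ltW bp).
have [Kp Kp0 KpP] := absorb_poly 2 a_gt0.
exists (K0 * Kp), (a / 2); split; [exact: mulr_ge0|exact: divr_gt0|].
move=> n e s e0 n1 ne s0.
set t := e * s; have tp : 0 <= t by rewrite mulr_ge0// ltW.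
have nE : n = e^-1 by rewrite -[n](mulfK (lt0r_neq0 e0)) ne mul1r.
pose h := n * (g t - a * t).
have h0 : 0 <= h by rewrite mulr_ge0 ?subr_ge0 ?g_ge_linear//; lra.
have -> : expR (- (n * g t)) = expR (- (a * s)) * expR (- h).
  by rewrite -expRD; congr expR; rewrite /h /t nE; field; rewrite gt_eqF.
have -> : expR (- (a * s)) * expR (- h) - expR (- (a * s)) * (1 - e * b / 2 * s ^+ 2) =
   expR (- (a * s)) * (expR (- h) - (1 - n * b / 2 * t ^+ 2)).
  by rewrite /t nE; field; rewrite gt_eqF.
rewrite normrM (ger0_norm (expR_ge0 _)).
(* With t = e s and n e = 1 the right side equals K0 e^2 (s^4 + s^3), so both terms carry e^2 and at
   least s^2. *)
suff H : `|expR (- h) - (1 - n * b / 2 * t ^+ 2)| <= K0 * (n ^+ 2 * t ^+ 4 + n * t ^+ 3).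
  have -> : K0 * Kp * e ^+ 2 * (s ^+ 2 * expquad 0 (a / 2) s) =
    K0 * e ^+ 2 * (Kp * (s ^+ 2 * expquad 0 (a / 2) s)) by ring.
  apply: le_trans (_ : K0 * e ^+ 2 * (s ^+ 2 * (1 + s) ^+ 2 * expR (- (a * s))) <= _).
    have -> : K0 * e ^+ 2 * (s ^+ 2 * (1 + s) ^+ 2 * expR (- (a * s))) =
      expR (- (a * s)) * (K0 * (e ^+ 2 * (s ^+ 2 * (1 + s) ^+ 2))) by ring.
    rewrite ler_wpM2l ?expR_ge0//; apply: le_trans H _; rewrite ler_wpM2l//.
    have -> : n ^+ 2 * t ^+ 4 + n * t ^+ 3 = e ^+ 2 * (s ^+ 2 * (s ^+ 2 + s)).
      by rewrite /t nE; field; rewrite gt_eqF.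
    rewrite ler_wpM2l ?sqr_ge0// ler_wpM2l ?sqr_ge0//.
    by rewrite sqrrD mul1r expr1n; lra.
  by apply: ler_wpM2l; [apply: mulr_ge0; rewrite ?sqr_ge0|exact: KpP].
have np : 0 <= n by lra.
have w1 : 0 <= n ^+ 2 * t ^+ 4 by rewrite mulr_ge0 ?sqr_ge0 ?exprn_ge0.
have w2 : 0 <= n * t ^+ 3 by rewrite mulr_ge0 ?exprn_ge0.
case: (leP t t0) => tt.
  set q := g t - a * t in h h0 *.
  have T2 : `|q - b * t ^+ 2 / 2| <= C1 * t ^+ 3.
    by apply: taylor2; rewrite tp.
  have Tq : q <= C2 * t ^+ 2.
    have t3 : C1 * t ^+ 3 <= C1 * t0 * t ^+ 2.
      by rewrite -mulrA ler_wpM2l// exprS ler_wpM2r ?sqr_ge0.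
    by move: T2; rewrite ler_norml /C2 => /andP[_]; lra.
  have Th : h ^+ 2 <= C2 ^+ 2 * (n ^+ 2 * t ^+ 4).
    have -> : C2 ^+ 2 * (n ^+ 2 * t ^+ 4) = (n * (C2 * t ^+ 2)) ^+ 2 by ring.
    rewrite lerXn2r ?nnegrE//; last by rewrite ler_wpM2l.
    by apply: mulr_ge0 => //; apply: mulr_ge0 => //; exact: sqr_ge0.
  have E1 : `|expR (- h) - (1 - h)| <= h ^+ 2.
    have l0 := expR_ge1Dx (- h); rewrite ger0_norm; last lra.
    have u1 : 0 < 1 + h by lra.
    have : expR (- h) <= (1 + h)^-1.
      by rewrite expRN lef_pV2 ?posrE ?expR_gt0// expR_ge1Dx.
    have -> : (1 + h)^-1 = 1 - h + h ^+ 2 / (1 + h) by field; rewrite gt_eqF.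
    have : h ^+ 2 / (1 + h) <= h ^+ 2 by rewrite ler_pdivrMr// ler_peMr ?sqr_ge0//; lra.
    lra.
  have E2 : `|h - n * b / 2 * t ^+ 2| <= C1 * (n * t ^+ 3).
    have -> : h - n * b / 2 * t ^+ 2 = n * (q - b * t ^+ 2 / 2) by rewrite /h; field.
    by rewrite normrM (ger0_norm np) (mulrCA C1); exact: ler_wpM2l.
  have -> : expR (- h) - (1 - n * b / 2 * t ^+ 2) =
    (expR (- h) - (1 - h)) - (h - n * b / 2 * t ^+ 2) by ring.
  apply: le_trans (ler_normB _ _) _; apply: le_trans (lerD E1 E2) _.
  apply: le_trans (lerD Th (lexx _)) _.
  have z1 : 0 <= 2 / t0 ^+ 4 by rewrite divr_ge0// exprn_ge0// ltW.
  have z2 : 0 <= b / 2 / t0 ^+ 2 by rewrite !divr_ge0 ?exprn_ge0// ltW.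
  have y1 : C2 ^+ 2 * (n ^+ 2 * t ^+ 4) <= K0 * (n ^+ 2 * t ^+ 4).
    by rewrite ler_wpM2r// /K0; have := sqr_ge0 C2; lra.
  have y2 : C1 * (n * t ^+ 3) <= K0 * (n * t ^+ 3).
    by rewrite ler_wpM2r// /K0; have := sqr_ge0 C2; lra.
  lra.
(* Beyond t0 every factor t / t0 is at least 1, so the missing powers of t and n can be inserted for
   free. *)
have eh : 0 <= expR (- h) <= 1.
  by rewrite expR_ge0/= -[leRHS]expR0 ler_expR; lra.
have b2 : 0 <= b / 2 * t ^+ 2 by apply: mulr_ge0; [lra|exact: sqr_ge0].
have nb : 0 <= n * b / 2 * t ^+ 2.
  by have := mulr_ge0 np b2; rewrite (_ : n * b / 2 * t ^+ 2 = n * (b / 2 * t ^+ 2))//; ring.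
have far k : 1 <= (t / t0) ^+ k.
  by rewrite exprn_ege1// ler_pdivlMr// mul1r ltW.
have n2 : n <= n ^+ 2 by rewrite expr2 ler_peMr.
have q1 : 2 <= 2 / t0 ^+ 4 * (n ^+ 2 * t ^+ 4).
  have -> : 2 / t0 ^+ 4 * (n ^+ 2 * t ^+ 4) = 2 * (n ^+ 2 * (t / t0) ^+ 4).
    by field; rewrite gt_eqF.
  by rewrite ler_peMr// mulr_ege1// exprn_ege1.
have q2 : n * b / 2 * t ^+ 2 <= b / 2 / t0 ^+ 2 * (n ^+ 2 * t ^+ 4).
  have -> : b / 2 / t0 ^+ 2 * (n ^+ 2 * t ^+ 4) = (b / 2 * t ^+ 2) * (n ^+ 2 * (t / t0) ^+ 2).
    by field; rewrite gt_eqF.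
  have -> : n * b / 2 * t ^+ 2 = (b / 2 * t ^+ 2) * (n * 1) by ring.
  by rewrite (ler_wpM2l b2)//; apply: ler_pM.
apply: le_trans (_ : (2 / t0 ^+ 4 + b / 2 / t0 ^+ 2) * (n ^+ 2 * t ^+ 4) <= _).
  by rewrite ler_norml mulrDl; lra.
apply: le_trans (_ : K0 * (n ^+ 2 * t ^+ 4) <= _).
  by rewrite ler_wpM2r// /K0; have := sqr_ge0 C2; lra.
by rewrite ler_wpM2l// lerDl.
Qed.

Let continuous_integrand x n d s : 0 <= d -> 0 <= s ->
  {for s, continuous (fun s => expR (- (2 * x * s + n * g (d * s))))}.
Proof.
move=> dp s0; have ds := dg (mulr_ge0 dp s0).
by apply: is_derive_continuous; isd_step.
Qed.

Let inv_cube_le (l : R) x : 0 < l -> 0 <= x ->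
  2 * (2 * x + l) ^- 3 <= 2 * (Num.min l 1) ^- 3 / (1 + x) ^+ 3.
Proof.
move=> l0 x0; set m := Num.min l 1.
have m0 : 0 < m by rewrite lt_min l0 ltr01.
have ml : m <= l by rewrite ge_min lexx.
have m1 : m <= 1 by rewrite ge_min lexx orbT.
rewrite -mulrA -invfM -exprMn ler_wpM2l// lef_pV2 ?posrE ?exprn_gt0 ?mulr_gt0//; try lra.
rewrite lerXn2r ?nnegrE ?mulr_ge0//; try lra.
have : m * x <= 1 * x by rewrite ler_wpM2r.
lra.
Qed.

Lemma laplace_inside : 0 < a -> exists2 K, 0 <= K &
  forall n e x, 0 < e -> 1 <= n -> n * e = 1 -> 0 <= x ->
  `|\int[mu]_(s in `[0, +oo[) expR (- (2 * x * s + n * g (e * s)))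
    - (a + 2 * x)^-1 * (1 - e * b * (a + 2 * x) ^- 2)| <= K * e ^+ 2 / (1 + x) ^+ 3.
Proof.
move=> a_gt0; have [K [l [K0 l0 H]]] := laplace_inside_pointwise a_gt0.
exists (K * (2 * (Num.min l 1) ^- 3)).
  by rewrite !mulr_ge0// invr_ge0 exprn_ge0// le_min ltW//= ler01.
move=> n e x e0 n1 ne x0.
pose y := a + 2 * x; have y0 : 0 < y by rewrite /y; lra.
have lin s : 0 <= s -> y * s - 0 <= y * s + 0 * s ^+ 2 by lra.
pose p s := expquad 0 y s - e * b / 2 * (s ^+ 2 * expquad 0 y s).
have mI : measurable (`[0%R, +oo[%classic : set (measurableTypeR R)) by [].
have i0 := moment_integrable y0 lin 0.
have i2 := moment_integrable y0 lin 2.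
have i0' : mu.-integrable `[0%R, +oo[ (EFin \o expquad 0 y).
  by apply: eq_integrable i0 => // s _; rewrite /= expr0 mul1r.
have i2' := integrable_mulrl mI (e * b / 2) i2.
have ip : mu.-integrable `[0%R, +oo[ (EFin \o p) by exact: integrable_subr.
have Ep : \int[mu]_(s in `[0, +oo[) p s = y^-1 * (1 - e * b * y ^- 2).
  have [m0 _ m2] := exp_moments y0.
  rewrite /p RintegralB// RintegralZl// -/(moment 0 y 2) m2.
  have -> : \int[mu]_(s in `[0, +oo[) expquad 0 y s = moment 0 y 0.
    by apply: eq_Rintegral => s _; rewrite expr0 mul1r.
  by rewrite m0; field; rewrite gt_eqF.
rewrite -/y -Ep.
have l2 : 0 < 2 * x + l by lra.
apply: le_trans (@Rintegral_dist _ p (K * e ^+ 2) _ l2 _ _ ip _) _.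
- by move=> s s0; apply: continuous_integrand => //; exact: ltW.
- move=> s s0; have d := is_derive_expquad 0 y s.
  by apply: is_derive_continuous; rewrite /p; isd_step.
- move=> s s0.
  have -> : expR (- (2 * x * s + n * g (e * s))) - p s = expR (- (2 * x * s)) *
      (expR (- (n * g (e * s))) - expR (- (a * s)) * (1 - e * b / 2 * s ^+ 2)).
    rewrite /p /expquad mul0r addr0 opprD expRD.
    have -> : expR (- (y * s)) = expR (- (2 * x * s)) * expR (- (a * s)).
      by rewrite -expRD /y; congr expR; ring.
    by ring.
  rewrite normrM ger0_norm ?expR_ge0//.
  apply: le_trans (ler_wpM2l (expR_ge0 _) (H n e s e0 n1 ne s0)) _.
  have -> : expquad 0 (2 * x + l) s = expR (- (2 * x * s)) * expquad 0 l s.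
    by rewrite /expquad -expRD; congr expR; ring.
  by apply: eq_lerW; move: (expR _) (expquad _ _ _) => u w; ring.
have -> : K * (2 * Num.min l 1 ^- 3) * e ^+ 2 / (1 + x) ^+ 3 =
  K * e ^+ 2 * (2 * Num.min l 1 ^- 3 / (1 + x) ^+ 3) by ring.
by apply: ler_wpM2l; [rewrite mulr_ge0 ?sqr_ge0|exact: inv_cube_le].
Qed.

Lemma gauss_le_exp s : expR (- (s ^+ 2 / 2)) <= expR 1 * expR (- s).
Proof. by rewrite -expRD ler_expR; have := sqr_ge0 (s - 1); rewrite sqrrB !expr1n mulr1; lra. Qed.

(** Write n g(t) = s^2 + u with t = d0 e s; the quadratic part is exactly s^2 because b d0^2 = 2 and
    n e^2 = 1. Up to t1 one expands in u, where |u| <= s^2 / 2. Beyond t1 the two terms are bounded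
    separately by multiples of (1 + s)^4 e^{-l s}. *)
Lemma laplace_edge_pointwise : a = 0 -> let d0 := Num.sqrt (2 / b) in
  exists K l,
  [/\ 0 <= K, 0 < l & forall n e s, 0 < e -> 1 <= n -> n * e ^+ 2 = 1 -> 0 <= s ->
    `|expR (- (n * g (d0 * e * s))) - expR (- s ^+ 2) * (1 - e * (c / 6 * d0 ^+ 3) * s ^+ 3)|
     <= K * e ^+ 2 * (s ^+ 2 * expquad 0 l s)].
Proof.
move=> az d0.
have bp : 0 < b by rewrite -g2b g2_gt0.
have d00 : 0 < d0 by rewrite sqrtr_gt0 divr_gt0.
have d02 : d0 ^+ 2 * b = 2 by rewrite sqr_sqrtr ?divfK ?gt_eqF// divr_ge0// ltW.
pose kap := c / 6 * d0 ^+ 3.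
pose C1 := `|c| / 6 + C * t0.
have C10 : 0 <= C1 by rewrite /C1 addr_ge0 ?mulr_ge0 ?(ltW t0_gt0).
have kapC : `|kap| <= C1 * d0 ^+ 3.
  rewrite /kap normrM [`|c / 6|]normrM (ger0_norm (exprn_ge0 3 (ltW d00))).
  rewrite (ger0_norm (_ : 0 <= 6^-1))// ler_wpM2r ?exprn_ge0 ?(ltW d00)//.
  by rewrite /C1 lerDl mulr_ge0 ?(ltW t0_gt0).
(* The Taylor bound reads |u| <= C1 d0^2 t s^2; for t <= 1 / D this is at most s^2 / 2. *)
pose D := 2 * C1 * d0 ^+ 2 + 1.
have D0 : 0 < D by rewrite /D ltr_wpDl//; nneg.
pose t1 := Num.min t0 D^-1.
have t10 : 0 < t1 by rewrite lt_min t0_gt0 invr_gt0.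
have t1t0 : t1 <= t0 by rewrite ge_min lexx.
have t1D : C1 * d0 ^+ 2 * t1 <= 2^-1.
  have h1 : t1 * D <= 1 by rewrite -ler_pdivlMr// div1r ge_min lexx orbT.
  by move: h1; rewrite /D; lra.
have [m m0 far] := g_ge_far t10.
(* Rate 1 comes from e^{-s^2 / 2} <= e^{1 - s}; rate m d0 from n m t = m d0 s / e with e <= 1. *)
pose l := Num.min 1 (m * d0).
have l0 : 0 < l by rewrite lt_min ltr01 mulr_gt0.
have l1 : l <= 1 by rewrite ge_min lexx.
have lm : l <= m * d0 by rewrite ge_min lexx orbT.
have [Kp Kp0 KpP] := absorb_poly 4 l0.
pose K0 := (C1 ^+ 2 * d0 ^+ 6 + C * d0 ^+ 4) * expR 1 +
  (1 + expR 1 * (1 + `|kap|)) * (d0 ^+ 2 / t1 ^+ 2).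
have ka0 := normr_ge0 kap.
have E1 : 0 <= expR 1 :> R by exact: expR_ge0.
have a1 : 0 <= C1 ^+ 2 * d0 ^+ 6 by rewrite mulr_ge0 ?sqr_ge0// exprn_ge0// ltW.
have a2 : 0 <= C * d0 ^+ 4 by rewrite mulr_ge0// exprn_ge0// ltW.
have a3 : 0 <= d0 ^+ 2 / t1 ^+ 2 by rewrite divr_ge0 ?sqr_ge0.
have a4 : 0 <= expR 1 * (1 + `|kap|) by rewrite mulr_ge0// addr_ge0.
have b1 : 0 <= (C1 ^+ 2 * d0 ^+ 6 + C * d0 ^+ 4) * expR 1 by rewrite mulr_ge0// addr_ge0.
have b2 : 0 <= (1 + expR 1 * (1 + `|kap|)) * (d0 ^+ 2 / t1 ^+ 2) by rewrite mulr_ge0// addr_ge0.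
have K00 : 0 <= K0 by rewrite /K0 addr_ge0.
exists (K0 * Kp), (l / 2); split; [exact: mulr_ge0|exact: divr_gt0|].
move=> n e s e0 n1 ne s0; rewrite -/kap.
have e1 : e <= 1.
  have h : e ^+ 2 <= 1 by rewrite -ne ler_peMl ?sqr_ge0.
  by move: h; rewrite expr_le1// ltW.
set t := d0 * e * s; have tp : 0 <= t by rewrite !mulr_ge0// ltW.
have nE : n = e ^- 2.
  by rewrite -[n](mulfK (lt0r_neq0 (exprn_gt0 2 e0))) ne mul1r.
suff H : `|expR (- (n * g t)) - expR (- s ^+ 2) * (1 - e * kap * s ^+ 3)| <=
    K0 * e ^+ 2 * (s ^+ 2 * (1 + s) ^+ 4 * expR (- (l * s))).
  apply: le_trans H _.
  have -> : K0 * Kp * e ^+ 2 * (s ^+ 2 * expquad 0 (l / 2) s) =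
    K0 * e ^+ 2 * (Kp * (s ^+ 2 * expquad 0 (l / 2) s)) by ring.
  by apply: ler_wpM2l; [apply: mulr_ge0; rewrite ?sqr_ge0|exact: KpP].
have els : expR (- s) <= expR (- (l * s)).
  by rewrite ler_expR lerN2; rewrite ler_piMl.
have pw k p : (k <= p)%N -> s ^+ k <= (1 + s) ^+ p.
  move=> kp; apply: le_trans (_ : (1 + s) ^+ k <= _).
    by rewrite lerXn2r ?nnegrE// ?addr_ge0// lerDr.
  by rewrite ler_weXn2l// lerDl.
have E2 : 0 <= e ^+ 2 by exact: sqr_ge0.
have S2 : 0 <= s ^+ 2 by exact: sqr_ge0.
have elp := expR_ge0 (- (l * s)).
case: (leP t t1) => tt.
  have tt0 : 0 <= t <= t0 by rewrite tp (le_trans tt).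
  have T3 := taylor3 tt0; have T2 := taylor2 tt0.
  rewrite az mul0r subr0 -/C1 in T2 T3.
  pose u := n * g t - s ^+ 2.
  have uE : u = n * (g t - b * t ^+ 2 / 2).
    have sE : n * (b * t ^+ 2 / 2) = s ^+ 2.
      have -> : n * (b * t ^+ 2 / 2) = (n * e ^+ 2) * (d0 ^+ 2 * b) / 2 * s ^+ 2.
        by rewrite /t; field.
      by rewrite ne d02; field.
    by rewrite mulrBr sE.
  have np : 0 <= n by rewrite (le_trans ler01).
  have u1 : `|u - e * kap * s ^+ 3| <= C * d0 ^+ 4 * e ^+ 2 * s ^+ 4.
    have -> : u - e * kap * s ^+ 3 = n * (g t - b * t ^+ 2 / 2 - c * t ^+ 3 / 6).
      by rewrite uE /kap /t nE; field; rewrite gt_eqF.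
    rewrite normrM (ger0_norm np); apply: le_trans (ler_wpM2l np T3) _.
    by apply: eq_lerW; rewrite /t nE; field; rewrite gt_eqF.
  have u2 : `|u| <= C1 * d0 ^+ 3 * e * s ^+ 3.
    rewrite uE normrM (ger0_norm np); apply: le_trans (ler_wpM2l np T2) _.
    by apply: eq_lerW; rewrite /t nE; field; rewrite gt_eqF.
  have u3 : `|u| <= s ^+ 2 / 2.
    apply: le_trans u2 _.
    have -> : C1 * d0 ^+ 3 * e * s ^+ 3 = C1 * d0 ^+ 2 * t * s ^+ 2 by rewrite /t; ring.
    rewrite (mulrC (s ^+ 2)); apply: ler_wpM2r => //; apply: le_trans t1D.
    by apply: ler_wpM2l => //; apply: mulr_ge0; rewrite ?sqr_ge0.
  have -> : expR (- (n * g t)) = expR (- s ^+ 2) * expR (- u).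
    by rewrite -expRD /u; congr expR; ring.
  have -> : expR (- s ^+ 2) * expR (- u) - expR (- s ^+ 2) * (1 - e * kap * s ^+ 3) =
    expR (- s ^+ 2) * ((expR (- u) - (1 - u)) - (u - e * kap * s ^+ 3)) by ring.
  rewrite normrM (ger0_norm (expR_ge0 _)).
  have v1 : u ^+ 2 <= C1 ^+ 2 * d0 ^+ 6 * (e ^+ 2 * s ^+ 6).
    have -> : C1 ^+ 2 * d0 ^+ 6 * (e ^+ 2 * s ^+ 6) = (C1 * d0 ^+ 3 * e * s ^+ 3) ^+ 2 by ring.
    by rewrite -[u ^+ 2]real_normK ?num_real// lerXn2r ?nnegrE// (le_trans _ u2).
  have v2 : expR `|u| <= expR (s ^+ 2 / 2) by rewrite ler_expR.
  have v3 : 1 <= expR (s ^+ 2 / 2) by rewrite -[leLHS]expR0 ler_expR divr_ge0.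
  have v4 : `|expR (- u) - (1 - u) - (u - e * kap * s ^+ 3)| <=
      (C1 ^+ 2 * d0 ^+ 6 * (e ^+ 2 * s ^+ 6) + C * d0 ^+ 4 * e ^+ 2 * s ^+ 4) * expR (s ^+ 2 / 2).
    apply: le_trans (ler_normB _ _) _; rewrite mulrDl; apply: lerD.
      apply: le_trans (expRN_taylor u) _.
      by apply: ler_pM => //; exact: sqr_ge0.
    apply: le_trans u1 _; rewrite -[leLHS]mulr1; apply: ler_wpM2l => //.
    by rewrite -mulrA mulr_ge0// mulr_ge0// exprn_ge0.
  apply: le_trans (ler_wpM2l (expR_ge0 _) v4) _.
  set Q := C1 ^+ 2 * d0 ^+ 6 * _ + _.
  have -> : expR (- s ^+ 2) * (Q * expR (s ^+ 2 / 2)) = Q * expR (- (s ^+ 2 / 2)).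
    by rewrite mulrCA -expRD; congr (_ * expR _); field.
  have w6 : s ^+ 2 * s ^+ 4 <= s ^+ 2 * (1 + s) ^+ 4 by apply: ler_wpM2l => //; exact: pw.
  have w4 : s ^+ 2 * s ^+ 2 <= s ^+ 2 * (1 + s) ^+ 4 by apply: ler_wpM2l => //; exact: pw.
  have Q1 : Q <= (C1 ^+ 2 * d0 ^+ 6 + C * d0 ^+ 4) * (e ^+ 2 * (s ^+ 2 * (1 + s) ^+ 4)).
    have -> : Q = C1 ^+ 2 * d0 ^+ 6 * (e ^+ 2 * (s ^+ 2 * s ^+ 4)) +
      C * d0 ^+ 4 * (e ^+ 2 * (s ^+ 2 * s ^+ 2)) by rewrite /Q; ring.
    by rewrite mulrDl; apply: lerD; apply: ler_wpM2l => //; apply: ler_wpM2l.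
  have Q0 : 0 <= Q.
    by rewrite /Q; nneg.
  apply: le_trans (_ : (C1 ^+ 2 * d0 ^+ 6 + C * d0 ^+ 4) * (e ^+ 2 * (s ^+ 2 * (1 + s) ^+ 4)) *
     (expR 1 * expR (- (l * s))) <= _).
    apply: ler_pM => //.
    by apply: le_trans (gauss_le_exp s) _; apply: ler_wpM2l.
  have -> : K0 * e ^+ 2 * (s ^+ 2 * (1 + s) ^+ 4 * expR (- (l * s))) =
    K0 * (e ^+ 2 * (s ^+ 2 * (1 + s) ^+ 4) * expR (- (l * s))) by ring.
  set W := e ^+ 2 * (s ^+ 2 * (1 + s) ^+ 4).
  have W0 : 0 <= W * expR (- (l * s)).
    by rewrite /W; nneg; lra.
  have := mulr_ge0 b2 W0; rewrite /K0; lra.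
have P1 : expR (- (n * g t)) <= expR (- (l * s)).
  rewrite ler_expR lerN2; apply: le_trans (_ : n * (m * t) <= _); last first.
    by apply: ler_wpM2l; [by rewrite (le_trans ler01)|exact/far/ltW].
  have -> : n * (m * t) = m * d0 * s * e^-1 by rewrite /t nE; field; rewrite gt_eqF.
  apply: le_trans (ler_wpM2r s0 lm) _.
  by rewrite ler_peMr ?invf_ge1//; nneg.
have P2 : `|expR (- s ^+ 2) * (1 - e * kap * s ^+ 3)| <=
    expR 1 * (1 + `|kap|) * ((1 + s) ^+ 4 * expR (- (l * s))).
  rewrite normrM (ger0_norm (expR_ge0 _)).
  have x1 : expR (- s ^+ 2) <= expR 1 * expR (- (l * s)).
    apply: le_trans (_ : expR 1 * expR (- s) <= _); last exact: ler_wpM2l.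
    apply: le_trans (gauss_le_exp s).
    by rewrite ler_expR; lra.
  have x2 : `|1 - e * kap * s ^+ 3| <= (1 + `|kap|) * (1 + s) ^+ 4.
    apply: le_trans (ler_normB _ _) _; rewrite normr1 mulrDl mul1r; apply: lerD.
      by rewrite exprn_ege1// lerDl.
    rewrite normrM normrM (gtr0_norm e0) (ger0_norm (exprn_ge0 3 s0)).
    apply: ler_pM; [nneg|nneg| |exact: pw].
    by rewrite ler_piMl.
  have -> : expR 1 * (1 + `|kap|) * ((1 + s) ^+ 4 * expR (- (l * s))) =
    expR 1 * expR (- (l * s)) * ((1 + `|kap|) * (1 + s) ^+ 4) by ring.
  by apply: ler_pM.
have s4 : 1 <= (1 + s) ^+ 4 by rewrite exprn_ege1// lerDl.
have P12 : `|expR (- (n * g t)) - expR (- s ^+ 2) * (1 - e * kap * s ^+ 3)| <=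
    (1 + expR 1 * (1 + `|kap|)) * ((1 + s) ^+ 4 * expR (- (l * s))).
  apply: le_trans (ler_normB _ _) _; rewrite (ger0_norm (expR_ge0 _)) mulrDl mul1r.
  by apply: lerD => //; apply: le_trans P1 _; rewrite ler_peMl.
apply: le_trans P12 _.
(* Beyond t1 the factor (t / t1)^2 >= 1 supplies the e^2 s^2 that the crude bounds lack. *)
have F : 1 <= d0 ^+ 2 / t1 ^+ 2 * (e ^+ 2 * s ^+ 2).
  have -> : d0 ^+ 2 / t1 ^+ 2 * (e ^+ 2 * s ^+ 2) = (t / t1) ^+ 2.
    by rewrite /t; field; rewrite gt_eqF.
  by rewrite exprn_ege1// ler_pdivlMr// mul1r ltW.
set V := (1 + s) ^+ 4 * expR (- (l * s)); set A := 1 + _.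
have V0 : 0 <= V by rewrite /V; nneg; lra.
have A0 : 0 <= A by rewrite addr_ge0.
apply: le_trans (_ : A * V * (d0 ^+ 2 / t1 ^+ 2 * (e ^+ 2 * s ^+ 2)) <= _).
  by rewrite ler_peMr// mulr_ge0.
have -> : K0 * e ^+ 2 * (s ^+ 2 * (1 + s) ^+ 4 * expR (- (l * s))) =
  K0 * (V * (e ^+ 2 * s ^+ 2)) by rewrite /V; ring.
have -> : A * V * (d0 ^+ 2 / t1 ^+ 2 * (e ^+ 2 * s ^+ 2)) =
  A * (d0 ^+ 2 / t1 ^+ 2) * (V * (e ^+ 2 * s ^+ 2)) by ring.
apply: ler_wpM2r; first by nneg.
by rewrite /K0 -/A; lra.
Qed.

Lemma laplace_edge : a = 0 -> let d0 := Num.sqrt (2 / b) in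
  exists2 K, 0 <= K & forall n e x, 0 < e -> 1 <= n -> n * e ^+ 2 = 1 -> 0 <= x ->
  `|\int[mu]_(s in `[0, +oo[) expR (- (2 * x * s + n * g (d0 * e * s)))
    - (mills x - e * (c / 6 * d0 ^+ 3) * mills3 x)| <= K * e ^+ 2 / (1 + x) ^+ 3.
Proof.
move=> az d0; have [K [l [K0 l0 H]]] := laplace_edge_pointwise az.
exists (K * (2 * (Num.min l 1) ^- 3)).
  by rewrite !mulr_ge0// invr_ge0 exprn_ge0// le_min ltW//= ler01.
move=> n e x e0 n1 ne x0; set kap := c / 6 * d0 ^+ 3.
have lin s : 0 <= s -> 1 * s - 1 <= 2 * x * s + 1 * s ^+ 2.
  by move=> s0; have := mulr_ge0 x0 s0; have := sqr_ge0 (2 * s - 1); rewrite !expr2; lra.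
pose p s := expquad 1 (2 * x) s - e * kap * (s ^+ 3 * expquad 1 (2 * x) s).
have mI : measurable (`[0%R, +oo[%classic : set (measurableTypeR R)) by [].
have i0 := moment_integrable ltr01 lin 0.
have i3 := moment_integrable ltr01 lin 3.
have i0' : mu.-integrable `[0%R, +oo[ (EFin \o expquad 1 (2 * x)).
  by apply: eq_integrable i0 => // s _; rewrite /= expr0 mul1r.
have i3' := integrable_mulrl mI (e * kap) i3.
have ip : mu.-integrable `[0%R, +oo[ (EFin \o p) by exact: integrable_subr.
have Ep : \int[mu]_(s in `[0, +oo[) p s = mills x - e * kap * mills3 x.
  have [_ _ <- _ _] := mills_moments x0; rewrite (mills_moment x0).
  rewrite /p RintegralB// RintegralZl// -/(moment 1 (2 * x) 3).
  have -> : \int[mu]_(s in `[0, +oo[) expquad 1 (2 * x) s = moment 1 (2 * x) 0.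
    by apply: eq_Rintegral => s _; rewrite expr0 mul1r.
  by [].
rewrite -Ep.
have l2 : 0 < 2 * x + l by lra.
have de0 : 0 <= d0 * e by rewrite mulr_ge0 ?sqrtr_ge0// ltW.
apply: le_trans (@Rintegral_dist _ p (K * e ^+ 2) _ l2 _ _ ip _) _.
- by move=> s s0; exact: continuous_integrand.
- move=> s s0; have d := is_derive_expquad 1 (2 * x) s.
  by apply: is_derive_continuous; rewrite /p; isd_step.
- move=> s s0.
  have -> : expR (- (2 * x * s + n * g (d0 * e * s))) - p s = expR (- (2 * x * s)) *
      (expR (- (n * g (d0 * e * s))) - expR (- s ^+ 2) * (1 - e * kap * s ^+ 3)).
    rewrite /p /expquad mul1r !opprD !expRD.
    by ring.
  rewrite normrM ger0_norm ?expR_ge0//.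
  apply: le_trans (ler_wpM2l (expR_ge0 _) (H n e s e0 n1 ne s0)) _.
  have -> : expquad 0 (2 * x + l) s = expR (- (2 * x * s)) * expquad 0 l s.
    by rewrite /expquad -expRD; congr expR; ring.
  by apply: eq_lerW; move: (expR _) (expquad _ _ _) => u w; ring.
have -> : K * (2 * Num.min l 1 ^- 3) * e ^+ 2 / (1 + x) ^+ 3 =
  K * e ^+ 2 * (2 * Num.min l 1 ^- 3 / (1 + x) ^+ 3) by ring.
by apply: ler_wpM2l; [rewrite mulr_ge0 ?sqr_ge0|exact: inv_cube_le].
Qed.

End convex_exponent.
End laplace.

(** * The potential as a function of t = - log r *)

Section potential_in_log_radius.
Context {R : realType}.
Implicit Types (r s t : R).

(** Differentiability at the single point 0 gives a linear bound near 0; this is all that is asked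
    of the third derivative of g. *)
Lemma derive_right_lipschitz (f : R -> R) (d : R) : is_derive (0 : R) 1 f d ->
  exists2 t0 : R, 0 < t0 & forall t, 0 <= t <= t0 -> `|f t - f 0| <= (`|d| + 1) * t.
Proof.
move=> [df dE].
have : h^-1 *: (f (h *: 1 + 0) - f 0) @[h --> 0^'] --> d by rewrite -dE; exact: df.
move=> /cvgrPdist_le /(_ 1 ltr01) [t0 /= t00 H].
exists (t0 / 2); first by rewrite divr_gt0.
move=> t /andP[tp tt].
have [->|tn] := eqVneq t 0; first by rewrite subrr normr0 mulr0.
have t_gt0 : 0 < t by rewrite lt_neqAle eq_sym tn.
have := H t; rewrite /ball_ /= sub0r normrN gtr0_norm// => /(_ _ tn).
rewrite addr0 [t *: 1]mulr1 => h.
have {}h : `|d - t^-1 * (f t - f 0)| <= 1 by apply: h; lra.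
have -> : f t - f 0 = t * (t^-1 * (f t - f 0)) by rewrite mulVKf.
rewrite normrM (gtr0_norm t_gt0) mulrC ler_wpM2r//.
set w := t^-1 * _ in h *.
have -> : w = d - (d - w) by ring.
by apply: le_trans (ler_normB _ _) _; rewrite lerD2l.
Qed.

Variable q : R -> R.
Hypothesis qsm : smooth_pos q.

Lemma smooth_is_derive n r : 0 < r ->
  is_derive r 1 (derive1n n q) (derive1n n.+1 q r).
Proof. by move=> r0; apply: derive1_is_derive; [exact: qsm|rewrite derive1nS]. Qed.

Let q1 : R -> R := derive1 q.
Let q2 : R -> R := derive1 q1.
Let q3 : R -> R := derive1 q2.
Let q4 : R -> R := derive1 q3.

Let dq r : 0 < r -> is_derive r 1 q (q1 r).
Proof. exact: (smooth_is_derive 0). Qed.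
Let dq1 r : 0 < r -> is_derive r 1 q1 (q2 r).
Proof. exact: (smooth_is_derive 1). Qed.
Let dq2 r : 0 < r -> is_derive r 1 q2 (q3 r).
Proof. exact: (smooth_is_derive 2). Qed.
Let dq3 r : 0 < r -> is_derive r 1 q3 (q4 r).
Proof. exact: (smooth_is_derive 3). Qed.

Let drq1 r : 0 < r -> is_derive r 1 (fun s => s * q1 s) (q1 r + r * q2 r).
Proof. by move=> r0; have d := dq1 r0; isd; ring. Qed.

Lemma laplQE r : 0 < r -> laplQ q r = r^-1 * (q1 r + r * q2 r).
Proof. by move=> r0; rewrite /laplQ (is_derive_derive1 (drq1 r0)). Qed.

Lemma derive_laplQ1 : derive1 (laplQ q) 1 = q3 1 + q2 1 - q1 1.
Proof.
apply: is_derive_derive1.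
apply: (@isd_near _ (fun r => r^-1 * (q1 r + r * q2 r))).
  near=> r; rewrite laplQE//.
  by near: r; apply: lt_nbhsr; exact: ltr01.
have d1 := dq1 ltr01; have d2 := dq2 ltr01.
by isd; [exact: oner_neq0|rewrite expr1n invr1; ring].
Unshelve. all: by end_near. Qed.

Lemma laplQ1 : laplQ q 1 = q1 1 + q2 1.
Proof. by rewrite laplQE// invr1 !mul1r. Qed.

Let er t : 0 < expR (- t) :> R. Proof. exact: expR_gt0. Qed.

(** In t = - log r the radial Laplacian is e^{2 t} times the second derivative in t, so strict
    subharmonicity becomes strict convexity of [gpot]; [gpot1] to [gpot3] are its derivatives. *)
Definition gpot t := q (expR (- t)) - q 1.
Definition gpot1 t := - (expR (- t) * q1 (expR (- t))).
Definition gpot2 t := expR (- t) * q1 (expR (- t)) + expR (- t) ^+ 2 * q2 (expR (- t)).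
Definition gpot3 t := - (expR (- t) * q1 (expR (- t)) +
  3 * expR (- t) ^+ 2 * q2 (expR (- t)) + expR (- t) ^+ 3 * q3 (expR (- t))).

Lemma is_derive_gpot t : is_derive t 1 gpot (gpot1 t).
Proof. by have d := dq (er t); rewrite /gpot /gpot1; isd; ring. Qed.

Lemma is_derive_gpot1 t : is_derive t 1 gpot1 (gpot2 t).
Proof. by have d := dq1 (er t); rewrite /gpot1 /gpot2; isd; ring. Qed.

Lemma is_derive_gpot2 t : is_derive t 1 gpot2 (gpot3 t).
Proof.
by have d := dq1 (er t); have d2 := dq2 (er t); rewrite /gpot2 /gpot3; isd; ring.
Qed.

Lemma gpot_at0 : [/\ gpot 0 = 0, gpot1 0 = - q1 1, gpot2 0 = laplQ q 1
  & gpot3 0 = - (2 * laplQ q 1 + derive1 (laplQ q) 1)].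
Proof.
rewrite laplQ1 derive_laplQ1 /gpot /gpot1 /gpot2 /gpot3 oppr0 expR0.
by move: (q 1) (q1 1) (q2 1) (q3 1) => a b c d; split; ring.
Qed.

Lemma gpot3_lipschitz : exists t0 C : R,
  0 < t0 /\ forall t, 0 <= t <= t0 -> `|gpot3 t - gpot3 0| <= C * t.
Proof.
have [d dg3] : exists d, is_derive (0 : R) 1 gpot3 d.
  have d1 := dq1 (er 0); have d2 := dq2 (er 0); have d3 := dq3 (er 0).
  by eexists; apply: isd_opp; isd_step.
by have [t0 t00 H] := derive_right_lipschitz dg3; exists t0, (`|d| + 1).
Qed.

Hypothesis lapl_gt0 : forall r, 0 < r -> 0 < laplQ q r.

Lemma gpot2_gt0 t : 0 < gpot2 t.
Proof.
have -> : gpot2 t = expR (- t) ^+ 2 * laplQ q (expR (- t)).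
  by rewrite laplQE// /gpot2; field; rewrite gt_eqF.
by rewrite mulr_gt0 ?exprn_gt0 ?lapl_gt0.
Qed.

(** The derivative of r q'(r) is r Delta Q(r), which is positive. *)
Lemma rderive_incr r s : 0 < r -> r < s -> r * q1 r < s * q1 s.
Proof.
move=> r0 rs; have [x xi||x] := @MVT R (fun s => s * q1 s) (fun r => q1 r + r * q2 r) r s rs.
- move: xi; rewrite in_itv/= => /andP[rx _]; exact: drq1 (lt_trans r0 rx).
- apply: continuous_in_subspaceT => x; rewrite inE/= in_itv/= => /andP[rx _].
  exact: is_derive_continuous (drq1 (lt_le_trans r0 rx)).
rewrite in_itv/= => /andP[rx _] E; rewrite -subr_gt0 E mulr_gt0 ?subr_gt0//.
have x0 := lt_trans r0 rx.
have := lapl_gt0 x0; rewrite laplQE// pmulr_rgt0// invr_gt0//.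
Qed.

Lemma inner_radius_eta (r0 r1 : \bar R) : inner_radius q r0 ->
  ((1%:E <= r0 /\ r0 < r1)%E \/ [/\ r0 = +oo%E, r1 = +oo%E & q1 1 < 0]) ->
  [/\ q1 1 <= 0, (1%:E < r0)%E <-> 1 < eta q & r0 = 1%:E <-> eta q = 1].
Proof.
move=> ir H.
have etaE : eta q = 1 - q1 1 / 2 by [].
(* An infinite r0 is incompatible with r0 < r1, so it leaves only the alternative carrying q'(1) <
   0. A finite r0 is a critical point at distance at least 1, hence a true zero of q' and not the
   limit case at 0. *)
have [|[r rE [cr cmin]]] : (r0 = +oo%E /\ q1 1 < 0) \/ (exists2 r, r0 = r%:E & crit q r /\ 1 <= r).
- case: ir => [[r rE [cr _]]|[roo _]].
    right; exists r => //; split => //.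
    by case: H => [[]|[]]; rewrite rE ?lee_fin.
  left; split => //; case: H => [[_]|[]//].
  by rewrite roo ltNge leey.
- move=> [-> q10]; rewrite etaE; split; first exact: ltW.
    by rewrite ltry; split=> // _; lra.
  by split=> [h|h]; [by []|exfalso; move: q10 h; move: (q1 1) => w; lra].
- rewrite rE lte_fin; have r_gt0 : 0 < r by exact: lt_le_trans cmin.
  have q1r : q1 r = 0 by case: cr => [[]|[r00]] //; rewrite r00 ltxx in r_gt0.
  rewrite etaE; move: cmin; rewrite le_eqVlt => /predU1P[r1E|r_gt1].
    have q10 : q1 1 = 0 by rewrite r1E.
    rewrite q10 -r1E; split => //; split => //; rewrite ?ltxx//; lra.
  have := rderive_incr ltr01 r_gt1; rewrite q1r mulr0 mul1r => q10.
  rewrite r_gt1; split; first exact: ltW.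
    by split=> // _; move: q10; move: (q1 1) => w; lra.
  split=> [[rr]|h]; last by exfalso; move: q10 h; move: (q1 1) => w; lra.
  by move: r_gt1; rewrite rr ltxx.
Qed.

End potential_in_log_radius.

(** * Area in polar coordinates *)

Section area_linear_maps.
Context {R : realType}.
Local Notation mR := (measurableTypeR R).
Local Notation lam := (@lebesgue_measure R).

Definition affine (r t : R) (x : mR) : mR := r * x + t.

Lemma measurable_affine r t : measurable_fun setT (affine r t).
Proof. by apply: measurable_funD => //; exact: measurable_funM. Qed.

(** Uniqueness of Lebesgue measure: the scaled image measure has the same value on half-open
    intervals. *)
Lemma lebesgue_measure_affine (r t : R) (A : set mR) : 0 < r -> measurable A ->
  lam A = (r%:E * lam (affine r t @^-1` A))%E.
Proof.
move=> r0 mA.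
pose f := affine r t.
have mf : measurable_fun setT f by exact: measurable_affine.
pose m := [the {measure set mR -> \bar R} of pushforward lam f].
pose k := NngNum (ltW r0).
suff -> : lam A = mscale k (m mf) A by [].
apply: lebesgue_measure_unique => // _ [[a b]] _ <-.
rewrite /= /mscale/= /pushforward.
have -> : f @^-1` `]a, b] = `](a - t) / r, (b - t) / r]%classic.
  apply/seteqP; split => x; rewrite /f /affine/= !in_itv/= ltr_pdivrMr// ler_pdivlMr//.
    by rewrite ltrBlDr lerBrDr mulrC.
  by rewrite ltrBlDr lerBrDr mulrC.
rewrite !lebesgue_measure_itv/= !lte_fin ltr_pM2r ?invr_gt0// ltrD2r.
case: ifPn => _; last by rewrite mule0.
by rewrite -EFinM; congr EFin; field; rewrite gt_eqF.
Qed.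

(** One map for two purposes: r = 1 gives the shears that compose to a rotation, c = 0 the dilations
    of one axis that scale disks. *)
Definition shear1 (r c : R) (z : mR * mR) : mR * mR := (r * z.1 + c * z.2, z.2).
Definition shear2 (r c : R) (z : mR * mR) : mR * mR := (z.1, r * z.2 + c * z.1).

Lemma measurable_shear1 r c : measurable_fun setT (shear1 r c).
Proof.
apply: measurable_fun_pair => //; apply: measurable_funD; apply: measurable_funM => //.
Qed.

Lemma measurable_shear2 r c : measurable_fun setT (shear2 r c).
Proof.
apply: measurable_fun_pair => //; apply: measurable_funD; apply: measurable_funM => //.
Qed.

Lemma area_ysection (A : set (mR * mR)) : measurable A ->
  area A = (\int[lam]_y lam (ysection A y))%E.
Proof.
move=> mA; pose m : {measure set (mR * mR) -> \bar R} := (lam \x^ lam)%E.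
suff H B C : measurable B -> measurable C -> m (B `*` C) = (lam B * lam C)%E.
  exact: (product_measure_unique H mA).
exact: (@product_measure2E _ _ mR mR R lam lam).
Qed.

(** Slicing at fixed second coordinate: on each slice the shear is an affine map of the line with
    factor r. *)
Lemma area_shear1 r c (A : set (mR * mR)) : 0 < r -> measurable A ->
  area A = (r%:E * area (shear1 r c @^-1` A))%E.
Proof.
move=> r0 mA.
have mA' : measurable (shear1 r c @^-1` A).
  by rewrite -[X in measurable X]setTI; exact: measurable_shear1.
rewrite !area_ysection// -ge0_integralZl//; last 2 first.
  exact: measurable_fun_ysection.
  by rewrite lee_fin ltW.
apply: eq_integral => y _.
rewrite (@lebesgue_measure_affine r (c * y))//.
exact: measurable_ysection.
Qed.

Lemma area_shear2 r c (A : set (mR * mR)) : 0 < r -> measurable A ->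
  area A = (r%:E * area (shear2 r c @^-1` A))%E.
Proof.
move=> r0 mA.
have mA' : measurable (shear2 r c @^-1` A).
  by rewrite -[X in measurable X]setTI; exact: measurable_shear2.
rewrite /area /product_measure1 -ge0_integralZl//; last 2 first.
  exact: measurable_fun_xsection.
  by rewrite lee_fin ltW.
apply: eq_integral => x _ /=.
rewrite (@lebesgue_measure_affine r (c * x))//.
exact: measurable_xsection.
Qed.

Definition rotation (c s : R) (z : mR * mR) : mR * mR :=
  (c * z.1 - s * z.2, s * z.1 + c * z.2).

Lemma measurable_rotation c s : measurable_fun setT (rotation c s).
Proof.
apply: measurable_fun_pair => //.
  by apply: measurable_funB; apply: measurable_funM => //.
by apply: measurable_funD; apply: measurable_funM => //.
Qed.

(* A rotation of angle other than pi is a product of three shears, with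
   coefficients - tan (theta / 2), sin theta and - tan (theta / 2). *)
Lemma area_rotation c s (A : set (mR * mR)) : c ^+ 2 + s ^+ 2 = 1 -> c != -1 ->
  measurable A -> area (rotation c s @^-1` A) = area A.
Proof.
move=> cs c1 mA.
have c10 : 1 + c != 0 by rewrite addrC addr_eq0.
pose u := shear1 1 (- (s / (1 + c))); pose v := shear2 1 s.
have mu : measurable_fun setT u by exact: measurable_shear1.
have mv : measurable_fun setT v by exact: measurable_shear2.
have -> : rotation c s = u \o v \o u.
  apply/funext => -[x y]; rewrite /rotation /u /v /shear1 /shear2/=.
  have s2 : s ^+ 2 = 1 - c ^+ 2 by rewrite -cs addrAC subrr add0r.
  have st : s / (1 + c) * s = 1 - c.
    by rewrite mulrAC -expr2 s2; field.
  set t := s / (1 + c) in st *.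
  have sE : s = t * (1 + c) by rewrite /t divfK.
  congr (_, _).
    transitivity (x - t * s * x - t * y - t * (1 - t * s) * y); last by ring.
    by rewrite st [in LHS]sE; ring.
  transitivity (s * x + (1 - t * s) * y); last by ring.
  by rewrite st; ring.
have mA1 : measurable (u @^-1` A).
  by rewrite -[X in measurable X]setTI; exact: mu.
have mA2 : measurable (v @^-1` (u @^-1` A)).
  by rewrite -[X in measurable X]setTI; exact: mv.
rewrite (area_shear1 (- (s / (1 + c))) ltr01 mA) mul1e -/u.
rewrite (area_shear2 s ltr01 mA1) mul1e -/v.
by rewrite (area_shear1 (- (s / (1 + c))) ltr01 mA2) mul1e.
Qed.

End area_linear_maps.

(** * The image of area under |z|^2 *)

Section radial_measure.
Context {R : realType}.
Local Notation mR := (measurableTypeR R).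
Local Notation lam := (@lebesgue_measure R).

(** The squared modulus is preferred to the modulus because its image of area is a constant multiple
    of Lebesgue measure on [0, +oo). *)
Definition cmod2 (z : mR * mR) : mR := z.1 ^+ 2 + z.2 ^+ 2.

Lemma measurable_cmod2 : measurable_fun setT cmod2.
Proof. by apply: measurable_funD; exact: measurable_funX. Qed.

Lemma measurable_cmod2_preimage (B : set mR) : measurable B ->
  measurable (cmod2 @^-1` B).
Proof.
by move=> mB; rewrite -[X in measurable X]setTI; exact: measurable_cmod2.
Qed.

Let disk (s : R) : set (mR * mR) := cmod2 @^-1` `]-oo, s].

Let mdisk s : measurable (disk s).
Proof. exact: measurable_cmod2_preimage. Qed.

Let disk_scale (s : R) : 0 < s -> area (disk s) = (s%:E * area (disk 1))%E.
Proof.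
move=> s0; have r0 : 0 < Num.sqrt s by rewrite sqrtr_gt0.
pose u := @shear1 R (Num.sqrt s) 0; pose v := @shear2 R (Num.sqrt s) 0.
have mA : measurable (u @^-1` disk s).
  by rewrite -[X in measurable X]setTI; exact: measurable_shear1.
have E : v @^-1` (u @^-1` disk s) = disk 1.
  apply/seteqP; split => -[x y]; rewrite /disk/= /shear1 /shear2 /cmod2/= !in_itv/=.
    rewrite !mul0r !addr0 !exprMn sqr_sqrtr ?(ltW s0)// -mulrDr.
    by rewrite -[X in _ <= X]mulr1 ler_pM2l.
  rewrite !mul0r !addr0 !exprMn sqr_sqrtr ?(ltW s0)// -mulrDr.
  by rewrite -[X in _ -> _ <= X]mulr1 ler_pM2l.
rewrite (area_shear1 0 r0 (mdisk s)) (area_shear2 0 r0 mA) E muleA -EFinM.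
by rewrite -expr2 sqr_sqrtr ?(ltW s0).
Qed.

Let disk1_fin : (area (disk 1) < +oo)%E.
Proof.
apply: (@le_lt_trans _ _ (area (`[(-1 : R), 1]%classic `*` `[(-1 : R), 1]%classic))).
  apply: le_measure; rewrite ?inE//; first exact: measurableX.
  have sq (x y : R) : x ^+ 2 + y ^+ 2 <= 1 -> -1 <= x <= 1.
    move=> h; rewrite -ler_norml -(@expr_le1 _ 2)// real_normK ?num_real//.
    by rewrite (le_trans _ h)// lerDl sqr_ge0.
  move=> [x y]; rewrite /disk /cmod2/= !in_itv/= => h; split; first exact: sq h.
  by apply: (sq y x); rewrite addrC.
rewrite [X in (X < _)%E](@product_measure1E _ _ mR mR R lam lam)//.
have L : lam `[(-1 : R), 1] = 2%:E.
  by rewrite lebesgue_measure_itv/= lte_fin ifT; [congr EFin; ring|lra].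
by rewrite [X in (X * _ < _)%E]L [X in (_ * X < _)%E]L -EFinM ltry.
Qed.

Let disk0 : area (disk 0) = 0%E.
Proof.
apply/eqP; rewrite eq_le measure_ge0 andbT.
have <- : area ([set (0 : R)] `*` [set (0 : R)]) = 0%E.
  rewrite [LHS](@product_measure1E _ _ mR mR R lam lam)//.
  by rewrite [X in (X * _)%E]lebesgue_measure_set1 mul0e.
apply: le_measure; rewrite ?inE//; first exact: measurableX.
move=> [x y]; rewrite /disk /cmod2/= in_itv/= => h.
have := sqr_ge0 x; have := sqr_ge0 y => y0 x0.
have [xx yy] : x ^+ 2 = 0 /\ y ^+ 2 = 0 by split; lra.
by split; apply/eqP; rewrite -sqrf_eq0 (xx, yy).
Qed.

Let kappa : R := fine (area (disk 1)).

Let kappaE : area (disk 1) = kappa%:E.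
Proof. by rewrite fineK// ge0_fin_numE. Qed.

Let kappa_ge0 : 0 <= kappa.
Proof. by rewrite fine_ge0. Qed.

Let disk_area (s : R) : area (disk s) = (kappa * Num.max s 0)%:E.
Proof.
have [s0|] := ltP 0 s; first by rewrite disk_scale// kappaE -EFinM mulrC.
rewrite mulr0 => s0; apply/eqP; rewrite eq_le measure_ge0 andbT -[X in (_ <= X)%E]disk0.
apply: le_measure; rewrite ?inE// => z; rewrite /disk/= !in_itv/= => h.
exact: le_trans h s0.
Qed.

(** The area of the disk |z|^2 <= s is linear in s >= 0 by dilation, so both sides agree on
    half-open intervals; uniqueness of measures does the rest. *)
Let radial_area_kappa (A : set mR) : measurable A ->
  area (cmod2 @^-1` A) = (kappa%:E * lam (A `&` `[0%R, +oo[))%E.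
Proof.
move=> mA.
pose m1 := [the {measure set mR -> \bar R} of pushforward area cmod2].
have mI : measurable (`[0%R, +oo[%classic : set mR) by [].
pose m2 : {measure set mR -> \bar R} := mscale (NngNum kappa_ge0) (mrestr lam mI).
suff -> : area (cmod2 @^-1` A) = m2 A by [].
have itvE (a b : R) : a <= b ->
    area (cmod2 @^-1` `]a, b]) = (kappa * (Num.max b 0 - Num.max a 0))%:E.
  move=> ab.
  have : area (disk b) = (area (disk a) + area (cmod2 @^-1` `]a, b]))%E.
    rewrite -measureU//; last 2 first.
      exact: measurable_cmod2_preimage.
      apply/seteqP; split => // z [] ; rewrite /disk/= !in_itv/= => h /andP[h' _].
      by move: (le_lt_trans h h'); rewrite ltxx.
    congr (area _); apply/seteqP; split => z; rewrite /disk/= !in_itv/=.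
      by move=> h; have [|] := leP (cmod2 z) a => h'; [left|right; apply/andP].
    by case=> [h|/andP[]//]; exact: le_trans h ab.
  rewrite !disk_area; case: (area _) => // x [] h.
  by rewrite mulrBr h addrAC subrr add0r.
pose g (n : nat) : set mR := `](- n%:R)%R, n%:R]%classic.
suff H : forall B, measurable B -> m1 measurable_cmod2 B = m2 B by exact: H.
apply: (@measure_unique _ R mR (@ocitv R) g).
- by [].
- exact: ocitvI.
- by move=> n; exists (- n%:R, n%:R).
- apply/seteqP; split => // x _; exists (Num.bound `|x|) => //=.
  have := archi_boundP (normr_ge0 x); rewrite /g/= in_itv/= ltr_norml => /andP[-> h].
  exact: ltW.
- move=> _ [[a b]] _ <-; 
  change (area (cmod2 @^-1` `]a, b]) = kappa%:E * lam (`]a, b] `&` `[0%R, +oo[))%E.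
  have [ab|ba] := leP a b; last first.
    by rewrite set_itv_ge ?bnd_simp -?leNgt ?(ltW ba)// preimage_set0 set0I !measure0 [RHS]mule0.
  rewrite itvE// EFinM; congr (_ * _)%E.
  have [a0|a0] := ltP a 0.
    have -> : `]a, b] `&` `[0, +oo[ = `[0, b]%classic.
      apply/seteqP; split => x /=; rewrite !in_itv/= andbT.
        by move=> [/andP[_ ->] ->].
      by move=> /andP[x0 ->]; rewrite (lt_le_trans a0 x0) x0.
    rewrite lebesgue_measure_itv/= lte_fin subr0; have [b0|b0] := ltP 0 b => //.
    by rewrite sube0.
  have -> : `]a, b] `&` `[0, +oo[ = `]a, b]%classic.
    apply/seteqP; split => x /=; rewrite !in_itv/= andbT; first by case.
    by move=> /andP[ax ->]; rewrite ax (le_trans a0 (ltW ax)).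
  rewrite lebesgue_measure_itv/= lte_fin max_l ?(le_trans a0 ab)//.
  by move: ab; rewrite le_eqVlt => /predU1P[->|->//]; rewrite ltxx subrr.
- move=> k; change (area (cmod2 @^-1` `](- k%:R)%R, k%:R]) < +oo)%E.
  by rewrite itvE ?ltry// (le_trans _ (ler0n _ k))// oppr_le0.
Qed.

Let integral_kappa (D : set mR) (f : mR -> \bar R) : measurable D ->
  D `<=` `[0, +oo[%classic -> measurable_fun D f -> (forall x, D x -> 0 <= f x)%E ->
  (\int[area]_(z in cmod2 @^-1` D) f (cmod2 z) = kappa%:E * \int[lam]_(u in D) f u)%E.
Proof.
move=> mD D0 mf f0.
rewrite -(@ge0_integral_pushforward _ _ _ _ R _ measurable_cmod2 area D f mD mf); last first.
  by move=> y /set_mem; exact: f0.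
rewrite -(@ge0_integral_mscale _ mR R lam D mD (NngNum kappa_ge0) f mf)//.
apply: eq_measure_integral; first exact: measurable_cmod2.
move=> ? A mA AD.
change (area (cmod2 @^-1` A) = kappa%:E * lam A)%E.
rewrite radial_area_kappa//; suff -> : A `&` `[0, +oo[ = A by [].
by apply/seteqP; split => [x []//|x Ax]; split => //; apply: D0; exact: AD.
Qed.

(** The unknown constant is found by integrating e^{-|z|^2} in two ways: as the square of the
    Gaussian integral, and radially, where int_0^oo e^{-u} du = 1. *)
Let kappa_pi : kappa = pi.
Proof.
have mf : measurable_fun setT (fun u : mR => (expR (- u))%:E).
  by apply/measurable_EFinP; exact: measurableT_comp.
have E1 : (\int[area]_z (expR (- cmod2 z))%:E = pi%:E)%E.
  rewrite (_ : area = (lam \x lam)%E)// fubini_tonelli1//; last first.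
    by apply: (measurableT_comp mf); exact: measurable_cmod2.
  rewrite /fubini_F; transitivity (\int[lam]_x ((Num.sqrt pi)%:E * (gauss_fun x)%:E))%E.
    apply: eq_integral => x _; rewrite muleC -integralT_gauss -ge0_integralZl//.
    - by apply: eq_integral => y _; rewrite -EFinM /gauss_fun -expRD /cmod2/= opprD.
    - by apply/measurable_EFinP; exact: measurable_gauss_fun.
    - by move=> y _; rewrite lee_fin gauss_fun_ge0.
    - by rewrite lee_fin gauss_fun_ge0.
  rewrite ge0_integralZl//.
  - by rewrite integralT_gauss -EFinM -expr2 sqr_sqrtr// pi_ge0.
  - by apply/measurable_EFinP; exact: measurable_gauss_fun.
  - by move=> y _; rewrite lee_fin gauss_fun_ge0.
have mI : measurable (`[0%R, +oo[%classic : set mR) by [].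
have := @integral_kappa `[0, +oo[%classic (fun u => (expR (- u))%:E) mI.
rewrite (_ : cmod2 @^-1` _ = setT); last first.
  by apply/seteqP; split => // z _; rewrite /= in_itv/= andbT addr_ge0// sqr_ge0.
rewrite E1.
have [|||| iI IE] := @ge0_half_line_FTC R (fun u => expR (- u)) (fun u => - expR (- u)) 0.
- by move=> u _; exact: expR_ge0.
- by move=> u _; isd; ring.
- by move=> u _; apply: (is_derive_continuous (a := - expR (- u))); isd; ring.
- by rewrite -oppr0; apply: cvgN; exact: cvgr_expR.
have -> : (\int[lam]_(u in `[0%R, +oo[) (expR (- u))%:E = 1)%E.
  have := integrable_fin_num mI iI => /fineK; rewrite [X in X%:E = _]IE.
  by move=> <-; rewrite oppr0 expR0 sub0r opprK.
rewrite mule1 => H; suff [] : pi%:E = kappa%:E by [].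
by apply: H => //; exact: measurable_funS mf.
Qed.

Lemma radial_area (A : set mR) : measurable A ->
  area (cmod2 @^-1` A) = (pi%:E * lam (A `&` `[0%R, +oo[))%E.
Proof. by rewrite -kappa_pi; exact: radial_area_kappa. Qed.

Lemma ge0_integral_radial (D : set mR) (f : mR -> \bar R) : measurable D ->
  D `<=` `[0, +oo[%classic -> measurable_fun D f -> (forall x, D x -> 0 <= f x)%E ->
  (\int[area]_(z in cmod2 @^-1` D) f (cmod2 z) = pi%:E * \int[lam]_(u in D) f u)%E.
Proof. by rewrite -kappa_pi; exact: integral_kappa. Qed.

End radial_measure.

Section radial_weight.
Context {R : realType}.
Local Notation mR := (measurableTypeR R).
Local Notation lam := (@lebesgue_measure R).

Lemma unit_diskE : unit_disk = cmod2 @^-1` `[(0 : R), 1]%classic.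
Proof.
apply/seteqP; split => z; rewrite /unit_disk /cmod2/= in_itv/= /cmod => h.
  rewrite addr_ge0 ?sqr_ge0//= -[X in _ <= X](expr1n _ 2).
  by rewrite -[X in X <= _]sqr_sqrtr ?addr_ge0 ?sqr_ge0// ler_pXn2r ?nnegrE ?sqrtr_ge0.
by move: h => /andP[_ h]; rewrite -[X in _ <= X]sqrtr1 ler_wsqrtr.
Qed.

Lemma cmodE (z : mR * mR) : cmod z = Num.sqrt (cmod2 z).
Proof. by []. Qed.

Lemma measurable_unit_disk : measurable (unit_disk : set (mR * mR)).
Proof. by rewrite unit_diskE; exact: measurable_cmod2_preimage. Qed.

Variable w : R -> R.
Hypothesis cw : forall r : R, 0 < r -> {for r, continuous w}.
Hypothesis w_ge0 : forall r, 0 <= w r.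
Hypothesis w_le1 : forall r, 0 < r <= 1 -> w r <= 1.

(** Truncation at 1 keeps the values on [0, 1] and makes the function continuous on both sides of u
    = 1, where the antiderivative must be differentiated because s = 0 corresponds to u = 1. *)
Let f j (u : R) := Num.min u 1 ^+ j * w (Num.sqrt (Num.min u 1)).

Let f_cont j (u : R) : 0 < u -> {for u, continuous (f j)}.
Proof.
move=> u0.
have cm : {for u, continuous (fun u : R => Num.min u 1)}.
  by apply: continuous_min; [exact: cvg_id|exact: cvg_cst].
have m0 : 0 < Num.min u 1 by rewrite lt_min u0 ltr01.
have s0 : 0 < Num.sqrt (Num.min u 1) by rewrite sqrtr_gt0.
have cs : {for u, continuous (Num.sqrt \o (fun u : R => Num.min u 1))}.
  by apply: continuous_comp => //; exact: sqrt_continuous.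
have cx : {for u, continuous ((fun y : R => y ^+ j) \o (fun u : R => Num.min u 1))}.
  by apply: continuous_comp => //; exact: exprn_continuous.
have cws : {for u, continuous (w \o (Num.sqrt \o (fun u : R => Num.min u 1)))}.
  by apply: continuous_comp => //; exact: cw.
exact: (cvgM cx cws).
Qed.

Let f_ge0 j (u : R) : 0 <= u -> 0 <= f j u.
Proof. by move=> u0; rewrite mulr_ge0// exprn_ge0// le_min u0 ler01. Qed.

(** The bound [w_le1] says nothing about [w 0], where the potential has an arbitrary value; the
    summand [w 0] accounts for that single point. *)
Let f_bound j (u : R) : 0 <= u -> f j u <= 1 + w 0.
Proof.
rewrite le_eqVlt => /predU1P[<-|u0]; rewrite /f.
  rewrite min_l ?ler01// sqrtr0 -[X in _ <= X]mul1r ler_pM ?exprn_ge0 ?exprn_ile1//.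
  by rewrite lerDr.
have m0 : 0 < Num.min u 1 by rewrite lt_min u0 ltr01.
have m1 : Num.min u 1 <= 1 by rewrite ge_min lexx orbT.
rewrite -[X in _ <= X]mul1r ler_pM ?exprn_ge0 ?exprn_ile1 ?(ltW m0)//.
apply: (le_trans (w_le1 _)); last by rewrite lerDl.
by rewrite sqrtr_gt0 m0 -[X in _ <= X]sqrtr1 ler_wsqrtr.
Qed.

Let mf j (b : R) : measurable_fun (`[0, b]%classic : set mR) (f j).
Proof.
apply/measurable_fun_itv_obnd_cbndP; have sub : `]0, b] `<=` `]0, +oo[%classic.
  by move=> x /=; rewrite !in_itv/= andbT => /andP[].
apply: (@measurable_funS _ _ mR R `]0, +oo[%classic) sub _ => //.
apply: open_continuous_measurable_fun; first exact: interval_open.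
by move=> x; rewrite inE/= in_itv/= andbT => x0; exact: f_cont.
Qed.

Let f_int j (b : R) : lam.-integrable `[0, b] (EFin \o f j).
Proof.
have [l L] : exists l : R, lam `[(0 : R), b] = l%:E.
  rewrite lebesgue_measure_itv/=; case: ifPn => _; last by exists 0.
  by exists (b - 0); rewrite EFinB.
apply: measurable_bounded_integrable => //; first by rewrite [X in (X < _)%E]L ltry.
exists (1 + w 0); split; first exact: num_real.
move=> M hM x; rewrite /= in_itv/= => /andP[x0 _].
by rewrite ger0_norm ?f_ge0// (le_trans (f_bound j x0))// ltW.
Qed.

Let A j (u : R) := \int[lam]_(t in `[0, u]) f j t.

Let dA j (u : R) : 0 < u -> is_derive u 1 (A j) (f j u).
Proof.
move=> u0; have [|||] := @continuous_FTC1 R (f j) (BLeft 0) u (u + 1) _ (f_int j _).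
- by rewrite ltrDl.
- by [].
- exact: f_cont.
by move=> h1 h2; exact: derive1_is_derive h1 h2.
Qed.

Let A0 j : A j u @[u --> (0 : R)] --> 0.
Proof. exact: (parameterized_integral_cvg_left (ltr01) (f_int j 1)). Qed.

(** Change of variable u = e^{-2 d s}, that is |z| = e^{-d s}; the factor u in du = - 2 d u ds
    raises the exponent from j to j + 1. *)
Let substitution j (d : R) : 0 < d ->
  A j 1 = 2 * d *
    \int[lam]_(s in `[0, +oo[) (expR (- (2 * (d * j.+1%:R) * s)) * w (expR (- (d * s)))).
Proof.
move=> d0; pose E (s : R) := expR (- (2 * d * s)).
have E0 (s : R) : 0 < E s by exact: expR_gt0.
have dE (s : R) : is_derive s 1 E (- (2 * d) * E s) by rewrite /E; isd; ring.
have cE (s : R) : {for s, continuous E} by exact: is_derive_continuous (dE s).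
have cfE (s : R) : {for s, continuous (f j \o E)}.
  by apply: (continuous_comp (cE s)); exact: f_cont.
have d20 : 2 * d != 0 by rewrite mulf_neq0 ?gt_eqF.
have [||||_ IE] := @ge0_half_line_FTC R (fun s => E s * f j (E s))
  (fun s => - (2 * d)^-1 * A j (E s)) 0.
- by move=> s _; rewrite mulr_ge0 ?(ltW (E0 _))// f_ge0// ltW.
- move=> s _; have h1 := dA j (E0 s); have h2 := dE s.
  have h3 := isd_mul (isd_cst (- (2 * d)^-1) s) (isd_comp h1 h2).
  by apply: (is_derive_eq h3); rewrite mulr0 addr0; field; rewrite gt_eqF.
- by move=> s _; apply: cvgM; [exact: cE|exact: cfE].
- rewrite -[X in _ --> X](mulr0 (- (2 * d)^-1)); apply: cvgMr.
  apply: (cvg_comp _ _ _ (@A0 j)).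
  have -> : E = (fun y => expR (- y)) \o (fun s => s * (2 * d)).
    by apply/funext => s; rewrite /E/= mulrC.
  by apply: cvg_comp (@cvgr_expR R); apply: gt0_cvgMly; [rewrite mulr_gt0|].
rewrite -[LHS](mulVKf d20); congr (_ * _).
have -> : A j 1 = A j (E 0) by congr (A j _); rewrite /E mulr0 oppr0 expR0.
transitivity (0 - - (2 * d)^-1 * A j (E 0)); first by rewrite sub0r mulNr opprK.
rewrite -IE.
apply: eq_Rintegral => s; rewrite inE/= in_itv/= andbT => s0.
have E1 : E s <= 1 by rewrite -expR0 ler_expR oppr_le0 !mulr_ge0 ?(ltW d0).
have E2 : E s = expR (- (d * s)) ^+ 2 by rewrite /E -expRM_natl; congr expR; ring.
transitivity (E s ^+ j.+1 * w (Num.sqrt (E s))); first by rewrite /f min_l// exprS mulrA.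
rewrite [X in Num.sqrt X]E2 sqrtr_sqr ger0_norm ?expR_ge0//.
by congr (_ * _); rewrite /E -expRM_natl; congr expR; ring.
Qed.

Lemma radial_moment j (d : R) : 0 < d ->
  \int[area]_(z in unit_disk) (cmod2 z ^+ j * w (cmod z)) =
  2 * pi * d * \int[lam]_(s in `[0, +oo[) (expR (- (2 * (d * j.+1%:R) * s)) * w (expR (- (d * s)))).
Proof.
move=> d0; rewrite [2 * pi]mulrC -mulrA -mulrA [_ * (d * _)]mulrA -substitution//.
have D0 : `[(0 : R), 1] `<=` `[0, +oo[%classic.
  by move=> x /=; rewrite !in_itv/= andbT => /andP[].
have mI : measurable (`[(0 : R), 1]%classic : set mR) by [].
have := @ge0_integral_radial R _ (EFin \o f j) mI D0.
rewrite unit_diskE /Rintegral => H.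
transitivity (fine (\int[area]_(z in cmod2 @^-1` `[0%R, 1%R]) (f j (cmod2 z))%:E)).
  congr fine; apply: eq_integral => z; rewrite inE/= in_itv/= => /andP[z0 z1].
  by rewrite /f min_l.
rewrite H; last 2 first.
- by apply/measurable_EFinP; exact: mf.
- by move=> x; rewrite /= in_itv/= => /andP[x0 _]; rewrite lee_fin f_ge0.
by rewrite fineM// integrable_fin_num// f_int.
Qed.

End radial_weight.

(** * The partition function as a product of radial moments *)

Section product_integral.
Context d1 d2 (T1 : measurableType d1) (T2 : measurableType d2) (R : realType).
Variables (m1 : {sigma_finite_measure set T1 -> \bar R}).
Variables (m2 : {sigma_finite_measure set T2 -> \bar R}).
Variables (f : T1 -> R) (g : T2 -> R).
Hypothesis f_int : m1.-integrable setT (EFin \o f).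
Hypothesis g_int : m2.-integrable setT (EFin \o g).

Let h (z : T1 * T2) := (f z.1 * g z.2)%:E.

Let mf : measurable_fun setT f.
Proof. by apply/measurable_EFinP; exact: measurable_int f_int. Qed.

Let mg : measurable_fun setT g.
Proof. by apply/measurable_EFinP; exact: measurable_int g_int. Qed.

Lemma integrable_prodM : (m1 \x m2)%E.-integrable setT h.
Proof.
apply/integrable12ltyP.
  apply/measurable_EFinP; apply: measurable_funM.
    exact: (measurableT_comp mf).
  exact: (measurableT_comp mg).
rewrite (_ : (fun x => _) = fun x => (`|(f x)%:E| * \int[m2]_y `|(g y)%:E|)%E); last first.
  apply/funext => x; rewrite -ge0_integralZl//.
    by apply: eq_integral => y _; rewrite /h/= normrM EFinM.
  by apply: measurableT_comp => //; apply/measurable_EFinP.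
have /integrableP[_ gfin] := g_int; have /integrableP[_ ffin] := f_int.
rewrite ge0_integralZr//; last 2 first.
- by apply: measurableT_comp => //; apply/measurable_EFinP.
- exact: integral_ge0.
by rewrite lte_mul_pinfty// ?integral_ge0// ge0_fin_numE// integral_ge0.
Qed.

Lemma Rintegral_prodM :
  \int[(m1 \x m2)%E]_z (f z.1 * g z.2) = (\int[m1]_x f x) * (\int[m2]_y g y).
Proof.
have gfin := integrable_fin_num measurableT g_int.
have ffin := integrable_fin_num measurableT f_int.
rewrite /Rintegral -fineM// -(@integral12_prod_meas1 _ _ _ _ _ m1 m2 h integrable_prodM).
congr fine; rewrite /fubini_F /h/= -(fineK gfin) -integralZr//.
apply: eq_integral => x _; rewrite (fineK gfin) -integralZl//.
Qed.

End product_integral.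

(** * Componentwise integration of complex-valued functions *)

Section complex_integral.
Context {R : realType}.
Local Notation C := (complex R).

Definition cintegrable d (T : measurableType d) (mu : {measure set T -> \bar R}) (f : T -> C) :=
  mu.-integrable setT (EFin \o (fun x => complex.Re (f x))) /\
  mu.-integrable setT (EFin \o (fun x => complex.Im (f x))).

Definition cint d (T : measurableType d) (mu : {measure set T -> \bar R}) (f : T -> C) : C :=
  Complex (\int[mu]_x complex.Re (f x)) (\int[mu]_x complex.Im (f x)).

Lemma complex_ReM (x y : C) :
  complex.Re (x * y) = complex.Re x * complex.Re y - complex.Im x * complex.Im y.
Proof. by case: x y => [a b] [c e]. Qed.

Lemma complex_ImM (x y : C) :
  complex.Im (x * y) = complex.Re x * complex.Im y + complex.Im x * complex.Re y.
Proof. by case: x y => [a b] [c e]. Qed.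

Lemma cint_add d (T : measurableType d) (mu : {measure set T -> \bar R}) (f g : T -> C) :
  cintegrable mu f -> cintegrable mu g ->
  cintegrable mu (fun x => f x + g x) /\
  cint mu (fun x => f x + g x) = cint mu f + cint mu g.
Proof.
move=> [f1 f2] [g1 g2]; split.
  split.
    by apply: eq_integrable (integrableD measurableT f1 g1) => // x _; rewrite /= raddfD.
  by apply: eq_integrable (integrableD measurableT f2 g2) => // x _; rewrite /= raddfD.
rewrite /cint; congr Complex; rewrite -RintegralD//; apply: eq_Rintegral => x _;
  by rewrite raddfD.
Qed.

Lemma cint_cst0 d (T : measurableType d) (mu : {measure set T -> \bar R}) :
  cintegrable mu (fun=> 0) /\ cint mu (fun=> 0) = 0.
Proof.
split; first by split; exact: integrable0.
by rewrite /cint /Rintegral/= integral0.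
Qed.

Lemma cint_sum d (T : measurableType d) (mu : {measure set T -> \bar R})
    (I : Type) (r : seq I) (P : pred I) (F : I -> T -> C) :
  (forall i, P i -> cintegrable mu (F i)) ->
  cintegrable mu (fun x => \sum_(i <- r | P i) F i x) /\
  cint mu (fun x => \sum_(i <- r | P i) F i x) = \sum_(i <- r | P i) cint mu (F i).
Proof.
move=> iF; elim: r => [|i r [IH1 IH2]].
  rewrite big_nil (_ : (fun x => _) = (fun=> 0)); first exact: cint_cst0.
  by apply/funext => x; rewrite big_nil.
rewrite big_cons (_ : (fun x => _) = (fun x => if P i then F i x + \sum_(j <- r | P j) F j x
  else \sum_(j <- r | P j) F j x)); last by apply/funext => x; rewrite big_cons.
by case: ifPn => // Pi; rewrite -IH2; apply: cint_add => //; exact: iF.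
Qed.

Lemma cint_scale d (T : measurableType d) (mu : {measure set T -> \bar R}) (c : C) (f : T -> C) :
  cintegrable mu f ->
  cintegrable mu (fun x => c * f x) /\ cint mu (fun x => c * f x) = c * cint mu f.
Proof.
case: c => a b [f1 f2].
have i1 (k : R) := integrable_mulrl measurableT k f1.
have i2 (k : R) := integrable_mulrl measurableT k f2.
split.
  split.
    apply: eq_integrable (integrable_subr measurableT (i1 a) (i2 b)) => // x _.
    by rewrite /= complex_ReM.
  apply: eq_integrable (integrable_addr measurableT (i2 a) (i1 b)) => // x _.
  by rewrite /= complex_ImM.
rewrite /cint; apply/eqP; rewrite eq_complex; apply/andP; split; apply/eqP; rewrite /=.
  rewrite -!RintegralZl// -RintegralB//; apply: eq_Rintegral => x _; exact: complex_ReM.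
rewrite -!RintegralZl// -RintegralD//; apply: eq_Rintegral => x _; exact: complex_ImM.
Qed.

Lemma cint_prodM d1 d2 (T1 : measurableType d1) (T2 : measurableType d2)
    (m1 : {sigma_finite_measure set T1 -> \bar R})
    (m2 : {sigma_finite_measure set T2 -> \bar R}) (f : T1 -> C) (g : T2 -> C) :
  cintegrable m1 f -> cintegrable m2 g ->
  cintegrable (m1 \x m2)%E (fun z => f z.1 * g z.2) /\
  cint (m1 \x m2)%E (fun z => f z.1 * g z.2) = cint m1 f * cint m2 g.
Proof.
move=> [f1 f2] [g1 g2].
have i11 := integrable_prodM f1 g1; have i12 := integrable_prodM f1 g2.
have i21 := integrable_prodM f2 g1; have i22 := integrable_prodM f2 g2.
split.
  split.
    by apply: eq_integrable (integrable_subr measurableT i11 i22) => // x _; rewrite /= complex_ReM.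
  by apply: eq_integrable (integrable_addr measurableT i12 i21) => // x _; rewrite /= complex_ImM.
rewrite /cint; apply/eqP; rewrite eq_complex; apply/andP; split; apply/eqP; rewrite /=.
  rewrite -!Rintegral_prodM// -RintegralB//; apply: eq_Rintegral => x _; exact: complex_ReM.
rewrite -!Rintegral_prodM// -RintegralD//; apply: eq_Rintegral => x _; exact: complex_ImM.
Qed.

Lemma measurable_cintegrable d (T : measurableType d) (mu : {measure set T -> \bar R}) f :
  cintegrable mu f ->
  measurable_fun setT (EFin \o (fun x => complex.Re (f x))) /\
  measurable_fun setT (EFin \o (fun x => complex.Im (f x))).
Proof. by move=> [h1 h2]; split; [exact: measurable_int h1|exact: measurable_int h2]. Qed.

(** Applied to [tcons], which carries the product measure to the measure on tuples, and to
    rotations, which carry area to itself. *)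
Lemma cint_image d1 d2 (T1 : measurableType d1) (T2 : measurableType d2)
    (phi : T1 -> T2) (mu : {measure set T1 -> \bar R}) (nu : {measure set T2 -> \bar R})
    (f : T2 -> C) :
  measurable_fun setT phi ->
  (forall A, measurable A -> nu A = mu (phi @^-1` A)) ->
  measurable_fun setT (EFin \o (fun x => complex.Re (f x))) ->
  measurable_fun setT (EFin \o (fun x => complex.Im (f x))) ->
  cintegrable mu (f \o phi) ->
  cintegrable nu f /\ cint nu f = cint mu (f \o phi).
Proof.
move=> mphi nuE.
suff H (g : T2 -> R) : measurable_fun setT (EFin \o g) ->
    mu.-integrable setT (EFin \o (g \o phi)) ->
    nu.-integrable setT (EFin \o g) /\ \int[nu]_x g x = \int[mu]_x (g (phi x)).
  move=> m1 m2 [i1 i2]; have [? e1] := H _ m1 i1; have [? e2] := H _ m2 i2.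
  by split => //; rewrite /cint e1 e2.
move=> mg ig.
pose m := [the {measure set T2 -> \bar R} of pushforward mu phi].
have nuI (h : T2 -> \bar R) : (\int[nu]_x h x = \int[m mphi]_x h x)%E.
  by apply: eq_measure_integral => A mA _; exact: nuE.
have ig' : mu.-integrable (phi @^-1` setT) ((EFin \o g) \o phi) by rewrite preimage_setT.
have /integrableP[_ fin] := @integrable_pushforward _ _ _ _ R _ mphi mu setT _ mg ig' measurableT.
split; first by apply/integrableP; split => //; rewrite nuI.
rewrite /Rintegral nuI (@integral_pushforward _ _ _ _ R _ mphi mu setT _ mg ig' measurableT).
by rewrite preimage_setT.
Qed.

Lemma cint_tuple d (T : measurableType d) (mu : {sigma_finite_measure set T -> \bar R}) n
    (F : 'I_n -> T -> C) :
  (forall i, cintegrable mu (F i)) ->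
  cintegrable (tuple_measure mu n) (fun t : n.-tuple T => \prod_(i < n) F i (tnth t i)) /\
  cint (tuple_measure mu n) (fun t : n.-tuple T => \prod_(i < n) F i (tnth t i)) =
    \prod_(i < n) cint mu (F i).
Proof.
elim: n F => [|n IH] F iF.
  rewrite big_ord0 (_ : (fun t => _) = fun=> 1); last by apply/funext => t; rewrite big_ord0.
  split.
    split; last exact: integrable0.
    apply/integrableP; split; first exact: measurable_cst.
    rewrite (@eq_measure_integral _ _ R setT (@dirac _ (0.-tuple T) [tuple] R))// integral_dirac//.
    by rewrite diracE in_setT mul1e/= ltry.
  rewrite /cint/= /Rintegral integral0; congr Complex.
  rewrite (@eq_measure_integral _ _ R setT (@dirac _ (0.-tuple T) [tuple] R))// integral_dirac//.
  by rewrite diracE in_setT mul1e.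
have [i1 e1] := IH (fun i => F (lift ord0 i)) (fun i => iF _).
have [i2 e2] := cint_prodM (iF ord0) i1.
have E (z : T * n.-tuple T) : \prod_(i < n.+1) F i (tnth (tcons z) i) =
    F ord0 z.1 * \prod_(i < n) F (lift ord0 i) (tnth z.2 i).
  by rewrite big_ord_recl; congr (_ * _); apply: eq_bigr => i _; rewrite tnthS.
(* Measurability on tuples is transported through the inverse of [tcons], splitting a tuple into
   head and tail. *)
have mtail : measurable_fun setT (fun t : n.+1.-tuple T => (thead t, [tuple of behead t])).
  exact: measurable_tail.
pose G (z : T * n.-tuple T) := F ord0 z.1 * \prod_(i < n) F (lift ord0 i) (tnth z.2 i).
have [mG1 mG2] := measurable_cintegrable i2.
have GE (t : n.+1.-tuple T) : \prod_(i < n.+1) F i (tnth t i) = G (thead t, [tuple of behead t]).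
  case/tupleP: t => x s; rewrite /G/= big_ord_recl tnth0 theadE; congr (_ * _).
  apply: eq_bigr => i _; rewrite tnthS; congr (F _ (tnth _ _)); exact: val_inj.
have [||||i3 e3] := @cint_image _ _ _ _ (@tcons _ T n)
  (mu \x tuple_measure mu n)%E (tuple_measure mu n.+1)
  (fun t => \prod_(i < n.+1) F i (tnth t i)) (@measurable_tcons _ T n).
- by [].
- rewrite (_ : _ \o _ = (EFin \o (fun z => complex.Re (G z))) \o
      (fun t : n.+1.-tuple T => (thead t, [tuple of behead t]))).
    exact: measurableT_comp mG1 mtail.
  by apply/funext => t; rewrite /= GE.
- rewrite (_ : _ \o _ = (EFin \o (fun z => complex.Im (G z))) \o
      (fun t : n.+1.-tuple T => (thead t, [tuple of behead t]))).
    exact: measurableT_comp mG2 mtail.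
  by apply/funext => t; rewrite /= GE.
- by rewrite (_ : _ \o _ = G); last by apply/funext => z; exact: E.
split => //; rewrite e3 (_ : _ \o _ = G); last by apply/funext => z; exact: E.
by rewrite e2 big_ord_recl e1.
Qed.

End complex_integral.

(** * Orthogonality of monomials and the Vandermonde square *)

Section complex_moments.
Context {R : realType}.
Local Notation C := (complex R).
Local Notation mR := (measurableTypeR R).
Local Notation lam := (@lebesgue_measure R).

Definition cplx (z : mR * mR) : C := Complex z.1 z.2.

Lemma complex_ReZ (r : R) (x : C) : complex.Re (r%:C%C * x) = r * complex.Re x.
Proof. by case: x => a b /=; rewrite mul0r subr0. Qed.

Lemma complex_ImZ (r : R) (x : C) : complex.Im (r%:C%C * x) = r * complex.Im x.
Proof. by case: x => a b /=; rewrite mul0r addr0. Qed.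

Lemma cplx_mul_conj z : cplx z * (cplx z)^*%C = (cmod2 z)%:C%C.
Proof.
case: z => x y; rewrite /cplx /cmod2/=; apply/eqP; rewrite eq_complex/=.
by apply/andP; split; apply/eqP; ring.
Qed.

Lemma cplx_rotation c s z : cplx (rotation c s z) = Complex c s * cplx z.
Proof.
case: z => x y; apply/eqP; rewrite eq_complex /cplx/=.
by apply/andP; split; apply/eqP; ring.
Qed.

Lemma cmod2_rotation c s (z : mR * mR) : c ^+ 2 + s ^+ 2 = 1 -> cmod2 (rotation c s z) = cmod2 z.
Proof.
move=> cs; case: z => x y; rewrite /cmod2 /rotation/=.
by rewrite -[RHS]mul1r -cs; ring.
Qed.

Lemma unit_circle_pow (t : R) a b :
  Complex (cos t) (sin t) ^+ a * ((Complex (cos t) (sin t))^*)%C ^+ b =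
  Complex (cos (t * (a%:R - b%:R))) (sin (t * (a%:R - b%:R))).
Proof.
pose e (u : R) : C := Complex (cos u) (sin u).
have eD u v : e (u + v) = e u * e v.
  apply/eqP; rewrite eq_complex/= cosD sinD.
  by apply/andP; split; apply/eqP; ring.
have e0 : e 0 = 1 by rewrite /e cos0 sin0.
have eX u n : e u ^+ n = e (u * n%:R).
  elim: n => [|n IH]; first by rewrite mulr0 e0.
  by rewrite exprS IH -eD -[in n.+1%:R]addn1 natrD; congr e; ring.
have eJ u : ((e u)^*)%C = e (- u) by rewrite /e/= cosN sinN.
by rewrite -/(e t) eJ !eX -eD; congr e; ring.
Qed.

Let disk_bounded (f : mR * mR -> C) :=
  [/\ measurable_fun setT (fun z => complex.Re (f z)),
      measurable_fun setT (fun z => complex.Im (f z)) &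
      exists K : R, forall z, unit_disk z -> `|complex.Re (f z)| <= K /\ `|complex.Im (f z)| <= K].

Let disk_boundedM f g : disk_bounded f -> disk_bounded g -> disk_bounded (fun z => f z * g z).
Proof.
move=> [f1 f2 [K fK]] [g1 g2 [L gL]]; split.
- rewrite (_ : (fun z => _) = fun z =>
      complex.Re (f z) * complex.Re (g z) - complex.Im (f z) * complex.Im (g z)).
    by apply: measurable_funB; exact: measurable_funM.
  by apply/funext => z; rewrite complex_ReM.
- rewrite (_ : (fun z => _) = fun z =>
      complex.Re (f z) * complex.Im (g z) + complex.Im (f z) * complex.Re (g z)).
    by apply: measurable_funD; exact: measurable_funM.
  by apply/funext => z; rewrite complex_ImM.
- exists (K * L + K * L) => z Dz; have [a1 a2] := fK z Dz; have [b1 b2] := gL z Dz.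
  rewrite complex_ReM complex_ImM; split.
    by rewrite (le_trans (ler_normB _ _))// !normrM lerD// ler_pM.
  by rewrite (le_trans (ler_normD _ _))// !normrM lerD// ler_pM.
Qed.

Let disk_boundedX f n : disk_bounded f -> disk_bounded (fun z => f z ^+ n).
Proof.
move=> bf; elim: n => [|n IH].
  split; [exact: measurable_cst|exact: measurable_cst|].
  by exists 1 => z _; rewrite expr0/= normr1 normr0.
by under [X in disk_bounded X]eq_fun do rewrite exprS; exact: disk_boundedM.
Qed.

Let disk_bounded_cplx : disk_bounded cplx /\ disk_bounded (fun z => (cplx z)^*%C).
Proof.
have H z : unit_disk z -> `|z.1| <= 1 /\ `|z.2| <= 1.
  rewrite unit_diskE/= in_itv/= /cmod2 => /andP[_ h].
  have := sqr_ge0 z.1; have := sqr_ge0 z.2 => h2 h1.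
  by split; rewrite -(@expr_le1 _ 2)// real_normK ?num_real//; lra.
split; split.
- exact: measurable_fst.
- exact: measurable_snd.
- by exists 1 => z /H.
- exact: measurable_fst.
- by apply: measurableT_comp => //; exact: measurable_snd.
- by exists 1 => z /H; rewrite /= normrN.
Qed.

Variable w : R -> R.
Hypothesis cw : forall r : R, 0 < r -> {for r, continuous w}.
Hypothesis w_ge0 : forall r, 0 <= w r.
Hypothesis w_le1 : forall r, 0 < r <= 1 -> w r <= 1.

(** Extension by zero puts the constraint on all points into the product integrand, so that
    [cint_tuple] applies on the whole space. *)
Definition disk_weight : mR * mR -> R := (fun z => w (cmod z)) \_ unit_disk.

Let disk_weight_bound z : `|disk_weight z| <= 1 + w 0.
Proof.
rewrite /disk_weight patchE; case: ifPn => [|_]; last by rewrite normr0 addr_ge0.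
rewrite inE => Dz; rewrite ger0_norm//.
have : 0 <= cmod z by exact: sqrtr_ge0.
rewrite le_eqVlt => /predU1P[<-|z0]; first by rewrite lerDr.
by rewrite (le_trans (w_le1 _)) ?lerDl// z0.
Qed.

Let measurable_disk_weight : measurable_fun setT disk_weight.
Proof.
apply/(measurable_restrictT _ measurable_unit_disk).
pose v (u : mR) : mR := w (Num.sqrt u).
suff mv : measurable_fun (`[0, 1]%classic : set mR) v.
  change (measurable_fun unit_disk (v \o cmod2)); rewrite unit_diskE.
  apply: (measurable_comp _ _ mv) => //; first by move=> _ /= [z zz <-].
  exact: measurable_funTS measurable_cmod2.
apply/measurable_fun_itv_obnd_cbndP.
have sub : `]0, 1] `<=` `](0 : R), +oo[%classic.
  by move=> x /=; rewrite !in_itv/= andbT => /andP[].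
apply: (@measurable_funS _ _ mR R `]0, +oo[%classic) sub _ => //.
apply: open_continuous_measurable_fun; first exact: interval_open.
move=> x; rewrite inE/= in_itv/= andbT => x0.
by apply: continuous_comp; [exact: sqrt_continuous|apply: cw; rewrite sqrtr_gt0].
Qed.

Let area_unit_disk_fin : (area (unit_disk : set (mR * mR)) < +oo)%E.
Proof.
have mI : measurable (`[(0 : R), 1]%classic : set mR) by [].
rewrite unit_diskE radial_area//.
have [l L] : exists l : R, lam (`[(0 : R), 1] `&` `[(0 : R), +oo[) = l%:E.
  rewrite (_ : _ `&` _ = `[(0 : R), 1]%classic).
    by rewrite lebesgue_measure_itv/= lte_fin ltr01; exists (1 - 0); rewrite EFinB.
  by apply/seteqP; split => x /=; rewrite !in_itv/= andbT; [case|move=> /andP[-> ->]].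
by rewrite L -EFinM ltry.
Qed.

Definition cmoment_fun a b (z : mR * mR) : C :=
  (disk_weight z)%:C%C * (cplx z ^+ a * (cplx z)^*%C ^+ b).

Let cmoment_measurable a b :
  measurable_fun setT (fun z => complex.Re (cmoment_fun a b z)) /\
  measurable_fun setT (fun z => complex.Im (cmoment_fun a b z)).
Proof.
have [b1 b2] := disk_bounded_cplx.
have [m1 m2 _] := disk_boundedM (disk_boundedX a b1) (disk_boundedX b b2).
split.
  rewrite (_ : (fun z => _) = fun z =>
      disk_weight z * complex.Re (cplx z ^+ a * (cplx z)^*%C ^+ b)).
    exact: measurable_funM.
  by apply/funext => z; rewrite /cmoment_fun complex_ReZ.
rewrite (_ : (fun z => _) = fun z =>
      disk_weight z * complex.Im (cplx z ^+ a * (cplx z)^*%C ^+ b)).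
  exact: measurable_funM.
by apply/funext => z; rewrite /cmoment_fun complex_ImZ.
Qed.

Let disk_integrable (f : mR * mR -> R) K : measurable_fun setT f ->
  (forall z, unit_disk z -> `|f z| <= K) ->
  area.-integrable setT (EFin \o (fun z => disk_weight z * f z)).
Proof.
move=> mf fK.
have E : (EFin \o (fun z => disk_weight z * f z)) =
    (EFin \o (fun z => disk_weight z * f z)) \_ unit_disk.
  apply/funext => z; rewrite patchE; case: ifPn => //= /negP.
  by rewrite inE => Dz; rewrite /disk_weight patchE memNset// mul0r.
rewrite E; apply/(integrable_mkcond _ measurable_unit_disk).
apply: measurable_bounded_integrable.
- exact: measurable_unit_disk.
- exact: area_unit_disk_fin.
- by apply: measurable_funM; [exact: measurable_funTS|exact: measurable_funTS].
exists ((1 + w 0) * K); split; first exact: num_real.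
move=> M hM z Dz; rewrite /= normrM ltW// (le_lt_trans _ hM)// ler_pM//.
exact: fK.
Qed.

Lemma cmoment_integrable a b : cintegrable area (cmoment_fun a b).
Proof.
have [b1 b2] := disk_bounded_cplx.
have [m1 m2 [K hK]] := disk_boundedM (disk_boundedX a b1) (disk_boundedX b b2).
split.
  rewrite (_ : (fun z => _) = fun z =>
      disk_weight z * complex.Re (cplx z ^+ a * (cplx z)^*%C ^+ b)).
    by apply: (disk_integrable (K := K)) => // z /hK[].
  by apply/funext => z; rewrite /cmoment_fun complex_ReZ.
rewrite (_ : (fun z => _) = fun z =>
      disk_weight z * complex.Im (cplx z ^+ a * (cplx z)^*%C ^+ b)).
  by apply: (disk_integrable (K := K)) => // z /hK[].
by apply/funext => z; rewrite /cmoment_fun complex_ImZ.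
Qed.

Lemma cmoment_diag a :
  cint area (cmoment_fun a a) = (\int[area]_(z in unit_disk) (cmod2 z ^+ a * w (cmod z)))%:C%C.
Proof.
have E z : cmoment_fun a a z = (((fun z => cmod2 z ^+ a * w (cmod z)) \_ unit_disk) z)%:C%C.
  rewrite /cmoment_fun -exprMn cplx_mul_conj -rmorphXn -rmorphM; congr (_%:C)%C.
  by rewrite /disk_weight !patchE; case: ifPn => _; rewrite ?mul0r// mulrC.
rewrite [in RHS]Rintegral_mkcond /cint; congr Complex.
  by apply: eq_Rintegral => z _; rewrite E.
under eq_Rintegral => z _ do rewrite E/=.
by rewrite /Rintegral integral0.
Qed.

(** The rotation by t = pi / (2 (a - b)) multiplies the integrand by e^{i pi / 2} = i and preserves
    area, so the integral I satisfies I = i I. As |a - b| >= 1, the angle lies in [- pi / 2, pi / 2]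
    and cos t differs from -1, as [area_rotation] requires. *)
Lemma cmoment_offdiag a b : a != b -> cint area (cmoment_fun a b) = 0.
Proof.
move=> ab; pose D : R := a%:R - b%:R.
have D0 : D != 0 by rewrite subr_eq0 eqr_nat.
have D1 : 1 <= `|D|.
  have [lt|lt|eq] := ltngtP a b; last by rewrite eq eqxx in ab.
    by rewrite /D distrC -natrB ?(ltnW lt)// normr_nat ler1n subn_gt0.
  by rewrite /D -natrB ?(ltnW lt)// normr_nat ler1n subn_gt0.
pose t : R := pi / 2 / D.
have ct : cos t != -1.
  rewrite gt_eqF// (lt_le_trans (ltrN10 R))// cos_ge0_pihalf// -ler_norml.
  rewrite normrM normfV ger0_norm ?divr_ge0 ?pi_ge0// ler_pdivrMr ?normr_gt0//.
  by rewrite ler_peMr// divr_ge0// pi_ge0.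
have cs : cos t ^+ 2 + sin t ^+ 2 = 1 by exact: cos2Dsin2.
pose rot := rotation (cos t) (sin t).
have E z : cmoment_fun a b (rot z) = Complex 0 1 * cmoment_fun a b z.
  rewrite /cmoment_fun cplx_rotation.
  have -> : disk_weight (rot z) = disk_weight z.
    have cE : cmod (rot z) = cmod z by rewrite !cmodE cmod2_rotation.
    have dE : (rot z \in unit_disk) = (z \in unit_disk).
      by apply/idP/idP; rewrite !inE /unit_disk/= cE.
    by rewrite /disk_weight !patchE dE cE.
  rewrite rmorphM !exprMn mulrACA unit_circle_pow -/D /t divfK// cos_pihalf sin_pihalf.
  by rewrite [RHS]mulrCA.
have [m1 m2] := cmoment_measurable a b.
have [i1 e1] := cint_scale (Complex 0 1) (cmoment_integrable a b).
have [||||_ e2] := @cint_image R _ _ _ _ rot area area (cmoment_fun a b) (measurable_rotation _ _).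
- by move=> A mA; exact/esym/area_rotation.
- exact/measurable_EFinP.
- exact/measurable_EFinP.
- by rewrite (_ : _ \o _ = fun z => Complex 0 1 * cmoment_fun a b z)//; apply/funext => z; exact: E.
move: e2; rewrite (_ : _ \o _ = fun z => Complex 0 1 * cmoment_fun a b z); last first.
  by apply/funext => z; exact: E.
rewrite e1 => /eqP; rewrite -subr_eq0 -[X in X - _]mul1r -mulrBl mulf_eq0 => /orP[|/eqP//].
by rewrite eq_complex/= subr0 oner_eq0.
Qed.

Lemma prod_cmod_vandermonde n (z : n.-tuple (R * R)) :
  (\prod_(j < n) \prod_(k < n | (j < k)%N) cmod (tnth z k - tnth z j) ^+ 2)%:C%C =
  \sum_(s : 'S_n) \sum_(t : 'S_n) (-1) ^+ s * (-1) ^+ t *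
    \prod_(i < n) (cplx (tnth z i) ^+ s i * (cplx (tnth z i))^*%C ^+ t i).
Proof.
pose V : 'M[C]_n := Vandermonde n (\row_i cplx (tnth z i)).
have VE : \det V = \sum_(s : 'S_n) (-1) ^+ s * \prod_(i < n) cplx (tnth z i) ^+ s i.
  (* Transposing places the exponent s i on the variable z_i, so that each term is a product over
     the points. *)
  rewrite -det_tr /determinant; apply: eq_bigr => s _; congr (_ * _).
  by apply: eq_bigr => i _; rewrite !mxE.
have VJ : (\det V)^*%C = \sum_(t : 'S_n) (-1) ^+ t * \prod_(i < n) (cplx (tnth z i))^*%C ^+ t i.
  rewrite VE rmorph_sum; apply: eq_bigr => t _.
  rewrite rmorphM rmorphXn rmorphN1 rmorph_prod; congr (_ * _).
  by apply: eq_bigr => i _; rewrite rmorphXn.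
transitivity (\det V * (\det V)^*%C).
  rewrite det_Vandermonde !rmorph_prod -big_split; apply: eq_bigr => j _.
  rewrite !rmorph_prod -big_split; apply: eq_bigr => k _.
  rewrite !mxE /=.
  have -> : cplx (tnth z k) - cplx (tnth z j) = cplx (tnth z k - tnth z j).
    by apply/eqP; rewrite eq_complex/= !eqxx.
  by rewrite cplx_mul_conj cmodE sqr_sqrtr// addr_ge0// sqr_ge0.
rewrite VJ VE mulr_suml; apply: eq_bigr => s _; rewrite mulr_sumr; apply: eq_bigr => t _.
by rewrite mulrACA -big_split.
Qed.

Let disk_moment j := \int[area]_(z in unit_disk) (cmod2 z ^+ j * w (cmod z)).

Lemma disk_partition_function n (K : R) :
  \int[tuple_measure area n]_(z in [set z : n.-tuple (R * R) | forall j, unit_disk (tnth z j)])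
    (K * (\prod_(j < n) w (cmod (tnth z j))) *
     \prod_(j < n) \prod_(k < n | (j < k)%N) cmod (tnth z k - tnth z j) ^+ 2) =
  K * (n`!%:R * \prod_(j < n) disk_moment j).
Proof.
pose F (s t : 'S_n) (z : n.-tuple (R * R)) : C :=
  \prod_(i < n) cmoment_fun (s i) (t i) (tnth z i).
pose G (z : n.-tuple (R * R)) : C :=
  \sum_(s : 'S_n) \sum_(t : 'S_n) ((-1) ^+ s * (-1) ^+ t) * F s t z.
pose S : set (n.-tuple (R * R)) := [set z | forall j, unit_disk (tnth z j)].
have FI (s t : 'S_n) := @cint_tuple R _ _ area n (fun i => cmoment_fun (s i) (t i))
  (fun i => cmoment_integrable (s i) (t i)).
have [GI GE] : cintegrable (tuple_measure area n) G /\
    cint (tuple_measure area n) G = (n`!%:R * \prod_(j < n) disk_moment j)%:C%C.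
  have H2 (s t : 'S_n) := cint_scale ((-1) ^+ s * (-1) ^+ t) (FI s t).1.
  have H1 (s : 'S_n) := @cint_sum R _ _ (tuple_measure area n) _
    (index_enum _) predT _ (fun t _ => (H2 s t).1).
  have [GI ->] := @cint_sum R _ _ (tuple_measure area n) _
    (index_enum _) predT _ (fun s _ => (H1 s).1).
  split; first exact: GI.
  transitivity (\sum_(s : 'S_n) \prod_(j < n) (disk_moment j)%:C%C : C).
    (* Only t = s survives: otherwise the permutations differ at some i, whose factor vanishes. For
       t = s the signs cancel and reindexing by s gives the same product for each of the n!
       permutations. *)
    apply: eq_bigr => s _; rewrite (H1 s).2 (bigD1 s)//= big1 ?addr0.
      rewrite (H2 s s).2 (FI s s).2 -expr2 sqrr_sign mul1r.
      rewrite [RHS](reindex_inj (@perm_inj _ s)); apply: eq_bigr => i _.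
      exact: cmoment_diag.
    move=> t ts; rewrite (H2 s t).2 (FI s t).2.
    have [i si] : exists i, s i != t i.
      apply/existsP; apply: contraR ts; rewrite negb_exists => /forallP h.
      by apply/eqP/permP => i; apply/eqP; move: (h i); rewrite negbK eq_sym.
    by rewrite (bigD1 i)//= cmoment_offdiag// mul0r mulr0.
  rewrite sumr_const card_Sn rmorphM rmorph_nat rmorph_prod mulr_natl.
  by [].
have KG z : K%:C%C * G z = ((fun z : n.-tuple (R * R) => K * (\prod_(j < n) w (cmod (tnth z j))) *
     \prod_(j < n) \prod_(k < n | (j < k)%N) cmod (tnth z k - tnth z j) ^+ 2) \_ S z)%:C%C.
  transitivity (K%:C%C * ((\prod_(j < n) disk_weight (tnth z j))%:C%C *
      (\prod_(j < n) \prod_(k < n | (j < k)%N) cmod (tnth z k - tnth z j) ^+ 2)%:C%C)).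
    congr (_ * _); rewrite prod_cmod_vandermonde mulr_sumr; apply: eq_bigr => s _.
    rewrite mulr_sumr; apply: eq_bigr => t _; rewrite mulrCA; congr (_ * _).
    by rewrite rmorph_prod -big_split.
  rewrite -!rmorphM patchE mulrA; congr (_%:C)%C; case: ifPn => [|].
    rewrite inE => Sz; congr (_ * _ * _); apply: eq_bigr => j _.
    by rewrite /disk_weight patchE mem_set.
  move=> /negP; rewrite inE => nS.
  have [j nj] : exists j, ~ unit_disk (tnth z j) by apply/existsNP.
  by rewrite (bigD1 j)//= /disk_weight patchE memNset// !(mul0r, mulr0).
have [_ KE] := cint_scale K%:C%C GI.
rewrite Rintegral_mkcond -/S.
transitivity (complex.Re (cint (tuple_measure area n) (fun z => K%:C%C * G z))).
  by apply: eq_Rintegral => z _; rewrite KG.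
by rewrite KE GE complex_ReZ.
Qed.

End complex_moments.

(** * Expansions of the partition function *)

Section hard_wall.
Context {R : realType}.
Local Notation mR := (measurableTypeR R).
Local Notation lam := (@lebesgue_measure R).

Lemma ln_prod_ord n (F : nat -> R) : (forall k, 0 < F k) ->
  ln (\prod_(j < n) F j) = \sum_(j < n) ln (F j).
Proof.
move=> F0; elim: n => [|n IH]; first by rewrite !big_ord0 ln1.
by rewrite !big_ord_recr/= -IH lnM ?posrE// prodr_gt0.
Qed.

Lemma half_line_integral_gt0 (f : R -> R) : (forall x, 0 < f x) -> continuous f ->
  lam.-integrable `[0%R, +oo[ (EFin \o f) -> 0 < \int[lam]_(x in `[0, +oo[) f x.
Proof.
move=> f0 cf fi.
have [|c c01 fc] := @EVT_min R f 0 1 ler01.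
  by apply: continuous_subspaceT => x; exact: cf.
have mI : measurable (`[0%R, +oo[%classic : set mR) by [].
have mJ : measurable (`[(0 : R), 1]%classic : set mR) by [].
have mf D : measurable_fun (D : set mR) (EFin \o f).
  by apply/measurable_EFinP; apply: measurable_funTS; exact: continuous_measurable_fun.
have JE : (\int[lam]_(x in `[0%R, 1%R]) (f c)%:E = (f c)%:E)%E.
  have L : lam `[(0 : R), 1] = 1%:E by rewrite lebesgue_measure_itv/= lte_fin ltr01 -EFinB subr0.
  by rewrite integral_cst// [X in (_ * X)%E]L mule1.
rewrite fine_gt0//; apply/andP; split; last first.
  have /integrable_fin_num := fi => /(_ mI).
  by rewrite ge0_fin_numE// integral_ge0// => x _; rewrite lee_fin ltW.
apply: (@lt_le_trans _ _ (f c)%:E); first by rewrite lte_fin.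
apply: (@le_trans _ _ (\int[lam]_(x in `[0%R, 1%R]) (f x)%:E)%E).
  rewrite -[X in (X <= _)%E]JE; apply: ge0_le_integral => //.
  by move=> x _; rewrite lee_fin ltW.
apply: (ge0_subset_integral lam mJ mI (mf _)).
  by move=> x _; rewrite lee_fin ltW.
by move=> x /=; rewrite !in_itv/= andbT => /andP[].
Qed.

Variable q : R -> R.
Hypothesis qrad : radial_potential q.
Hypothesis q1_le0 : derive1 q 1 <= 0.

Let qsm : smooth_pos q := qrad.1.

(** r q'(r) is increasing and at most 0 at r = 1, hence q' <= 0 on (0, 1]: on the punctured disk the
    weight e^{-N q} is largest at the wall. *)
Lemma potential_ge_wall (r : R) : 0 < r <= 1 -> q 1 <= q r.
Proof.
move=> /andP[r0]; rewrite le_eqVlt => /predU1P[->//|r1].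
have dq (s : R) : 0 < s -> is_derive s 1 q (derive1 q s) := smooth_is_derive qsm 0 (r := s).
have [x xr||x] := @MVT R q (derive1 q) r 1 r1.
- by move: xr; rewrite in_itv/= => /andP[rx _]; apply: dq; exact: lt_trans rx.
- apply: continuous_in_subspaceT => x; rewrite inE/= in_itv/= => /andP[rx _].
  exact: is_derive_continuous (dq _ (lt_le_trans r0 rx)).
rewrite in_itv/= => /andP[rx x1] E.
have x0 := lt_trans r0 rx.
have := rderive_incr qsm qrad.2 x0 x1; rewrite mul1r => h.
have qx : derive1 q x <= 0 by rewrite -(pmulr_rle0 _ x0) ltW// (lt_le_trans h).
by rewrite -subr_le0 E mulr_le0_ge0// subr_ge0 ltW.
Qed.

Lemma gpot_ge0 (t : R) : 0 <= t -> 0 <= gpot q t.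
Proof.
by move=> t0; rewrite subr_ge0 potential_ge_wall// expR_gt0 -expR0 ler_expR oppr_le0.
Qed.

Definition laplace_moment (N : nat) (d : R) (k : nat) : R :=
  \int[lam]_(s in `[0, +oo[) expR (- (2 * (d * k%:R) * s + N%:R * gpot q (d * s))).

Lemma laplace_moment_gt0 N d k : 0 < d -> (0 < k)%N -> 0 < laplace_moment N d k.
Proof.
move=> d0 k0; have x0 : 0 < d * k%:R by rewrite mulr_gt0// ltr0n.
have cf : continuous (fun s : R => expR (- (2 * (d * k%:R) * s + N%:R * gpot q (d * s)))).
  move=> s; have h := @is_derive_gpot R q qsm.
  by eapply is_derive_continuous; isd_step.
apply: half_line_integral_gt0 => //; first by move=> x; exact: expR_gt0.
have [||||iE _] := @ge0_half_line_FTC R (fun s => expR (- (2 * (d * k%:R) * s)))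
    (fun s => - (2 * (d * k%:R))^-1 * expR (- (2 * (d * k%:R) * s))) 0.
- by move=> s _; exact: expR_ge0.
- by move=> s _; isd; field; rewrite !gt_eqF ?ltr0n.
- by move=> s _; eapply is_derive_continuous; isd_step.
- rewrite -[X in _ --> X](mulr0 (- (2 * (d * k%:R))^-1)); apply: cvgMr.
  rewrite (_ : (fun s => _) = (fun y => expR (- y)) \o (fun s => s * (2 * (d * k%:R)))); last first.
    by apply/funext => s; rewrite /= mulrC.
  apply: cvg_comp (@cvgr_expR R); apply: gt0_cvgMly; last exact: cvg_id.
  by rewrite mulr_gt0.
apply: half_line_le_integrable iE => [s _|s s0]; first exact: cf.
rewrite ger0_norm ?expR_ge0// ler_expR lerN2 lerDl mulr_ge0//.
by rewrite gpot_ge0// mulr_ge0// ltW.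
Qed.

(** Pulling e^{-N q(1)} out of each of the N weights leaves a weight bounded by 1 on 0 < r <= 1 and
    produces - N^2 q(1). The scale d stays free here and is fixed only in the asymptotics. *)
Lemma ln_Zhard N d : 0 < d ->
  ln (Zhard q N / (2 * pi) ^+ N) =
  - N%:R ^+ 2 * q 1 + \sum_(1 <= k < N.+1) ln (d * laplace_moment N d k).
Proof.
move=> d0; pose w r := expR (- (N%:R * (q r - q 1))).
have cw (r : R) : 0 < r -> {for r, continuous w}.
  move=> r0; have h := smooth_is_derive qsm 0 r0.
  eapply is_derive_continuous; rewrite /w; isd_step.
have w0 r : 0 <= w r by exact: expR_ge0.
have w1 (r : R) : 0 < r <= 1 -> w r <= 1.
  by move=> r01; rewrite -expR0 ler_expR oppr_le0 mulr_ge0// subr_ge0 potential_ge_wall.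
pose K := expR (- N%:R ^+ 2 * q 1).
have ZE : Zhard q N = K * \prod_(j < N) (2 * pi * (d * laplace_moment N d j.+1)).
  rewrite /Zhard; under eq_Rintegral => z _.
    rewrite /boltzmann (_ : expR _ = K * \prod_(j < N) w (cmod (tnth z j))); last first.
      rewrite /w /K -expR_sum -expRD; congr expR.
      rewrite sumrN -mulr_sumr sumrB sumr_const card_ord -[q 1 *+ N]mulr_natl.
      ring.
    over.
  rewrite (disk_partition_function cw w0 w1) mulrCA mulKf ?pnatr_eq0 -?lt0n ?fact_gt0//.
  congr (_ * _); apply: eq_bigr => j _; rewrite (radial_moment cw w0 w1 j d0) [RHS]mulrA.
  congr (_ * _); rewrite /laplace_moment; apply: eq_Rintegral => s _.
  by rewrite /w -expRD opprD.
have L0 (k : nat) : (0 < k)%N -> 0 < d * laplace_moment N d k.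
  by move=> k0; rewrite mulr_gt0// laplace_moment_gt0.
have pi0 := pi_gt0 R.
rewrite ZE big_split/= prodr_const card_ord mulrCA mulrAC divff ?mul1r; last first.
  by rewrite expf_neq0// mulf_neq0// gt_eqF.
rewrite big_add1/= big_mkord lnM ?posrE ?expR_gt0//; last first.
  by apply: prodr_gt0 => j _; exact: L0.
rewrite expRK; congr (_ + _).
by apply: (@ln_prod_ord N (fun j => d * laplace_moment N d j.+1)) => j; exact: L0.
Qed.

Let g_at0 := gpot_at0 qsm.
Let dg (t : R) (_ : 0 <= t) := is_derive_gpot qsm t.
Let dg1 (t : R) (_ : 0 <= t) := is_derive_gpot1 qsm t.
Let dg2 (t : R) (_ : 0 <= t) := is_derive_gpot2 qsm t.
Let g2_gt0 (t : R) (_ : 0 <= t) := gpot2_gt0 qsm qrad.2 t.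

Lemma ln_Zhard_inside : 1 < eta q ->
  (fun N : nat => ln (Zhard q N / (2 * pi) ^+ N) - expansion_inside q N) @ \oo --> (0 : R).
Proof.
move=> h1; have [g00 g10 g20 g30] := g_at0.
have [t0 [C [t00 lipg]]] := gpot3_lipschitz qsm.
set a := - derive1 q 1 in g10; set b := laplQ q 1 in g20.
have aE : a = 2 * (eta q - 1) by rewrite /eta /a; field.
(* Strict positivity of - q'(1) is exactly eta > 1; it makes the linear term of g dominate near the
   wall. *)
have a0 : 0 < a by rewrite aE mulr_gt0// subr_gt0.
have [K K0 HK] := laplace_inside dg dg1 dg2 g00 g10 g20 g2_gt0 t00 lipg a0.
pose L (N k : nat) : R := N%:R^-1 * laplace_moment N N%:R^-1 k.
have HL (N k : nat) : (0 < k <= N)%N -> let e := N%:R^-1 in let x := e * k%:R in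
    `|L N k - e / (a + 2 * x) * (1 - e * b / (a + 2 * x) ^+ 2)| <= K * e ^+ 3 / (1 + x) ^+ 3.
  move=> /andP[k0 kN]; cbv zeta; set e : R := N%:R^-1; set x := e * k%:R.
  have N0 : (0 < N)%N by exact: leq_trans kN.
  have e0 : 0 < e by rewrite invr_gt0 ltr0n.
  have x0 : 0 <= x by rewrite mulr_ge0// ltW.
  have Ne : N%:R * e = 1 by rewrite /e divff// pnatr_eq0 -lt0n.
  have := HK N%:R e x e0 _ Ne x0; rewrite ler1n => /(_ N0) H.
  rewrite /L -/e -mulrA -mulrBr normrM (gtr0_norm e0).
  rewrite (_ : K * e ^+ 3 / (1 + x) ^+ 3 = e * (K * e ^+ 2 / (1 + x) ^+ 3)); last by ring.
  by rewrite ler_pM2l.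
have := inside_asymptotics a0 K0 HL.
apply: cvg_trans; apply: near_eq_cvg; near=> N.
have N0 : (0 < N)%N by near: N; exact: nbhs_infty_gt.
rewrite (@ln_Zhard N N%:R^-1) ?invr_gt0 ?ltr0n// /expansion_inside.
rewrite /L; set S := \sum_(_ <= _ < _) _; rewrite -/b aE.
set h := eta q; have hh : 1 < h by [].
have h10 : 0 < h - 1 by rewrite subr_gt0.
have h0 : 0 < h by exact: lt_trans hh.
have h1h : 1 - h < 0 by rewrite subr_lt0.
rewrite (_ : 2 * (h - 1) + 2 = 2 * h); last by ring.
rewrite ln_div ?posrE// !lnM ?posrE//.
(* Partial fractions bring the constant to the difference of end values of [Av] over [0, 1]. *)
have -> : b / (4 * h * (1 - h)) = b / 2 * ((2 * h)^-1 - (2 * (h - 1))^-1).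
  by field; rewrite (gt_eqF h0) (gt_eqF h10) (lt_eqF h1h).
by set B := b / 2 * _; field.
Unshelve. all: by end_near.
Qed.

Lemma ln_Zhard_edge : eta q = 1 ->
  (fun N : nat => ln (Zhard q N / (2 * pi) ^+ N) - expansion_edge q N) @ \oo --> (0 : R).
Proof.
move=> h1; have [g00 g10 g20 g30] := g_at0.
have [t0 [C [t00 lipg]]] := gpot3_lipschitz qsm.
have q10 : derive1 q 1 = 0.
  have -> : derive1 q 1 = 2 * (1 - eta q) by rewrite /eta; field.
  by rewrite h1 subrr mulr0.
rewrite q10 oppr0 in g10; set b := laplQ q 1 in g20; set c := gpot3 q 0 in g30 lipg.
have b0 : 0 < b by exact: qrad.2.
have [K K0 HK] := laplace_edge dg dg1 dg2 g00 g10 g20 (lexx 0) g2_gt0 t00 lipg (erefl 0).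
pose d0 := Num.sqrt (2 / b).
have d00 : 0 < d0 by rewrite sqrtr_gt0 divr_gt0.
pose d (N : nat) : R := d0 * (Num.sqrt N%:R)^-1.
pose L (N k : nat) : R := d N * laplace_moment N (d N) k.
have HL (N k : nat) : (0 < k <= N)%N -> let e := (Num.sqrt N%:R)^-1 in let d := d0 * e in
    let x := d * k%:R in
    `|L N k - d * (mills x - e * (c / 6 * d0 ^+ 3) * mills3 x)| <= K * e ^+ 2 * d / (1 + x) ^+ 3.
  move=> /andP[k0 kN]; cbv zeta; set e : R := (Num.sqrt N%:R)^-1.
  set dd := d0 * e; set x := dd * k%:R.
  have N0 : (0 < N)%N by exact: leq_trans kN.
  have e0 : 0 < e by rewrite invr_gt0 sqrtr_gt0 ltr0n.
  have dd0 : 0 < dd by rewrite mulr_gt0.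
  have x0 : 0 <= x by rewrite mulr_ge0// ltW.
  have Ne : N%:R * e ^+ 2 = 1.
    by rewrite /e exprVn sqr_sqrtr// divff// pnatr_eq0 -lt0n.
  have := HK N%:R e x e0 _ Ne x0; rewrite ler1n => /(_ N0) H.
  rewrite /L /d -/e -/dd -mulrBr normrM (gtr0_norm dd0).
  rewrite (_ : K * e ^+ 2 * dd / (1 + x) ^+ 3 = dd * (K * e ^+ 2 / (1 + x) ^+ 3)); last by ring.
  by rewrite ler_pM2l.
have := edge_asymptotics b0 K0 HL.
apply: cvg_trans; apply: near_eq_cvg; near=> N.
have N0 : (0 < N)%N by near: N; exact: nbhs_infty_gt.
have dN : 0 < d N by rewrite mulr_gt0// invr_gt0 sqrtr_gt0 ltr0n.
(* As c is minus the sum of 2 b and the radial derivative of Delta Q at 1, the term - (c / b)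
   [beta_out] contains an extra 2 [beta_out], which [alpha_outE] turns into - [alpha_out] and half
   of log pi. *)
rewrite (ln_Zhard N dN) /expansion_edge.
rewrite /L; set S := \sum_(_ <= _ < _) _; rewrite alpha_outE g30 -/b.
have -> : ln (pi * b / 2) = ln pi + ln (b / 2).
  by rewrite -mulrA lnM ?posrE ?pi_gt0// divr_gt0.
by field; rewrite gt_eqF.
Unshelve. all: by end_near.
Qed.

End hard_wall.

(** When both radii are infinite they do not determine the sign of q'; the condition q'(1) < 0 in
    that alternative selects the case where r0 > 1 means eta > 1. *)
Theorem theorem2p5 (R : realType) (q : R -> R) (r0 r1 : \bar R) :
  radial_potential q -> inner_radius q r0 -> outer_radius q r1 ->
  ((1%:E <= r0 /\ r0 < r1)%E \/
   [/\ r0 = +oo%E, r1 = +oo%E & derive1 q 1 < 0]) ->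
  [/\ (1%:E < r0)%E <-> 1 < eta q,
      r0 = 1%:E <-> eta q = 1,
      (1%:E < r0)%E ->
        (fun N : nat => ln (Zhard q N / (2 * pi) ^+ N) - expansion_inside q N)
          @ \oo --> (0 : R)
    & r0 = 1%:E ->
        (fun N : nat => ln (Zhard q N / (2 * pi) ^+ N) - expansion_edge q N)
          @ \oo --> (0 : R)].
Proof.
move=> qrad ir _ H; have [q1 E1 E2] := inner_radius_eta qrad.1 qrad.2 ir H.
by split=> // [/E1|/E2]; [exact: ln_Zhard_inside|exact: ln_Zhard_edge].
Qed.
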